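(* Let $A\in\mathbb{R}^{m\times n}$ be an arbitrary matrix, let $k\ge 1$ and $q\ge 0$ be integers, and let $\sigma_k,\sigma_{k+1}$ and $\overline{\Sigma}_k$ be given by the partitioned singular value decomposition of $A$ described in the context. Let $Z=A(A^{T}A)^qG\in\mathbb{R}^{m\times\ell}$, where $G\in\mathbb{R}^{n\times\ell}$ is a random matrix whose columns are independent $n$-variate standard Gaussian vectors and $\ell\le\operatorname{rank}(A)$. Then, if $\ell\ge k+2$, $$\mathbb{E}\big[\|[I_m-\Pi(Z)]A\|_F\big]\le\Big(1+\Big(\frac{\sigma_{k+1}}{\sigma_k}\Big)^{2q}\sqrt{\frac{k}{\ell-k-1}}\Big)\|\overline{\Sigma}_k\|_F.$$ Moreover, if $\ell\ge k+4$, then for all real $u,t\ge1$, the inequality $$\|[I_m-\Pi(Z)]A\|_F\le\Big(1+\sqrt3\,ut\cdot\Big(\frac{\sigma_{k+1}}{\sigma_k}\Big)^{2q}\sqrt{\frac{k}{\ell-k+1}}\Big)\|\overline{\Sigma}_k\|_F$$ holds with probability at least $1-e^{-u^2/2}-t^{-(\ell-k)}$.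
   Context: Partitioned SVD: $A=U\Sigma V^{T}$ with $U\in\mathbb{R}^{m\times m}$, $V\in\mathbb{R}^{n\times n}$ orthogonal and $\Sigma\in\mathbb{R}^{m\times n}$ (rectangular) diagonal with diagonal entries the singular values $\sigma_1\ge\dots\ge\sigma_{\min\{m,n\}}\ge 0$; for $k\le\min\{m,n\}$, $\Sigma=\begin{bmatrix}\Sigma_k&\\&\overline{\Sigma}_k\end{bmatrix}$ with $\Sigma_k\in\mathbb{R}^{k\times k}$, $\overline{\Sigma}_k\in\mathbb{R}^{(m-k)\times(n-k)}$. $\|\cdot\|_F$ is the Frobenius norm, and $\Pi(M)=MM^{\dagger}$ ($M^\dagger$ the Moore-Penrose inverse) is the orthogonal projection onto the column space of $M$. $I_m$ is the $m\times m$ identity. *)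

(* Defs.v *)
From mathcomp Require Import all_boot all_order all_algebra.
From mathcomp Require Import all_classical all_reals all_analysis.

Set Implicit Arguments.
Unset Strict Implicit.
Unset Printing Implicit Defensive.

Import Order.TTheory GRing.Theory Num.Theory.

Local Open Scope classical_set_scope.
Local Open Scope ring_scope.

Section LinearAlgebra.
Context {R : realType}.

Definition frobenius_norm {m n} (M : 'M[R]_(m, n)) : R :=
  Num.sqrt (\sum_(i < m) \sum_(j < n) M i j ^+ 2).

Record is_mp_inverse {m n} (M : 'M[R]_(m, n)) (X : 'M[R]_(n, m)) : Prop := {
  mp_mulKr : M *m X *m M = M;
  mp_mulKl : X *m M *m X = X;
  mp_symr : (M *m X)^T = M *m X;
  mp_syml : (X *m M)^T = X *m M
}.

(* The default value 0 is never used: see mp_inverseP, mp_inverse_uniq below. *)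
Definition mp_inverse {m n} (M : 'M[R]_(m, n)) : 'M[R]_(n, m) :=
  xget 0 [set X | is_mp_inverse M X].

Definition range_proj {m n} (M : 'M[R]_(m, n)) : 'M[R]_m :=
  M *m mp_inverse M.

(* sigma is indexed from 1; its values outside 1 .. minn m n are irrelevant. *)
Definition rect_diag_mx m n (sigma : nat -> R) : 'M[R]_(m, n) :=
  \matrix_(i < m, j < n) (if i == j :> nat then sigma i.+1 else 0).

Record is_svd {m n} (A : 'M[R]_(m, n)) (U : 'M[R]_m) (Sigma : 'M[R]_(m, n))
    (sigma : nat -> R) (V : 'M[R]_n) : Prop := {
  svd_eq : A = U *m Sigma *m V^T;
  svd_orthU : U^T *m U = 1%:M;
  svd_orthV : V^T *m V = 1%:M;
  svd_diag : Sigma = rect_diag_mx m n sigma;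
  svd_decr : forall i j : nat, (0 < i <= j)%N -> (j <= minn m n)%N ->
               sigma j <= sigma i;
  svd_ge0 : forall i : nat, (0 < i <= minn m n)%N -> 0 <= sigma i
}.

Lemma trail_ord_proof k n (i : 'I_(n - k)) : (k + i < n)%N.
Proof. by rewrite -ltn_subRL. Qed.

Definition trail_ord k n (i : 'I_(n - k)) : 'I_n :=
  Ordinal (trail_ord_proof i).

(* The lower right block of Sigma when its first k rows and columns are split
   off; see trail_mxE. *)
Definition trail_mx k {m n} (Sigma : 'M[R]_(m, n)) : 'M[R]_(m - k, n - k) :=
  \matrix_(i, j) Sigma (trail_ord i) (trail_ord j).

Lemma trail_mxE k m n (Sigma : 'M[R]_(m, n)) (km : (k <= m)%N) (kn : (k <= n)%N) :
  trail_mx k Sigma =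
  drsubmx (castmx (esym (subnKC km), esym (subnKC kn)) Sigma).
Proof.
apply/matrixP => i j; rewrite !mxE castmxE.
by congr (Sigma _ _); apply: val_inj.
Qed.

Lemma row_sqr_eq0 n (w : 'rV[R]_n) : w *m w^T = 0 -> w = 0.
Proof.
move=> /matrixP /(_ 0 0); rewrite !mxE => /eqP.
under eq_bigr do rewrite mxE -expr2.
rewrite psumr_eq0 => [/allP w0|j _]; last exact: sqr_ge0.
apply/rowP => j; rewrite mxE; apply/eqP; rewrite -sqrf_eq0.
by have := w0 j; rewrite mem_index_enum => /(_ isT).
Qed.

Lemma row_free_gram_unit r n (F : 'M[R]_(r, n)) :
  row_free F -> F *m F^T \in unitmx.
Proof.
move=> Ff; rewrite -row_free_unit -kermx_eq0; apply/rowV0P => v /sub_kermxP vFF.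
have {vFF} vF0 : v *m F = 0.
  apply: row_sqr_eq0.
  by rewrite trmx_mul !mulmxA -(mulmxA v) vFF mul0mx.
by apply: (row_free_inj Ff); rewrite vF0 mul0mx.
Qed.

Lemma mp_inverse_full_rank m r n (C : 'M[R]_(m, r)) (F : 'M[R]_(r, n)) :
  row_free C^T -> row_free F -> exists X, is_mp_inverse (C *m F) X.
Proof.
move=> /row_free_gram_unit CC /row_free_gram_unit FF; rewrite trmxK in CC.
pose Fi := F^T *m invmx (F *m F^T); pose Ci := invmx (C^T *m C) *m C^T.
have FFi : F *m Fi = 1%:M by rewrite mulmxA mulmxV.
have CiC : Ci *m C = 1%:M by rewrite -mulmxA mulVmx.
have MX : C *m F *m (Fi *m Ci) = C *m Ci.
  by rewrite -mulmxA (mulmxA F) FFi mul1mx.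
have XM : Fi *m Ci *m (C *m F) = Fi *m F.
  by rewrite -mulmxA (mulmxA Ci) CiC mul1mx.
exists (Fi *m Ci); split.
- by rewrite MX -mulmxA (mulmxA Ci) CiC mul1mx.
- by rewrite XM -mulmxA (mulmxA F) FFi mul1mx.
- by rewrite MX !trmx_mul trmxK trmx_inv trmx_mul trmxK mulmxA.
- by rewrite XM !trmx_mul trmxK trmx_inv trmx_mul trmxK mulmxA.
Qed.

Lemma mp_inverse_exists m n (M : 'M[R]_(m, n)) : exists X, is_mp_inverse M X.
Proof.
rewrite -(mulmx_base M); apply: mp_inverse_full_rank (row_base_free M).
by rewrite /row_free mxrank_tr; exact: col_base_full.
Qed.

Lemma mp_inverseP m n (M : 'M[R]_(m, n)) : is_mp_inverse M (mp_inverse M).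
Proof. by have [X MX] := mp_inverse_exists M; exact: (xgetI 0 MX). Qed.

Lemma mp_inverse_uniq m n (M : 'M[R]_(m, n)) X Y :
  is_mp_inverse M X -> is_mp_inverse M Y -> X = Y.
Proof.
move=> [MXM XMX sMX sXM] [MYM YMY sMY sYM].
have MXY : M *m X = M *m Y.
  by rewrite -sMX -{1}MYM -(mulmxA (M *m Y)) trmx_mul sMX sMY mulmxA MXM.
have XYM : X *m M = Y *m M.
  by rewrite -sXM -{1}MYM -(mulmxA M) (mulmxA X) trmx_mul sXM sYM -mulmxA (mulmxA M) MXM.
by rewrite -XMX -mulmxA MXY mulmxA XYM YMY.
Qed.

End LinearAlgebra.

Section GaussianMatrix.
Context {R : realType} {d : measure_display} {T : measurableType d}.
Variable P : probability T R.

Definition mutually_independent {d' : measure_display} {T' : measurableType d'}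
    {I : finType} (X : I -> T -> T') : Prop :=
  forall (J : {set I}) (B : I -> set T'), (forall i, measurable (B i)) ->
    P (\bigcap_(i in [set` J]) (X i @^-1` B i)) =
    (\prod_(i in J) P (X i @^-1` B i))%E.

Record std_gaussian_vector {n : nat} (X : T -> n.-tuple R) : Prop := {
  gaussv_measurable : measurable_fun [set: T] X;
  gaussv_law : forall (i : 'I_n) (B : set R), measurable B ->
    P ((fun w => tnth (X w) i) @^-1` B) = normal_prob 0 1 B;
  gaussv_indep : mutually_independent (fun (i : 'I_n) w => tnth (X w) i)
}.

(* Columns are encoded as tuples, which carry the product sigma-algebra. *)
Definition col_tuple {n l : nat} (M : 'M[R]_(n, l)) (j : 'I_l) : n.-tuple R :=
  [tuple M i j | i < n].

Record std_gaussian_mx {n l : nat} (G : T -> 'M[R]_(n, l)) : Prop := {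
  gaussm_cols : forall j, std_gaussian_vector (fun w => col_tuple (G w) j);
  gaussm_indep : mutually_independent (fun j w => col_tuple (G w) j)
}.

End GaussianMatrix.

(* Main.v *)
(* Write Omega = V^T G, which again has independent standard normal entries, and
   let Omega_1 be its first k rows, H the pseudo-inverse of Omega_1 and omega_i
   its later rows. Since the residual is at most |A - Z X|_F for every X,
   choosing X = H diag(sigma_j^(-2q)) V_k^T gives almost surely
     err <= |Sigmabar_k|_F + (sigma_(k+1)/sigma_k)^(2q) sqrt(S),
     S = sum_(i > k) sigma_i^2 sum_(j <= k) <omega_i, h_j>^2.
   Given H, <omega_i, h_j> is |h_j| times a standard normal variable, and |h_j| is
   at most the inverse of the distance from row j of Omega_1 to the span of the
   other rows, whose law is chi with N = l-k+1 degrees of freedom. Integration by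
   parts therefore bounds E |<omega_i, h_j>|^s for s < N; s = 2 yields the bound in
   expectation, and Markov's inequality with s adapted to u and t the tail. *)
Require Import Defs.
From HB Require Import structures.
From mathcomp Require Import all_boot all_order all_algebra.
From mathcomp Require Import all_classical all_reals all_analysis.
From mathcomp Require Import measurable_realfun ring lra zify.

Set Implicit Arguments.
Unset Strict Implicit.
Unset Printing Implicit Defensive.

Import Order.TTheory GRing.Theory Num.Theory.
Import numFieldNormedType.Exports.

Local Open Scope classical_set_scope.
Local Open Scope ring_scope.

(** * Independent normal families *)

Section Families.
Context {R : realType}.

(** Independence enters as a product formula for boxes, so conditioning is expressed by redrawing a
    set of coordinates from a second copy of the space: the mixed family on [P \x P] has the same
    law, and Tonelli integrates the redrawn part with the rest frozen. Rotation invariance, the chi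
    recurrence, the almost sure invertibility and the moments given H all rest on this.

    The terms of S are dependent, so S is never treated through its law: only the moments of each
    single <omega_i, h_j> are bounded, and the weights sigma_i^2, of total k |Sigmabar_k|_F^2 over
    all pairs (i, j), carry them to S, by linearity for s = 2 and by convexity for larger s. This is
    where the k under the root comes from.

    Exponents must stay below N = l-k+1. When u^2 >= N/2 the largest one, N-1 = l-k, is taken, and
    it produces the term t^-(l-k). The 3 under the root comes from the other range: with s about x =
    u^2 the requirement is roughly N / (6 (N - x)) <= 1/e, which at the end x = N/2 reads 1/3 <=
    1/e. *)

Definition boxes (I : finType) : set (set (I -> R)) :=
  [set A | exists2 B : I -> set R, (forall i, measurable (B i)) &
     A = [set x | forall i, B i (x i)]].

(** An arbitrary finite index type is allowed because families are later indexed by matrix positions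
    and by rows of type [option], and are restricted along injections. *)
Definition fam (I : finType) : measurableType _ := g_sigma_algebraType (@boxes I).

Lemma boxes_setI (I : finType) : setI_closed (@boxes I).
Proof.
move=> _ _ [B mB ->] [C mC ->]; exists (fun i => B i `&` C i).
  by move=> i; exact: measurableI.
apply/seteqP; split=> [x [xB xC] i|x xBC]; first by split.
by split=> i; have [] := xBC i.
Qed.

Lemma boxes_setT (I : finType) : @boxes I setT.
Proof. by exists (fun=> setT) => //; apply/seteqP; split. Qed.

Lemma measurable_eval (I : finType) (i : I) :
  measurable_fun setT (fun x : fam I => x i).
Proof.
move=> _ B mB; rewrite setTI; apply: sub_sigma_algebra.
exists (fun j => if j == i then B else setT).
  by move=> j; case: ifP.
apply/seteqP; split=> [x Bx j|x /(_ i)]; last by rewrite eqxx.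
by case: eqP => // ->.
Qed.

Lemma box_bigcap (I : finType) T (X : I -> T -> R) (B : I -> set R) :
  [set w | forall i, B i (X i w)] = \bigcap_(i in [set: I]) X i @^-1` B i.
Proof. by apply/seteqP; split=> [w Bw i _|w Bw i]; exact: Bw. Qed.

Section OnSpace.
Context {d : measure_display} {T : measurableType d}.

Lemma measurable_box (I : finType) (X : I -> T -> R) (B : I -> set R) :
  (forall i, measurable_fun setT (X i)) -> (forall i, measurable (B i)) ->
  measurable [set w | forall i, B i (X i w)].
Proof.
move=> mX mB; rewrite box_bigcap; apply: fin_bigcap_measurable => // i _.
by rewrite -[_ @^-1` _]setTI; exact: mX.
Qed.

Lemma measurable_fam (I : finType) (X : I -> T -> R) :
  (forall i, measurable_fun setT (X i)) ->
  measurable_fun setT (fun w => (fun i => X i w) : fam I).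
Proof.
move=> mX; apply: (@measurability _ _ T (fam I) setT _ (@boxes I)) => // _ [_ [B mB ->] <-].
by rewrite setTI; exact: measurable_box.
Qed.

End OnSpace.

(** One product formula over full boxes suffices: a subfamily is reached by taking [B i = setT]
    elsewhere, and [B = setT] throughout gives total mass 1. [P] is a plain measure so that [P \x P]
    is covered too. *)
Definition iid_normal {d} {T : measurableType d} (P : {measure set T -> \bar R})
    (I : finType) (X : I -> T -> R) : Prop :=
  (forall i, measurable_fun setT (X i)) /\
  forall B : I -> set R, (forall i, measurable (B i)) ->
    P [set w | forall i, B i (X i w)] = (\prod_i normal_prob 0 1 (B i))%E.

(** Boxes form a pi-system containing the whole space, so the product formula determines the law of
    the family. The two underlying spaces may differ, as [T] and [T * T] do below. *)
Lemma iid_normal_transfer {d d'} {T : measurableType d} {T' : measurableType d'}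
    (P : {measure set T -> \bar R}) (P' : {measure set T' -> \bar R}) (I : finType)
    (X : I -> T -> R) (X' : I -> T' -> R) (f : fam I -> \bar R) :
  iid_normal P X -> iid_normal P' X' ->
  @measurable_fun _ _ (fam I) (\bar R) setT f -> (forall x, 0 <= f x)%E ->
  (\int[P]_w f (X ^~ w) = \int[P']_w f (X' ^~ w))%E.
Proof.
move=> [mX PX] [mX' PX'] mf f0.
have mF := measurable_fam mX; have mF' := measurable_fam mX'.
pose phi w : fam I := X ^~ w; pose phi' w : fam I := X' ^~ w.
rewrite -(@ge0_integral_pushforward _ _ _ _ _ phi mF P setT f)//.
rewrite -(@ge0_integral_pushforward _ _ _ _ _ phi' mF' P' setT f)//.
apply: eq_measure_integral => A mA _.
pose p : {mfun T >-> fam I} := HB.pack phi (isMeasurableFun.Build _ _ _ _ phi mF).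
pose p' : {mfun T' >-> fam I} := HB.pack phi' (isMeasurableFun.Build _ _ _ _ phi' mF').
apply: (@measure_unique _ R (fam I) (@boxes I) (fun=> setT) _ _ _ _
  (pushforward P p) (pushforward P' p')) => //.
- exact: boxes_setI.
- by move=> _; exact: boxes_setT.
- by rewrite bigcup_const.
- by move=> _ [B mB ->]; rewrite /= /pushforward /= PX// PX'.
- move=> _; rewrite /= /pushforward preimage_setT.
  have := PX (fun=> setT) (fun=> measurableT).
  rewrite (_ : mkset _ = setT); last by apply/seteqP; split.
  by move=> ->; rewrite big1 ?ltry// => i _; exact: probability_setT.
Qed.

Lemma measurable_if_fam {d d'} {T : measurableType d} {T' : measurableType d'}
    (I : finType) (S : pred I) (X : I -> T -> R) (Y : I -> T' -> R) :
  (forall i, measurable_fun setT (X i)) -> (forall i, measurable_fun setT (Y i)) ->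
  measurable_fun setT (fun ww : T * T' =>
    (fun i => if S i then Y i ww.2 else X i ww.1) : fam I).
Proof.
move=> mX mY; apply: measurable_fam => i; case: (S i).
  exact: measurableT_comp (mY i) measurable_snd.
exact: measurableT_comp (mX i) measurable_fst.
Qed.

(** This is the substitute for conditioning on the coordinates outside [S]: the family taking its
    [S]-coordinates from [w'] and the others from [w] is again iid under [P \x P]. *)
Lemma iid_normal_resample {d} {T : measurableType d} (P : probability T R)
    (I : finType) (S : pred I) (X : I -> T -> R) (f : fam I -> \bar R) :
  iid_normal P X -> measurable_fun setT f -> (forall x, 0 <= f x)%E ->
  (\int[P]_w f (X ^~ w) =
   \int[P]_w \int[P]_w' f (fun i => if S i then X i w' else X i w))%E.
Proof.
move=> iX mf f0; have [mX PX] := iX.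
pose Y i (ww : T * T) := if S i then X i ww.2 else X i ww.1.
have mY : measurable_fun setT (fun ww => Y ^~ ww : fam I).
  exact: measurable_if_fam.
rewrite (@iid_normal_transfer _ _ _ _ P (P \x P)%E _ X Y f)//; last first.
  split=> [i|B mB].
    rewrite /Y; case: (S i); first exact: measurableT_comp (mX i) measurable_snd.
    exact: measurableT_comp (mX i) measurable_fst.
  pose B1 i := if S i then setT else B i; pose B2 i := if S i then B i else setT.
  rewrite (_ : mkset _ = [set w | forall i, B1 i (X i w)] `*`
      [set w | forall i, B2 i (X i w)]); last first.
    apply/seteqP; split=> [[w w'] /= BY|[w w'] /= [h1 h2] i].
      by split=> i; have := BY i; rewrite /Y /B1 /B2; case: (S i).
    by have := h1 i; have := h2 i; rewrite /Y /B1 /B2; case: (S i).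
  have mB1 i : measurable (B1 i) by rewrite /B1; case: (S i).
  have mB2 i : measurable (B2 i) by rewrite /B2; case: (S i).
  rewrite [LHS](@product_measure1E _ _ T T R P P);
    [|exact: measurable_box|exact: measurable_box].
  transitivity (P [set w | forall i, B1 i (X i w)] *
    P [set w | forall i, B2 i (X i w)])%E; first by [].
  rewrite !PX// -big_split; apply: eq_bigr => i _ /=.
  by rewrite /B1 /B2; case: (S i); rewrite probability_setT ?mul1e ?mule1.
rewrite (@fubini_tonelli1 _ _ T T R P P (fun ww => f (Y ^~ ww)))//.
exact: measurableT_comp mf mY.
Qed.

Lemma iid_normal_sub {d} {T : measurableType d} (P : {measure set T -> \bar R})
    (I J : finType) (e : J -> I) (X : I -> T -> R) :
  injective e -> iid_normal P X -> iid_normal P (fun j => X (e j)).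
Proof.
move=> e_inj [mX PX]; split=> [//|B mB].
pose B' i := if [pick j | e j == i] is Some j then B j else setT.
have B'e j : B' (e j) = B j.
  rewrite /B'; case: pickP => [j' /eqP /e_inj -> //|/(_ j)].
  by rewrite eqxx.
rewrite (_ : mkset _ = [set w | forall i, B' i (X i w)]); last first.
  apply/seteqP; split=> [w /= BX i|w /= BX j].
    rewrite /B'; case: pickP => [j /eqP <-|//]; exact: BX.
  by have := BX (e j); rewrite B'e.
rewrite PX; last by move=> i; rewrite /B'; case: pickP.
pose h' i := [pick j | e j == i].
rewrite (bigID (fun i => h' i))/= [X in (_ * X)%E]big1 ?mule1; last first.
  by move=> i; rewrite /B' /h'; case: pickP => // *; exact: probability_setT.
rewrite (reindex_omap e h'); last first.
  by move=> i; rewrite /h'; case: pickP => //= j /eqP ->.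
apply: eq_big => [j|j _]; last by rewrite B'e.
rewrite /h'; case: pickP => [j' /eqP /e_inj -> /=|/(_ j)]; rewrite ?eqxx//.
Qed.

End Families.

(** * Integrals against the normal density, and rotations of the plane *)

Section NormalIntegral.
Context {R : realType}.
Notation mu := (@lebesgue_measure R).
Notation N01 := (@normal_prob R 0 1).
Notation pdf := (@normal_pdf R 0 1).

Lemma measurable_pdf : measurable_fun setT (fun x => (pdf x)%:E).
Proof. by apply/measurable_EFinP; exact: measurable_normal_pdf. Qed.

(** The Radon-Nikodym derivative of the normal law allows the change of variables, and it equals
    [pdf] almost everywhere because both have the same integrals over measurable sets. *)
Lemma ge0_integral_normal (f : R -> \bar R) :
  measurable_fun setT f -> (forall x, 0 <= f x)%E ->
  (\int[N01]_x f x = \int[mu]_x (f x * (pdf x)%:E))%E.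
Proof.
move=> mf f0.
have dom : normal_prob 0 1 `<< mu := normal_prob_dominates 0 1.
rewrite -(Radon_Nikodym_SigmaFinite.change_of_variables dom f0)//.
set g := Radon_Nikodym_SigmaFinite.f _ _.
have ig : mu.-integrable setT g := Radon_Nikodym_SigmaFinite.f_integrable dom.
apply: ae_eq_integral => //.
- by apply: emeasurable_funM => //; exact: measurable_int ig.
- by apply: emeasurable_funM => //; exact: measurable_pdf.
apply: ae_eqe_mul2l.
apply: integral_ae_eq => //; first exact: measurable_pdf.
by move=> E _ mE; rewrite -(Radon_Nikodym_SigmaFinite.f_integral dom mE).
Qed.

Lemma ge0_integral_translation (g : R -> \bar R) (c : R) :
  measurable_fun setT g -> (forall x, 0 <= g x)%E ->
  (\int[mu]_x g (x + c)%R = \int[mu]_x g x)%E.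
Proof.
move=> mg g0.
pose phi (x : measurableTypeR R) : measurableTypeR R := x + c.
have mphi : measurable_fun setT phi by exact: measurable_funD.
rewrite -(@ge0_integral_pushforward _ _ _ _ _ phi mphi mu setT g)//.
apply: eq_measure_integral => A mA _.
pose p : {mfun measurableTypeR R >-> measurableTypeR R} :=
  HB.pack phi (isMeasurableFun.Build _ _ _ _ phi mphi).
apply/esym/(@lebesgue_measure_unique _ (pushforward mu p)) => //.
move=> _ [[a b]] _ <- /=; rewrite /pushforward /=.
have -> : phi @^-1` [set` `]a, b]] = [set` `]a - c, b - c]].
  by apply/seteqP; split=> x /=; rewrite !in_itv/= ltrBlDr lerBrDr.
rewrite !lebesgue_measure_itv/= !lte_fin ltrD2r.
by case: ifP => // _; rewrite -!EFinB; congr EFin; ring.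
Qed.

Section Shears.
Variable h : R * R -> \bar R.
Hypotheses (mh : measurable_fun setT h) (h0 : forall z, (0 <= h z)%E).

Lemma integral_shearR (a : R) :
  (\int[mu]_x \int[mu]_y h (x, (y + a * x)%R) = \int[mu]_x \int[mu]_y h (x, y))%E.
Proof.
apply: eq_integral => x _.
apply: (ge0_integral_translation (g := fun y => h (x, y))) => //.
exact: measurableT_comp mh (measurable_pair1 x).
Qed.

Lemma measurable_shearL (a : R) :
  measurable_fun setT (fun z : R * R => h (z.1 + a * z.2, z.2)).
Proof.
apply: measurableT_comp mh _; apply: measurable_fun_pair => //=.
by apply: measurable_funD => //; apply: measurable_funM.
Qed.

Lemma integral_shearL (a : R) :
  (\int[mu]_x \int[mu]_y h ((x + a * y)%R, y) = \int[mu]_x \int[mu]_y h (x, y))%E.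
Proof.
have e1 := @fubini_tonelli _ _ _ _ R mu mu _ (measurable_shearL a) (fun=> h0 _).
have e2 := @fubini_tonelli _ _ _ _ R mu mu h mh h0.
apply: (etrans e1); apply: etrans (esym e2).
apply: eq_integral => y _ /=.
apply: (ge0_integral_translation (g := fun x => h (x, y))) => //.
exact: measurableT_comp mh (measurable_pair2 y).
Qed.

End Shears.

Lemma measurable_shearR (h : R * R -> \bar R) (a : R) :
  measurable_fun setT h ->
  measurable_fun setT (fun z : R * R => h (z.1, z.2 + a * z.1)).
Proof.
move=> mh; apply: measurableT_comp mh _; apply: measurable_fun_pair => //=.
by apply: measurable_funD => //; apply: measurable_funM.
Qed.

(* A rotation by an angle that is not a multiple of pi is a product of three
   shears. *)
Lemma ge0_integral_rotation (h : R * R -> \bar R) (c s : R) :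
  measurable_fun setT h -> (forall z, 0 <= h z)%E ->
  c ^+ 2 + s ^+ 2 = 1 -> s != 0 ->
  (\int[mu]_x \int[mu]_y h ((c * x + s * y)%R, (c * y - s * x)%R) =
   \int[mu]_x \int[mu]_y h (x, y))%E.
Proof.
(* For [c] and [s] the cosine and sine of an angle, [a] is the tangent of half of it; the rotation
   is the horizontal shear by [a], the vertical one by [- s], and the horizontal one by [a]
   again. *)
move=> mh h0 cs s0; pose a := (1 - c) / s.
pose h1 (z : R * R) := h (z.1 + a * z.2, z.2).
pose h2 (z : R * R) := h1 (z.1, z.2 + (- s) * z.1).
have mh1 : measurable_fun setT h1 by exact: measurable_shearL.
have mh2 : measurable_fun setT h2 by exact: measurable_shearR.
have h10 z : (0 <= h1 z)%E by exact: h0.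
have h20 z : (0 <= h2 z)%E by exact: h0.
have e1 := integral_shearL mh h0 a.
have e2 := integral_shearR mh1 h10 (- s).
have e3 := integral_shearL mh2 h20 a.
apply: etrans e1; apply: etrans e2; apply: etrans e3.
apply: eq_integral => x _; apply: eq_integral => y _.
rewrite /h2 /h1 /=; have has : a * s = 1 - c by rewrite mulfVK.
congr (h (_, _)).
  have -> : x + a * y + a * (y + - s * (x + a * y)) =
    (1 - a * s) * x + a * (1 + (1 - a * s)) * y by ring.
  rewrite has subKr; congr (_ + _ * _).
  apply/esym/(mulIf s0); rewrite mulrAC has.
  by transitivity (1 - c ^+ 2); [ring|rewrite -cs; ring].
have -> : y + - s * (x + a * y) = (1 - a * s) * y - s * x by ring.
by rewrite has subKr.
Qed.

Lemma ge0_integral2_normal (f : R * R -> \bar R) :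
  measurable_fun setT f -> (forall z, 0 <= f z)%E ->
  (\int[N01]_x \int[N01]_y f (x, y) =
   \int[mu]_x \int[mu]_y (f (x, y) * (pdf x * pdf y)%:E))%E.
Proof.
move=> mf f0.
rewrite ge0_integral_normal; last 2 first.
- exact: measurable_fun_fubini_tonelli_F.
- by move=> x; apply: integral_ge0.
apply: eq_integral => x _.
have mfx : measurable_fun setT (fun y => f (x, y)).
  exact: measurableT_comp mf (measurable_pair1 x).
rewrite ge0_integral_normal// -ge0_integralZr//=.
- by apply: eq_integral => y _; rewrite -muleA -EFinM [(pdf y * _)%R]mulrC.
- by apply: emeasurable_funM => //; exact: measurable_pdf.
- by move=> y _; rewrite mule_ge0// lee_fin normal_pdf_ge0.
- by rewrite lee_fin normal_pdf_ge0.
Qed.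

Lemma normal_pdf_rotation (c s x y : R) : c ^+ 2 + s ^+ 2 = 1 ->
  pdf (c * x + s * y) * pdf (c * y - s * x) = pdf x * pdf y.
Proof.
move=> cs; rewrite !normal_pdfE ?oner_neq0// /normal_fun !subr0.
rewrite mulrACA -expRD [RHS]mulrACA -expRD; congr (_ * expR _).
rewrite -!mulrDl; congr (_ / _); rewrite -!opprD; congr (- _).
transitivity ((c ^+ 2 + s ^+ 2) * (x ^+ 2 + y ^+ 2)); first by ring.
by rewrite cs mul1r.
Qed.

Lemma ge0_integral_normal_rotation (f : R * R -> \bar R) (c s : R) :
  measurable_fun setT f -> (forall z, 0 <= f z)%E ->
  c ^+ 2 + s ^+ 2 = 1 -> s != 0 ->
  (\int[N01]_x \int[N01]_y f ((c * x + s * y)%R, (c * y - s * x)%R) =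
   \int[N01]_x \int[N01]_y f (x, y))%E.
Proof.
move=> mf f0 cs s0.
pose fr z := f ((c * z.1 + s * z.2)%R, (c * z.2 - s * z.1)%R).
have mfr : measurable_fun setT fr.
  apply: measurableT_comp mf _; apply: measurable_fun_pair => /=.
    by apply: measurable_funD => //; apply: measurable_funM.
  by apply: measurable_funB => //; apply: measurable_funM.
have e1 := ge0_integral2_normal mfr (fun=> f0 _).
have e2 := ge0_integral2_normal mf f0.
apply: (etrans e1); apply: etrans (esym e2).
pose h z := (f z * (pdf z.1 * pdf z.2)%:E)%E.
have mh : measurable_fun setT h.
  apply: emeasurable_funM => //; apply/measurable_EFinP.
  apply: measurable_funM.
    exact: measurableT_comp (measurable_normal_pdf _ _) measurable_fst.
  exact: measurableT_comp (measurable_normal_pdf _ _) measurable_snd.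
have h0 z : (0 <= h z)%E.
  by rewrite mule_ge0// lee_fin mulr_ge0// normal_pdf_ge0.
have e3 := ge0_integral_rotation mh h0 cs s0.
apply: etrans e3.
apply: eq_integral => x _; apply: eq_integral => y _.
by rewrite /h /= normal_pdf_rotation.
Qed.

Section PairLaw.
Context {d : measure_display} {T : measurableType d} (P : {measure set T -> \bar R}).
Variables (I : finType) (X : I -> T -> R).
Hypothesis iX : iid_normal P X.

Lemma iid_normal_pair (i j : I) (g : R * R -> \bar R) : i != j ->
  measurable_fun setT g -> (forall z, 0 <= g z)%E ->
  (\int[P]_w g (X i w, X j w) = \int[N01]_x \int[N01]_y g (x, y))%E.
Proof.
have [mX PX] := iX => ij mg g0.
pose RR : measurableType _ := (measurableTypeR R * measurableTypeR R)%type.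
pose phi w : RR := (X i w, X j w).
have mphi : measurable_fun setT phi := measurable_fun_pair (mX i) (mX j).
rewrite -(@ge0_integral_pushforward _ _ _ _ _ phi mphi P setT g)//.
apply: etrans (@fubini_tonelli1 _ _ _ _ R N01 N01 g mg g0).
apply: eq_measure_integral => A mA _.
pose p : {mfun T >-> RR} := HB.pack phi (isMeasurableFun.Build _ _ _ _ phi mphi).
apply/esym/(@product_measure_unique _ _ _ _ R N01 N01 (pushforward P p)) => //.
move=> B C mB mC; rewrite /= /pushforward /=.
pose D k := if k == i then B else if k == j then C else setT.
rewrite (_ : _ @^-1` _ = [set w | forall k, D k (X k w)]); last first.
  apply/seteqP; split=> [w [/= Bw Cw] k|w /= Dw].
    by rewrite /D; case: eqP => [->//|_]; case: eqP => [->//|_].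
  by split; have := Dw i; have := Dw j;
    rewrite /D eqxx [j == i]eq_sym (negbTE ij) eqxx.
rewrite PX; last by move=> k; rewrite /D; case: (k == i); case: (k == j).
rewrite (bigD1 i)//= (bigD1 j) /=; last by rewrite eq_sym.
rewrite big1 ?mule1; last first.
  by move=> k /andP[/negbTE ki /negbTE kj]; rewrite /D ki kj probability_setT.
by rewrite /D eqxx eq_sym (negbTE ij) eqxx.
Qed.

Lemma iid_normal_one (i : I) (g : R -> \bar R) :
  measurable_fun setT g -> (forall z, 0 <= g z)%E ->
  (\int[P]_w g (X i w) = \int[N01]_x g x)%E.
Proof.
have [mX PX] := iX => mg g0.
pose phi w : measurableTypeR R := X i w.
have mphi : measurable_fun setT phi := mX i.
rewrite -(@ge0_integral_pushforward _ _ _ _ _ phi mphi P setT g)//.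
apply: eq_measure_integral => A mA _.
pose D k : set R := if k == i then A else setT.
transitivity (P [set w | forall k, D k (X k w)]).
  congr (P _); apply/seteqP; split=> [w Aw k|w /(_ i) /=]; last by rewrite /D eqxx.
  by rewrite /D; case: eqP => [->|].
rewrite PX; last by move=> k; rewrite /D; case: eqP.
rewrite /D (bigD1 i)//= eqxx big1 ?mule1// => k /negbTE ->.
by rewrite probability_setT.
Qed.

End PairLaw.

End NormalIntegral.

(** * Rotation invariance *)

Section Rotations.
Context {R : realType}.
Notation mu := (@lebesgue_measure R).
Notation N01 := (@normal_prob R 0 1).

Lemma normal_probN (B : set R) : measurable B -> N01 (-%R @^-1` B) = N01 B.
Proof.
move=> mB; rewrite /normal_prob [RHS](_ : _ =
  \int[pushforward mu (-%R : measurableTypeR R -> measurableTypeR R)]_(x in B)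
     (normal_pdf 0 1 x)%:E)%E; last first.
  by apply: eq_measure_integral => A mA _; exact/esym/lebesgue_measureN.
pose f (x : measurableTypeR R) := (normal_pdf 0 1 x)%:E.
have mf : measurable_fun B f by exact: measurable_funTS measurable_pdf.
have f0 : {in B, forall x, 0 <= f x}%E by move=> x _; rewrite lee_fin normal_pdf_ge0.
pose phi (x : measurableTypeR R) : measurableTypeR R := - x.
have mphi : measurable_fun setT phi by exact: oppr_measurable.
apply: etrans (esym (ge0_integral_pushforward mphi mu mB mf f0)).
apply: eq_integral => x _ /=; congr EFin.
by rewrite !normal_pdfE ?oner_neq0// /normal_fun !subr0 sqrrN.
Qed.

(** Converse of [iid_normal_transfer], obtained on indicators of boxes. It lets a transformed family
    be recognized as iid by computing integrals, where resampling applies. *)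
Lemma iid_normal_integralP {d} {T : measurableType d} (P : {measure set T -> \bar R})
    {d'} {T' : measurableType d'} (P' : {measure set T' -> \bar R})
    (I : finType) (X : I -> T -> R) (Y : I -> T' -> R) :
  iid_normal P X -> (forall i, measurable_fun setT (Y i)) ->
  (forall f : fam I -> \bar R, measurable_fun setT f -> (forall x, 0 <= f x)%E ->
     (\int[P]_w f (X ^~ w) = \int[P']_w f (Y ^~ w))%E) ->
  iid_normal P' Y.
Proof.
move=> [mX PX] mY XY; split=> // B mB; rewrite -PX//.
pose A : set (fam I) := [set x | forall i, B i (x i)].
have mA : measurable A by apply: sub_sigma_algebra; exists B.
have mXA : measurable [set w | A (X ^~ w)] by exact: measurable_box.
have mYA : measurable [set w | A (Y ^~ w)] by exact: measurable_box.
have mA1 : measurable_fun setT (fun x : fam I => (\1_A x)%:E : \bar R).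
  exact/measurable_EFinP/measurable_indic.
have A1_ge0 (x : fam I) : (0 <= (\1_A x)%:E :> \bar R)%E by rewrite lee_fin.
have := XY _ mA1 A1_ge0.
rewrite (_ : (fun w => (\1_A (X^~ w))%:E) = (fun w => (\1_[set w | A (X ^~ w)] w)%:E))//.
rewrite (_ : (fun w => (\1_A (Y^~ w))%:E) = (fun w => (\1_[set w | A (Y ^~ w)] w)%:E))//.
by rewrite !integral_indic// !setIT => ->.
Qed.

Definition rot_apply b (Q : 'M[R]_b) T (X : 'I_b -> T -> R) : 'I_b -> T -> R :=
  fun j w => \sum_i X i w * Q i j.

Definition gauss_preserving b (Q : 'M[R]_b) : Prop :=
  forall d (T : measurableType d) (P : probability T R) (X : 'I_b -> T -> R),
    iid_normal P X -> iid_normal P (rot_apply Q X).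

Lemma gauss_preserving1 b : @gauss_preserving b 1%:M.
Proof.
move=> d T P X iX; rewrite (_ : rot_apply _ X = X)//.
apply/funext => j; apply/funext => w; rewrite /rot_apply (bigD1 j)//= mxE eqxx.
rewrite mulr1 big1 ?addr0// => i /negbTE ij.
by rewrite mxE ij mulr0.
Qed.

Lemma rot_applyM b (Q1 Q2 : 'M[R]_b) T (X : 'I_b -> T -> R) :
  rot_apply (Q1 *m Q2) X = rot_apply Q2 (rot_apply Q1 X).
Proof.
apply/funext => j; apply/funext => w; rewrite /rot_apply.
under [RHS]eq_bigr do rewrite big_distrl /=.
rewrite exchange_big /=; apply: eq_bigr => i _.
by rewrite mxE big_distrr /=; apply: eq_bigr => a _; rewrite mulrA.
Qed.

Lemma gauss_preservingM b (Q1 Q2 : 'M[R]_b) :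
  gauss_preserving Q1 -> gauss_preserving Q2 -> gauss_preserving (Q1 *m Q2).
Proof. by move=> g1 g2 d T P X iX; rewrite rot_applyM; exact/g2/g1. Qed.

Lemma measurable_rot_apply {d} {T : measurableType d} b (Q : 'M[R]_b) X :
  (forall i, measurable_fun [set: T] (X i)) ->
  forall j, measurable_fun [set: T] (rot_apply Q X j).
Proof.
move=> mX j; apply: measurable_sum => i.
by apply: measurable_funM.
Qed.

Definition givens b (i j : 'I_b) (c s : R) : 'M[R]_b :=
  \matrix_(a, e) if e == i then c *+ (a == i) + s *+ (a == j)
    else if e == j then c *+ (a == j) - s *+ (a == i) else (a == e)%:R.

Lemma sum_givens b (i j : 'I_b) (c s : R) (x : 'I_b -> R) e :
  \sum_a x a * givens i j c s a e =
  if e == i then c * x i + s * x j else if e == j then c * x j - s * x i else x e.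
Proof.
have delta k (t : R) : \sum_a x a * (t *+ (a == k)) = t * x k.
  rewrite (bigD1 k)//= eqxx mulr1n big1 ?addr0 1?mulrC// => a /negbTE ->.
  by rewrite mulr0n mulr0.
case: (boolP (e == i)) => ei.
  under eq_bigr do rewrite mxE ei mulrDr.
  by rewrite big_split /= !delta.
case: (boolP (e == j)) => ej.
  under eq_bigr do rewrite mxE (negbTE ei) ej mulrBr.
  by rewrite sumrB !delta.
under eq_bigr do rewrite mxE (negbTE ei) (negbTE ej).
by rewrite delta mul1r.
Qed.

Lemma givens_orth b (i j : 'I_b) (c s : R) : i != j -> c ^+ 2 + s ^+ 2 = 1 ->
  (givens i j c s)^T *m givens i j c s = 1%:M.
Proof.
move=> ij cs; apply/matrixP => a e; rewrite mxE.
under eq_bigr do rewrite mxE.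
rewrite sum_givens !mxE.
have ij0 : (i == j) = false by exact: negbTE.
have ji0 : (j == i) = false by rewrite eq_sym.
case: (eqVneq e i) => [->|ei].
  case: (eqVneq a i) => [_|ai]; first by rewrite !(eqxx, ij0, ji0) /= -cs; ring.
  case: (eqVneq a j) => [_|aj]; first by rewrite !(eqxx, ij0, ji0) /=; ring.
  by rewrite /= !mulr0 addr0.
case: (eqVneq e j) => [->|ej].
  case: (eqVneq a i) => [->|ai]; first by rewrite !(eqxx, ij0, ji0) /=; ring.
  case: (eqVneq a j) => [_|aj]; first by rewrite !(eqxx, ij0, ji0) /= -cs; ring.
  by rewrite /= !mulr0 subr0.
case: (eqVneq a i) => [->|ai].
  by rewrite ?[_ == e]eq_sym ?(negbTE ei, negbTE ej) !mulr0n addr0.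
case: (eqVneq a j) => [->|aj].
  by rewrite ?[_ == e]eq_sym ?(negbTE ei, negbTE ej) !mulr0n subr0.
by rewrite eq_sym.
Qed.

(** Only coordinates [i] and [j] move, so redrawing these two with the others frozen leaves the
    rotation invariance of the Gaussian law in the plane. *)
Lemma givens_preserving b (i j : 'I_b) (c s : R) :
  i != j -> c ^+ 2 + s ^+ 2 = 1 -> s != 0 -> gauss_preserving (givens i j c s).
Proof.
move=> ij cs s0 d T P X iX; have [mX PX] := iX.
apply: (iid_normal_integralP iX); first exact: measurable_rot_apply.
move=> f mf f0; pose S := pred2 i j.
pose rho (x : fam 'I_b) : fam 'I_b := fun e =>
  if e == i then c * x i + s * x j else if e == j then c * x j - s * x i else x e.
have mrho : measurable_fun setT rho.
  apply: measurable_fam => e; case: (e == i); [|case: (e == j)].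
  - by apply: measurable_funD; apply: measurable_funM => //; exact: measurable_eval.
  - by apply: measurable_funB; apply: measurable_funM => //; exact: measurable_eval.
  - exact: measurable_eval.
rewrite (iid_normal_resample S iX mf f0).
transitivity (\int[P]_w f (rho (X ^~ w)))%E; last first.
  apply: eq_integral => w _; congr f; apply/funext => e.
  by rewrite /rot_apply sum_givens.
have mfr : measurable_fun setT (f \o rho) by exact: measurableT_comp mf mrho.
rewrite (@iid_normal_resample _ _ _ P _ S X (f \o rho) iX mfr (fun=> f0 _)).
apply: eq_integral => w _ /=.
pose g (z : R * R) := f (fun e : 'I_b => if e == i then z.1 else if e == j then z.2 else X e w).
have mg : measurable_fun setT g.
  apply: measurableT_comp mf _; apply: measurable_fam => e.
  case: (e == i); first exact: measurable_fst.
  by case: (e == j); [exact: measurable_snd|exact: measurable_cst].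
transitivity (\int[N01]_x \int[N01]_y g (x, y))%E.
  rewrite -(iid_normal_pair iX ij)//; last by move=> z; exact: f0.
  apply: eq_integral => w' _; congr f; apply/funext => e.
  by rewrite /S /=; case: eqP => [->//|_]; case: eqP => [->|].
rewrite -(ge0_integral_normal_rotation mg _ cs s0); last by move=> z; exact: f0.
pose gr z := g ((c * z.1 + s * z.2), (c * z.2 - s * z.1)).
transitivity (\int[N01]_x \int[N01]_y gr (x, y))%E; first by [].
rewrite -(iid_normal_pair iX ij)//; last 2 first.
- apply: measurableT_comp mg _; apply: measurable_fun_pair => /=.
    by apply: measurable_funD => //; apply: measurable_funM.
  by apply: measurable_funB => //; apply: measurable_funM.
- by move=> z; exact: f0.
apply: eq_integral => w' _; congr f; apply/funext => e.
rewrite /rho /S /= !eqxx [j == i]eq_sym (negbTE ij) /=.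
by case: eqP => // _; case: eqP.
Qed.

Lemma sign_preserving b (e : 'I_b -> bool) :
  gauss_preserving (\matrix_(i, j) ((-1) ^+ e i *+ (i == j))).
Proof.
move=> d T P X [mX PX]; split; first exact: measurable_rot_apply.
move=> B mB.
pose C j := if e j then -%R @^-1` B j else B j.
have mC j : measurable (C j).
  rewrite /C; case: (e j) => //; rewrite -[_ @^-1` _]setTI.
  exact: (@oppr_measurable R setT).
transitivity (P [set w | forall j, C j (X j w)]); last first.
  by rewrite PX//; apply: eq_bigr => j _; rewrite /C; case: (e j); rewrite ?normal_probN.
congr (P _).
have rotE j w : rot_apply (\matrix_(i, j) ((-1) ^+ e i *+ (i == j))) X j w =
    (if e j then - X j w else X j w).
  rewrite /rot_apply (bigD1 j)//= big1 ?addr0 => [|i /negbTE ij]; last first.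
    by rewrite mxE ij mulr0n mulr0.
  by rewrite mxE eqxx mulr1n; case: (e j); rewrite ?expr1 ?expr0 ?mulrN1 ?mulr1.
apply/seteqP; split=> w /= Bw j; have := Bw j; rewrite rotE /C; by case: (e j).
Qed.

(** Invariance is carried along with orthogonality: the triangularizing [J] gets applied to random
    rows, and the invariance under every orthogonal matrix is itself deduced from it. *)
Definition orth_gauss b (Q : 'M[R]_b) := Q^T *m Q = 1%:M /\ gauss_preserving Q.

Lemma orth_gauss1 b : @orth_gauss b 1%:M.
Proof. by split; [rewrite trmx1 mulmx1|exact: gauss_preserving1]. Qed.

Lemma orth_gaussM b (Q1 Q2 : 'M[R]_b) : orth_gauss Q1 -> orth_gauss Q2 -> orth_gauss (Q1 *m Q2).
Proof.
move=> [h1 g1] [h2 g2]; split; last exact: gauss_preservingM.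
by rewrite trmx_mul mulmxA -(mulmxA Q2^T) h1 mulmx1 h2.
Qed.

(* Plane rotations clear the entries above the diagonal one by one, along the
   rows and from the top; at stage (r, c) rows before r and the first c entries
   of row r are done. *)
Lemma orth_gauss_triangularize a b (Y : 'M[R]_(a, b)) :
  exists2 J, orth_gauss J & forall (i : 'I_a) (j : 'I_b), (i < j)%N -> (Y *m J) i j = 0.
Proof.
suff H r : (r <= a)%N -> exists2 J, orth_gauss J &
    forall (i : 'I_a) (j : 'I_b), (i < r)%N -> (i < j)%N -> (Y *m J) i j = 0.
  by have [J gJ J0] := H a (leqnn a); exists J => // i j; exact: J0.
elim: r => [_|r IHr ra]; first by exists 1%:M => //; exact: orth_gauss1.
suff H c : (c <= b)%N -> exists2 J, orth_gauss J &
    forall (i : 'I_a) (j : 'I_b), (i < j)%N ->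
      (i < r)%N || (i == r :> nat) && (j < c)%N -> (Y *m J) i j = 0.
  have [J gJ J0] := H b (leqnn b); exists J => // i j.
  rewrite ltnS leq_eqVlt => ir ij; apply: J0 => //.
  by rewrite (ltn_ord j) andbT orbC.
elim: c => [_|c IHc cb].
  have [J gJ J0] := IHr (ltnW ra); exists J => // i j ij.
  by rewrite ltn0 andbF orbF => ir; exact: J0.
have [J gJ J0] := IHc (ltnW cb).
have [cr|rc] := leqP c r.
  exists J => // i j ij /orP[ir|/andP[/eqP ir jc]]; first by rewrite J0// ir.
  by move: ij; rewrite ir ltnNge (leq_trans _ cr).
(* The rotation mixes columns [r] and [c], where [r < c]. Both vanish in the rows above row [r], so
   the zeros already made survive. *)
pose rb : 'I_b := Ordinal (ltn_trans rc cb); pose ra' : 'I_a := Ordinal ra.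
pose cb' : 'I_b := Ordinal cb.
set W := Y *m J in J0; set x := W ra' rb; set y := W ra' cb'.
(* An entry that is already 0 is left alone, because the sine [y / rho] has to be nonzero for the
   factorization into shears. *)
have [y0|y0] := eqVneq y 0.
  exists J => // i j ij /orP[ir|/andP[/eqP ir]]; first by rewrite J0// ir.
  rewrite ltnS leq_eqVlt => /orP[/eqP jc|jc].
    have -> : i = ra' by apply: val_inj.
    by have -> : j = cb' by apply: val_inj.
  by rewrite J0// ir eqxx jc orbT.
have rho0 : 0 < x ^+ 2 + y ^+ 2.
  by rewrite ltr_wpDl ?sqr_ge0// lt_def sqrf_eq0 y0 sqr_ge0.
pose rho := Num.sqrt (x ^+ 2 + y ^+ 2).
have rhoN0 : rho != 0 by rewrite gt_eqF// sqrtr_gt0.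
have rcN : rb != cb' by rewrite -val_eqE /= ltn_eqF.
have cs : (x / rho) ^+ 2 + (y / rho) ^+ 2 = 1.
  rewrite !expr_div_n -mulrDl sqr_sqrtr ?divff//; first by rewrite gt_eqF.
  exact: ltW.
have gG : orth_gauss (givens rb cb' (x / rho) (y / rho)).
  split; first exact: givens_orth.
  by apply: givens_preserving => //; rewrite mulf_neq0 ?invr_neq0.
exists (J *m givens rb cb' (x / rho) (y / rho)); first exact: orth_gaussM.
move=> i j ij h; rewrite mulmxA mxE sum_givens -/W.
have Wzero (j' : 'I_b) : (r <= j')%N -> (i < r)%N -> W i j' = 0.
  by move=> rj ir; apply: J0; rewrite ?ir// (leq_trans ir).
case/orP: h => [ir|/andP[/eqP ir jc]].
  rewrite (Wzero rb)// (Wzero cb') ?(ltnW rc)// !mulr0 addr0 subr0.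
  by case: ifP => // _; case: ifP => // _; apply: J0; rewrite ?ir.
have ei : i = ra' by apply: val_inj.
case: eqP => [jr|_]; first by move: ij; rewrite jr ir ltnn.
case: eqP => [jc'|jc']; first by rewrite ei -/x -/y; field.
apply: J0 => //; rewrite ir eqxx ltnn /= ltn_neqAle -ltnS jc andbT.
by apply/eqP => jc0; apply: jc'; exact: val_inj.
Qed.

Lemma sum_sqr_orth b (Q : 'M[R]_b) (j : 'I_b) : Q^T *m Q = 1%:M ->
  \sum_i Q i j ^+ 2 = 1.
Proof.
move=> /matrixP /(_ j j); rewrite !mxE eqxx => e; apply: etrans e.
by apply: eq_bigr => i _; rewrite mxE expr2.
Qed.

(* Compare the sums of squares of the first m rows and of the first m columns. *)
Lemma orth_triangular_diag b (W : 'M[R]_b) : W^T *m W = 1%:M ->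
  (forall i j : 'I_b, (i < j)%N -> W i j = 0) ->
  forall i j : 'I_b, i != j -> W i j = 0.
Proof.
move=> oW W0 i j; rewrite neq_ltn => /orP[|ji]; first exact: W0.
have oWt : (W^T)^T *m W^T = 1%:M by rewrite trmxK; exact: mulmx1C.
pose A := \sum_(a : 'I_b | (a < i)%N) \sum_(e : 'I_b | (e < i)%N) W a e ^+ 2.
have rows : A = \sum_(a : 'I_b | (a < i)%N) 1.
  apply: eq_bigr => a ai; rewrite -(sum_sqr_orth a oWt).
  rewrite [RHS](bigID (fun e : 'I_b => (e < i)%N))/=.
  rewrite [X in _ = _ + X]big1 ?addr0; first by apply: eq_bigr => e _; rewrite mxE.
  by move=> e; rewrite -leqNgt => ie; rewrite mxE W0 ?expr0n// (leq_trans ai).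
pose S := \sum_(e : 'I_b | (e < i)%N) \sum_(a : 'I_b | ~~ (a < i)%N) W a e ^+ 2.
have cols : \sum_(e : 'I_b | (e < i)%N) 1 = A + S.
  rewrite [A]exchange_big -big_split /=; apply: eq_bigr => e _.
  by rewrite -(sum_sqr_orth e oW) (bigID (fun a : 'I_b => (a < i)%N)).
have : S = 0 by apply: (addrI A); rewrite addr0 -cols.
have sq_ge0 (e : 'I_b) : (e < i)%N ->
    0 <= \sum_(a : 'I_b | ~~ (a < i)%N) W a e ^+ 2.
  by move=> _; apply: sumr_ge0 => a _; exact: sqr_ge0.
move=> /(psumr_eq0P sq_ge0) /(_ j ji) /psumr_eq0P h.
apply/eqP; rewrite -sqrf_eq0; apply/eqP; apply: h => [a _|].
  exact: sqr_ge0.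
by rewrite -leqNgt.
Qed.

(** [X J] has the law of [X], so [X J^T] has the law of [X J J^T], which is [X]. *)
Lemma gauss_preserving_tr b (J : 'M[R]_b) : J *m J^T = 1%:M ->
  gauss_preserving J -> gauss_preserving J^T.
Proof.
move=> oJ gJ d T P X iX; have [mX PX] := iX.
apply: (iid_normal_integralP iX); first exact: measurable_rot_apply.
move=> f mf f0.
pose rho (x : fam 'I_b) : fam 'I_b := fun e => \sum_i x i * J^T i e.
have mrho : measurable_fun setT rho.
  apply: measurable_fam => e; apply: measurable_sum => i.
  by apply: measurable_funM => //; exact: measurable_eval.
have mfr : measurable_fun setT (f \o rho) by exact: measurableT_comp mf mrho.
have := iid_normal_transfer (gJ _ _ _ _ iX) iX mfr (fun=> f0 _).
move=> e; apply: etrans e; apply: eq_integral => w _ /=; congr f.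
apply/funext => j; rewrite -[LHS]/(X j w).
rewrite -[X in X j w](_ : rot_apply J^T (rot_apply J X) = X)//.
rewrite -rot_applyM oJ; apply/funext => i; apply/funext => w'.
rewrite /rot_apply (bigD1 i)//= mxE eqxx mulr1 big1 ?addr0// => a /negbTE ai.
by rewrite mxE ai mulr0.
Qed.

(* With J from the triangularization of V, the matrix V J is orthogonal and
   triangular, hence diagonal with entries 1 and -1. *)
Lemma orth_preserving b (V : 'M[R]_b) : V^T *m V = 1%:M -> gauss_preserving V.
Proof.
move=> oV; have [J [oJ gJ] J0] := orth_gauss_triangularize V.
set W := V *m J in J0.
have VW : V = W *m J^T by rewrite -mulmxA (mulmx1C oJ) mulmx1.
have oW : W^T *m W = 1%:M by rewrite trmx_mul mulmxA -(mulmxA J^T) oV mulmx1.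
have Wd := orth_triangular_diag oW J0.
rewrite VW; apply: gauss_preservingM; last first.
  exact: gauss_preserving_tr (mulmx1C oJ) gJ.
pose e i := W i i < 0.
rewrite (_ : W = \matrix_(i, j) ((-1) ^+ e i *+ (i == j))); first exact: sign_preserving.
apply/matrixP => i j; rewrite [RHS]mxE; case: (eqVneq i j) => [<-|ij]; last by rewrite Wd.
have := sum_sqr_orth i oW; rewrite (bigD1 i)//= big1 ?addr0 => [/eqP|a ai]; last first.
  by rewrite Wd// expr0n.
rewrite sqrf_eq1 mulr1n /e => /orP[]/eqP ->; first by rewrite ltr10.
by rewrite oppr_lt0 ltr01.
Qed.

End Rotations.

(** * Moments by integration by parts *)

Section Stein.
Context {R : realType}.
Notation mu := (@lebesgue_measure R).
Notation N01 := (@normal_prob R 0 1).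
Notation pdf := (@normal_pdf R 0 1).

Lemma bigcup_itv0n : \bigcup_n [set` `[0, n%:R : R]] = [set` `[0, +oo[].
Proof.
apply/seteqP; split=> [x [n _ /=]|x /=]; rewrite !in_itv/= ?andbT.
  by move=> /andP[].
move=> x0; exists (Num.bound x) => //=; rewrite in_itv/= x0 /=.
by apply: ltW; exact: archi_boundP.
Qed.

Lemma ge0_cvg_integral_itv0n (f : R -> R) :
  continuous f -> (forall x, 0 <= x -> 0 <= f x) ->
  (\int[mu]_(x in `[0%R, n%:R]) (f x)%:E)%E @[n --> \oo] -->
  (\int[mu]_(x in `[0%R, +oo[) (f x)%:E)%E.
Proof.
move=> cf f0; rewrite -bigcup_itv0n.
have mf n : measurable_fun [set` `[0, n%:R : R]] (fun x => (f x)%:E).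
  apply/measurable_EFinP; apply: measurable_funTS.
  exact: continuous_measurable_fun.
apply: (@ge0_nondecreasing_set_cvg_integral _ (measurableTypeR R) R
  (fun n : nat => [set` `[0, n%:R : R]]) (fun x => (f x)%:E) mu _ _ mf) => //.
- move=> m n mn; apply/subsetPset => x /=; rewrite !in_itv/= => /andP[-> xm] /=.
  by rewrite (le_trans xm)// ler_nat.
- by move=> n x /=; rewrite in_itv/= => /andP[x0 _]; rewrite lee_fin f0.
Qed.

Lemma integral_itv0n_parts (F P Q : R -> R) (n : nat) :
  (forall x : R, 0 <= x -> is_derive x 1 F (P x - Q x)) ->
  continuous F -> continuous P -> continuous Q -> F 0 = 0 -> (0 < n)%N ->
  (\int[mu]_(x in `[0%R, n%:R]) (P x)%:E =
   (F n%:R)%:E + \int[mu]_(x in `[0%R, n%:R]) (Q x)%:E)%E.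
Proof.
move=> dF cF cP cQ F0 n0.
have n0' : 0 < n%:R :> R by rewrite ltr0n.
have intc (f : R -> R) : continuous f -> mu.-integrable `[0%R, n%:R] (EFin \o f).
  move=> cf; apply: continuous_compact_integrable; first exact: segment_compact.
  exact: continuous_subspaceT.
have ftc : (\int[mu]_(x in `[0%R, n%:R]) ((P x)%:E - (Q x)%:E) = (F n%:R)%:E)%E.
  have -> : ((F n%:R)%:E = (F n%:R)%:E - (F 0)%:E)%E by rewrite F0 sube0.
  apply: (@continuous_FTC2 R (fun x => P x - Q x) F) => //.
  - by apply: continuous_subspaceT => x; apply: (@cvgB _ R^o); [exact: cP|exact: cQ].
  - split.
    + by move=> x; rewrite in_itv/= => /andP[/ltW x0 _]; have [] := dF x x0.
    + exact: cvg_at_right_filter (cF _).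
    + exact: cvg_at_left_filter (cF _).
  - move=> x; rewrite in_itv/= => /andP[/ltW x0 _].
    by rewrite derive1E; have [_ ->] := dF x x0.
rewrite -ftc integralB_EFin//; [|exact: intc|exact: intc].
by rewrite subeK//; exact: integrable_fin_num (intc _ cQ).
Qed.

(** One inequality is wanted, so the boundary term is only bounded from above, along integer
    endpoints; for nonpositive [F], as in [normal_moment_step], this costs nothing. Nonnegativity of
    [P] and [Q] lets both sides be infinite. *)
Lemma ge0_le_integral_parts (F P Q : R -> R) :
  (forall x : R, 0 <= x -> is_derive x 1 F (P x - Q x)) ->
  continuous F -> continuous P -> continuous Q ->
  (forall x, 0 <= x -> 0 <= P x) -> (forall x, 0 <= x -> 0 <= Q x) -> F 0 = 0 ->
  (forall e, 0 < e -> \forall n \near \oo, F n%:R <= e) ->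
  (\int[mu]_(x in `[0%R, +oo[) (P x)%:E <= \int[mu]_(x in `[0%R, +oo[) (Q x)%:E)%E.
Proof.
move=> dF cF cP cQ P0 Q0 F0 Fe; apply/lee_addgt0Pr => e e0.
have cvP := ge0_cvg_integral_itv0n cP P0.
rewrite -(cvg_lim _ cvP)//; apply: lime_le; first by apply/cvg_ex; eexists; exact: cvP.
have [N _ HN] := Fe e e0; exists N.+1 => // n /= Nn.
have n0 : (0 < n)%N by exact: leq_ltn_trans Nn.
rewrite (integral_itv0n_parts dF)// addeC leeD//; last first.
  by rewrite lee_fin HN//= ltnW.
have n0y : [set` `[0, n%:R : R]] `<=` [set` `[0, +oo[].
  by move=> x /=; rewrite !in_itv/= => /andP[->].
apply: ge0_subset_integral => //.
- apply/measurable_EFinP; apply: measurable_funTS.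
  exact: continuous_measurable_fun.
- by move=> x /=; rewrite in_itv/= andbT lee_fin => /Q0.
Qed.

Lemma is_derive_pdf (x : R) : is_derive x 1 pdf (- x * pdf x).
Proof.
have pdfE : pdf = (normal_peak 1 \*: (expR \o (- (2^-1 : R) \*: (id ^+ 2)))) :> (R -> R).
  apply/funext => y; rewrite normal_pdfE ?oner_neq0// /normal_fun subr0 expr1n.
  by congr (_ * expR _); rewrite mulNr mulrC -mulNr.
rewrite [X in is_derive _ _ X _]pdfE.
apply: is_derive_eq.
rewrite pdfE /GRing.scale /=; set E := expR _.
by rewrite -[normal_peak 1 *: E]/(normal_peak 1 * E); field.
Qed.

Lemma continuous_pdf : continuous pdf.
Proof. by apply: continuous_normal_pdf; rewrite oner_neq0. Qed.

(** Stein's identity: the derivative of [G * pdf] is [(dG x - x * G x) * pdf x]. Evenness of [p] and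
    [q] reduces the line to a half-line, where [G 0 = 0] removes the lower boundary term. *)
Lemma ge0_le_integral_normal_parts (G dG p q : R -> R) :
  (forall x : R, 0 <= x -> is_derive x 1 G (dG x)) ->
  (forall x, 0 <= x -> dG x - x * G x = p x - q x) ->
  continuous G -> continuous p -> continuous q ->
  p =1 p \o -%R -> q =1 q \o -%R ->
  (forall x, 0 <= p x) -> (forall x, 0 <= q x) -> G 0 = 0 ->
  (forall e, 0 < e -> \forall n \near \oo, G n%:R * pdf n%:R <= e) ->
  (\int[N01]_x (p x)%:E <= \int[N01]_x (q x)%:E)%E.
Proof.
move=> dGE Gpq cG cp cq ep eq p0 q0 G0 Ge.
have even (f : R -> R) : continuous f -> f =1 f \o -%R -> (forall x, 0 <= f x) ->
    (\int[N01]_x (f x)%:E =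
     2%:E * \int[mu]_(x in `[0%R, +oo[) (f x * pdf x)%:E)%E.
  move=> cf ef f0.
  have mf : measurable_fun setT (fun x => (f x)%:E).
    by apply/measurable_EFinP; exact: continuous_measurable_fun.
  have e1 := ge0_integral_normal mf (fun x => f0 x).
  apply: (etrans e1); rewrite set_itvcy.
  apply: (@ge0_symfun_integralT _ (fun x => f x * pdf x)) => //.
  - by move=> x; rewrite mulr_ge0// normal_pdf_ge0.
  - by move=> x; apply: cvgM; [exact: cf|exact: continuous_pdf].
  - move=> x /=; rewrite [f x]ef /=; congr (_ * _).
    by rewrite !normal_pdfE ?oner_neq0// /normal_fun !subr0 sqrrN.
rewrite !even// lee_pmul2l//.
have cM (f : R -> R) : continuous f -> continuous (fun x => f x * pdf x).
  by move=> cf x; apply: cvgM; [exact: cf|exact: continuous_pdf].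
apply: (@ge0_le_integral_parts (fun x => G x * pdf x)) => //.
- move=> x x0; have dGx := dGE x x0; have dpx := is_derive_pdf x.
  rewrite -mulrBl -Gpq// [X in is_derive _ _ X _](_ : _ = G * pdf)//.
  by apply: is_derive_eq; rewrite /GRing.scale /=; ring.
- exact: cM.
- exact: cM.
- exact: cM.
- by move=> x _; rewrite mulr_ge0// normal_pdf_ge0.
- by move=> x _; rewrite mulr_ge0// normal_pdf_ge0.
- by rewrite G0 mul0r.
Qed.

Lemma normal_moment_step (s : nat) :
  (\int[N01]_x (`|x| ^+ s.+2)%:E <= s.+1%:R%:E * \int[N01]_x (`|x| ^+ s)%:E)%E.
Proof.
have cX n : continuous (fun x : R => `|x| ^+ n).
  move=> x; apply: (@continuous_comp _ _ _ (fun x : R => `|x|) (fun x => x ^+ n)).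
    exact: norm_continuous.
  exact: exprn_continuous.
rewrite -ge0_integralZl//; last first.
  by apply/measurable_EFinP; exact: continuous_measurable_fun.
under [leRHS]eq_integral do rewrite -EFinM.
(* The minus sign puts the higher moment on the left of the inequality and makes the boundary term
   nonpositive. *)
apply: (@ge0_le_integral_normal_parts (fun x => - x ^+ s.+1)
  (fun x => - (s.+1%:R * x ^+ s))) => //.
- move=> x _; have dX : is_derive x 1 (fun y : R => y ^+ s.+1) (s.+1%:R * x ^+ s).
    apply: DeriveDef; first exact: exprn_derivable.
    by rewrite exp_derive /GRing.scale /= mulr1.
  exact: is_deriveN.
- by move=> x x0; rewrite !ger0_norm// !exprS; ring.
- by move=> x; apply: (@cvgN _ R^o); exact: exprn_continuous.
- by move=> x; apply: cvgM; [exact: cvg_cst|exact: cX].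
- by move=> x; rewrite /= normrN.
- by move=> x; rewrite /= normrN.
- by rewrite expr0n oppr0.
- move=> e e0; near=> n; apply: le_trans (ltW e0).
  by rewrite mulNr oppr_le0 mulr_ge0 ?normal_pdf_ge0.
Unshelve. all: by end_near. Qed.

Section ChiStep.
Variables (c : R) (c0 : 0 < c).
Notation rho := (fun x : R => (Num.sqrt (x ^+ 2 + c))^-1).

Let sqc_gt0 (x : R) : 0 < x ^+ 2 + c.
Proof. by rewrite ltr_wpDl// sqr_ge0. Qed.

Let rho_gt0 x : 0 < rho x.
Proof. by rewrite invr_gt0 sqrtr_gt0. Qed.

Lemma is_derive_rho (x : R) : is_derive x 1 rho (- x * rho x ^+ 3).
Proof.
have r0 : Num.sqrt (x ^+ 2 + c) != 0 by rewrite gt_eqF// sqrtr_gt0.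
have d2 : is_derive x 1 (fun y : R => y ^+ 2 + c) (2 * x).
  have dX : is_derive x 1 (fun y : R => y ^+ 2) (2 * x).
    apply: DeriveDef; first exact: exprn_derivable.
    by rewrite exp_derive /GRing.scale /= mulr1.
  by rewrite -[2 * x]addr0; apply: is_deriveD.
have ds := is_derive1_sqrt (sqc_gt0 x).
have d3 := @is_derive1_comp _ Num.sqrt (fun y : R => y ^+ 2 + c) x _ _ ds d2.
have d4 := @is_deriveV _ (Num.sqrt \o (fun y : R => y ^+ 2 + c)) x _ 1 r0 d3.
apply: (is_derive_eq d4).
rewrite /= /GRing.scale /=; field.
by rewrite r0.
Qed.

Lemma continuous_rho : continuous rho.
Proof.
move=> x; apply: differentiable_continuous; apply/derivable1_diffP.
by have [] := is_derive_rho x.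
Qed.

Lemma rho_le (x : R) : rho x <= (Num.sqrt c)^-1.
Proof.
rewrite lef_pV2 ?posrE ?sqrtr_gt0// ler_sqrt ?(ltW (sqc_gt0 _))//.
by rewrite lerDr sqr_ge0.
Qed.

Lemma near_xpdf_le (C e : R) : 0 <= C -> 0 < e ->
  \forall n \near \oo, n%:R * C * pdf n%:R <= e.
Proof.
move=> C0 e0; pose K := C * normal_peak (1 : R) * 2.
have K0 : 0 <= K by rewrite !mulr_ge0// normal_peak_ge0.
exists (Num.bound (K / e)).+1 => // n /= nb.
have n0 : 0 < n%:R :> R by rewrite ltr0n (leq_ltn_trans _ nb).
have Kn : K <= e * n%:R.
  rewrite -ler_pdivrMl// mulrC; apply: ltW; apply: (lt_le_trans (archi_boundP _)).
    by rewrite divr_ge0// ltW.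
  by rewrite ler_nat ltnW.
rewrite normal_pdfE ?oner_neq0// /normal_fun subr0 expr1n.
(* From [1 + y <= expR y] at [y = n^2 / 2]. *)
have en : expR (- n%:R ^+ 2 / (1 *+ 2)) <= 2 / n%:R ^+ 2 :> R.
  rewrite mulNr expRN -[2 / _]invf_div lef_pV2 ?posrE ?expR_gt0 ?divr_gt0 ?exprn_gt0//.
  by apply: le_trans (expR_ge1Dx _); rewrite lerDr.
apply: (@le_trans _ _ (n%:R * C * (normal_peak 1 * (2 / n%:R ^+ 2)))).
  apply: ler_wpM2l; first by rewrite mulr_ge0// ltW.
  by apply: ler_wpM2l => //; exact: normal_peak_ge0.
have -> : n%:R * C * (normal_peak 1 * (2 / n%:R ^+ 2)) = K / n%:R.
  by rewrite /K; field; rewrite gt_eqF.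
by rewrite ler_pdivrMr.
Qed.

(** Stein's identity with [G x = x * rho x ^+ s]. The constant [c] will be the sum of squares of the
    other, frozen, coordinates plus the regularization. *)
Lemma stein_chi (s : nat) :
  (\int[N01]_x (rho x ^+ s)%:E <=
   \int[N01]_x (s%:R * x ^+ 2 * rho x ^+ s.+2 + x ^+ 2 * rho x ^+ s)%:E)%E.
Proof.
have crhoX n : continuous (fun x => rho x ^+ n).
  move=> x; apply: (@continuous_comp _ _ _ rho (fun y => y ^+ n)).
    exact: continuous_rho.
  exact: exprn_continuous.
have r0 x : 0 <= rho x by exact: ltW.
pose G x := x * rho x ^+ s; pose dG x := rho x ^+ s - s%:R * x ^+ 2 * rho x ^+ s.+2.
have dGE (x : R) : is_derive x 1 G (dG x).
  have dr := is_derive_rho x.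
  have drs : is_derive x 1 (fun y => rho y ^+ s) (s%:R * rho x ^+ s.-1 * (- x * rho x ^+ 3)).
    by have := @is_deriveX _ _ rho s x 1 _ dr; rewrite exprfctE.
  have := @is_deriveM _ _ id (fun y => rho y ^+ s) x 1 _ _ (is_derive_id _ _) drs.
  move=> h; apply: (is_derive_eq h); rewrite /GRing.scale /= /dG mulr1.
  case: (s) => [|s']; rewrite ?mul0r ?mulr0 ?add0r ?subr0// !exprS; ring.
have cG : continuous G.
  move=> x; apply: differentiable_continuous; apply/derivable1_diffP.
  by have [] := dGE x.
apply: (@ge0_le_integral_normal_parts G dG) => //.
- by move=> x _; rewrite /dG /G; ring.
- move=> x; apply: (@cvgD _ R^o).
    apply: cvgM; last exact: crhoX.
    by apply: cvgM; [exact: cvg_cst|exact: exprn_continuous].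
  by apply: cvgM; [exact: exprn_continuous|exact: crhoX].
- by move=> x; rewrite /= sqrrN.
- by move=> x; rewrite /= sqrrN.
- move=> x; have rx n : 0 <= rho x ^+ n by apply: exprn_ge0.
  by apply: addr_ge0; [apply: mulr_ge0 => //; apply: mulr_ge0 => //; exact: sqr_ge0|apply: mulr_ge0 => //; exact: sqr_ge0].
- by rewrite /G mul0r.
- move=> e e0; have C0 : 0 <= (Num.sqrt c)^-1 ^+ s by rewrite exprn_ge0// invr_ge0.
  have [M _ HM] := near_xpdf_le C0 e0; exists M => // n /= Mn.
  apply: le_trans (HM n Mn); apply: ler_wpM2r; first exact: normal_pdf_ge0.
  apply: ler_wpM2l => //.
  by rewrite lerXn2r ?nnegrE ?invr_ge0// rho_le.
Qed.

End ChiStep.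

End Stein.

(** * Moments of normal and of inverse chi variables *)

Section Moments.
Context {R : realType}.
Notation N01 := (@normal_prob R 0 1).
Local Notation fam := (@fam R).

Lemma measurable_sqrtr {d'} {T' : measurableType d'} (f : T' -> R) :
  measurable_fun setT f -> measurable_fun setT (fun x => Num.sqrt (f x)).
Proof.
move=> mf; apply: measurableT_comp mf; apply: continuous_measurable_fun.
exact: sqrt_continuous.
Qed.

Lemma measurable_invr {d'} {T' : measurableType d'} (f : T' -> R) :
  measurable_fun setT f -> measurable_fun setT (fun x => (f x)^-1).
Proof.
(* Squaring makes the base of the real power nonnegative and the factor [f x] restores the sign;
   where [f] vanishes both sides are 0. *)
move=> mf; rewrite (_ : (fun x => _) = (fun x => f x * (f x ^+ 2) `^ (-1))).
  apply: measurable_funM => //.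
  exact: (measurableT_comp (measurable_powR (-1)) (measurable_funX 2 mf)).
apply/funext => x; rewrite powR_inv1 ?sqr_ge0//.
have [->|fx0] := eqVneq (f x) 0; first by rewrite mul0r invr0.
by rewrite expr2 invfM mulrA divff// mul1r.
Qed.

(* Upper bounds for E|g|^s, g standard normal, and for E rho^-s, rho chi
   distributed with N > s degrees of freedom. Integration by parts gives both
   recurrences; for s = 1, E|g| <= (1 + E g^2)/2 = 1 and E rho^-1 <= sqrt(E rho^-2). *)
Fixpoint gmom (s : nat) : R :=
  match s with s'.+2 => s'.+1%:R * gmom s' | _ => 1 end.

Fixpoint cmom (N s : nat) : R :=
  match s with
  | 0 => 1
  | 1 => (Num.sqrt (N - 2)%:R)^-1
  | s'.+2 => cmom N s' / (N - s'.+2)%:R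
  end.

Lemma nat_ind2 (Q : nat -> Prop) :
  Q 0 -> Q 1 -> (forall n, Q n -> Q n.+2) -> forall n, Q n.
Proof.
move=> Q0 Q1 Qs n; suff : Q n /\ Q n.+1 by case.
by elim: n => [//|n [? ?]]; split=> //; exact: Qs.
Qed.

Lemma gmom_ge0 s : 0 <= gmom s.
Proof. by elim/nat_ind2: s => // s IHs; rewrite /= mulr_ge0. Qed.

Lemma cmom_ge0 N s : 0 <= cmom N s.
Proof.
elim/nat_ind2: s => //= s IHs.
by rewrite divr_ge0.
Qed.

Lemma measurable_normX (s : nat) :
  measurable_fun setT (fun x : R => (`|x| ^+ s)%:E).
Proof.
apply/measurable_EFinP; apply: measurable_funX.
exact: normr_measurable.
Qed.

Lemma normal_moment_le (s : nat) :
  (\int[N01]_x (`|x| ^+ s)%:E <= (gmom s)%:E)%E.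
Proof.
have m0 : (\int[N01]_x (`|x| ^+ 0)%:E = 1%:E)%E.
  under eq_integral do rewrite expr0.
  by rewrite integral_cst// mul1e; exact: probability_setT.
elim/nat_ind2: s => [||s IHs]; first by rewrite m0.
  have m2 : (\int[N01]_x (`|x| ^+ 2)%:E <= 1%:E)%E.
    apply: le_trans (normal_moment_step 0) _; rewrite mul1e.
    by rewrite le_eqVlt; apply/orP; left; apply/eqP; exact: m0.
  apply: (@le_trans _ _ (\int[N01]_x (2^-1%:E * ((`|x| ^+ 0)%:E + (`|x| ^+ 2)%:E)))%E).
    apply: ge0_le_integral => //.
    - exact: measurable_normX.
    - apply: measurable_funeM; apply: emeasurable_funD; exact: measurable_normX.
    - move=> x _; rewrite -EFinD -EFinM lee_fin expr0 expr1.
      have := sqr_ge0 (`|x| - 1); rewrite sqrrB; lra.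
  rewrite ge0_integralZl//; last 2 first.
  - by apply: emeasurable_funD; exact: measurable_normX.
  - by move=> x _; rewrite lee_fin addr_ge0// exprn_ge0.
  rewrite ge0_integralD//; [|exact: measurable_normX|exact: measurable_normX].
  rewrite m0; apply: (@le_trans _ _ (2^-1%:E * (1%:E + 1%:E))%E).
    by apply: lee_wpmul2l; [rewrite lee_fin invr_ge0|exact: leeD].
  by rewrite -EFinD -EFinM lee_fin /=; lra.
apply: le_trans (normal_moment_step s) _.
by rewrite /= EFinM; apply: lee_wpmul2l => //; rewrite lee_fin.
Qed.

Section Resample.
Context {d : measure_display} {T : measurableType d} (P : probability T R).
Context (I : finType) (X : I -> T -> R) (iX : iid_normal P X).

Lemma iid_normal_resample_le (S : pred I) (f : fam I -> \bar R) (g : T -> \bar R) :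
  measurable_fun setT f -> (forall x, 0 <= f x)%E -> measurable_fun setT g ->
  (forall w, \int[P]_w' f (fun i => if S i then X i w' else X i w) <= g w)%E ->
  (\int[P]_w f (X ^~ w) <= \int[P]_w g w)%E.
Proof.
move=> mf f0 mg fg; have [mX _] := iX.
rewrite (iid_normal_resample S iX mf f0); apply: ge0_le_integral => //.
- by move=> w _; apply: integral_ge0.
- have mh : measurable_fun setT (fun ww : T * T =>
      f (fun i => if S i then X i ww.2 else X i ww.1)).
    exact: measurableT_comp mf (measurable_if_fam _ mX mX).
  exact: (@measurable_fun_fubini_tonelli_F _ _ T T R P _ mh (fun=> f0 _)).
Qed.

Lemma iid_normal_resample_le2 (S : pred I) (f h : fam I -> \bar R) :
  measurable_fun setT f -> (forall x, 0 <= f x)%E ->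
  measurable_fun setT h -> (forall x, 0 <= h x)%E ->
  (forall w, \int[P]_w' f (fun i => if S i then X i w' else X i w) <=
             \int[P]_w' h (fun i => if S i then X i w' else X i w))%E ->
  (\int[P]_w f (X ^~ w) <= \int[P]_w h (X ^~ w))%E.
Proof.
move=> mf f0 mh h0 fh; have [mX _] := iX.
rewrite (iid_normal_resample S iX mh h0).
apply: (iid_normal_resample_le mf f0) fh.
have mhh : measurable_fun setT (fun ww : T * T =>
    h (fun i => if S i then X i ww.2 else X i ww.1)).
  exact: measurableT_comp mh (measurable_if_fam _ mX mX).
exact: (@measurable_fun_fubini_tonelli_F _ _ T T R P _ mhh (fun=> h0 _)).
Qed.

End Resample.

Section Chi.
Context {d : measure_display} {T : measurableType d} (P : probability T R).
Context (I : finType) (X : I -> T -> R) (iX : iid_normal P X).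
Variables (J : pred I) (eps : R) (eps0 : 0 < eps).

(** The inverse of the chi variable over the coordinates in [J]. The summand [eps] bounds it, so
    every moment is finite and [chi_moment_step] may be solved for the higher moment by
    subtraction. *)
Definition chi_inv (x : I -> R) : R := (Num.sqrt (\sum_(i | J i) x i ^+ 2 + eps))^-1.

Lemma chi_sum_gt0 x : 0 < \sum_(i | J i) x i ^+ 2 + eps.
Proof. by rewrite ltr_wpDl// sumr_ge0// => i _; exact: sqr_ge0. Qed.

Lemma chi_inv_gt0 x : 0 < chi_inv x.
Proof. by rewrite invr_gt0 sqrtr_gt0 chi_sum_gt0. Qed.

Lemma chi_invX_ge0 x s : 0 <= chi_inv x ^+ s.
Proof. by rewrite exprn_ge0// ltW// chi_inv_gt0. Qed.

Lemma sum_chi_inv x : \sum_(i | J i) x i ^+ 2 * chi_inv x ^+ 2 <= 1.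
Proof.
rewrite -big_distrl /= exprVn sqr_sqrtr; last exact: ltW (chi_sum_gt0 x).
by rewrite ler_pdivrMr ?chi_sum_gt0// mul1r lerDl ltW.
Qed.

Lemma chi_inv_le x : chi_inv x <= (Num.sqrt eps)^-1.
Proof.
rewrite lef_pV2 ?posrE ?sqrtr_gt0 ?chi_sum_gt0// ler_sqrt ?(ltW (chi_sum_gt0 _))//.
by rewrite lerDr sumr_ge0// => i _; exact: sqr_ge0.
Qed.

Lemma measurable_chi_inv (s : nat) :
  measurable_fun setT (fun x : fam I => (chi_inv x ^+ s)%:E).
Proof.
apply/measurable_EFinP; apply: measurable_funX; apply: measurable_invr.
apply: measurable_sqrtr; apply: measurable_funD => //.
rewrite (_ : (fun x => _) = (fun x : fam I => \sum_i if J i then x i ^+ 2 else 0)).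
  apply: measurable_sum => i; case: (J i) => //.
  by apply: measurable_funX; exact: measurable_eval.
by apply/funext => x; rewrite big_mkcond.
Qed.

Definition chi_step_rhs (s : nat) (j : I) (x : fam I) : R :=
  s%:R * x j ^+ 2 * chi_inv x ^+ s.+2 + x j ^+ 2 * chi_inv x ^+ s.

Lemma chi_step_rhs_ge0 s j x : 0 <= chi_step_rhs s j x.
Proof.
apply: addr_ge0; apply: mulr_ge0; rewrite ?chi_invX_ge0 ?sqr_ge0//.
by apply: mulr_ge0 => //; exact: sqr_ge0.
Qed.

Lemma measurable_chi_step_rhs s j :
  measurable_fun setT (fun x : fam I => (chi_step_rhs s j x)%:E).
Proof.
have mj : measurable_fun setT (fun x : fam I => x j ^+ 2).
  by apply: measurable_funX; exact: measurable_eval.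
have mc n : measurable_fun setT (fun x : fam I => chi_inv x ^+ n).
  by apply/measurable_EFinP; exact: measurable_chi_inv.
apply/measurable_EFinP; apply: measurable_funD; apply: measurable_funM => //.
exact: measurable_funM.
Qed.

Lemma chi_step_coord (s : nat) (j : I) : J j ->
  (\int[P]_w (chi_inv (X ^~ w) ^+ s)%:E <=
   \int[P]_w (chi_step_rhs s j (X ^~ w))%:E)%E.
Proof.
move=> Jj; have [mX _] := iX.
apply: (iid_normal_resample_le2 iX (S := pred1 j)
  (f := fun x => (chi_inv x ^+ s)%:E) (h := fun x => (chi_step_rhs s j x)%:E)).
- exact: measurable_chi_inv.
- by move=> x; rewrite lee_fin chi_invX_ge0.
- exact: measurable_chi_step_rhs.
- by move=> x; rewrite lee_fin chi_step_rhs_ge0.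
move=> w; pose c := \sum_(i | J i && (i != j)) X i w ^+ 2 + eps.
have c0 : 0 < c.
  by rewrite ltr_wpDl// sumr_ge0// => i _; exact: sqr_ge0.
have chiE w' : chi_inv (fun i => if pred1 j i then X i w' else X i w) =
    (Num.sqrt (X j w' ^+ 2 + c))^-1.
  rewrite /chi_inv (bigD1 j)//= eqxx -addrA; congr ((Num.sqrt (_ + (_ + _)))^-1).
  by apply: eq_bigr => i /andP[_ /negbTE ->].
pose rho (y : R) := (Num.sqrt (y ^+ 2 + c))^-1.
have mrho n : measurable_fun setT (fun y => rho y ^+ n).
  apply: measurable_funX; apply: measurable_invr; apply: measurable_sqrtr.
  by apply: measurable_funD => //; exact: measurable_funX.
have rho0 y n : 0 <= rho y ^+ n by rewrite exprn_ge0// invr_ge0.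
pose g1 (y : R) := (rho y ^+ s)%:E.
pose g2 (y : R) := (s%:R * y ^+ 2 * rho y ^+ s.+2 + y ^+ 2 * rho y ^+ s)%:E.
have -> : (\int[P]_w' (chi_inv (fun i => if pred1 j i then X i w' else X i w) ^+ s)%:E
    = \int[P]_w' g1 (X j w'))%E.
  by apply: eq_integral => w' _; rewrite chiE.
have -> : (\int[P]_w' (chi_step_rhs s j (fun i => if pred1 j i then X i w' else X i w))%:E
    = \int[P]_w' g2 (X j w'))%E.
  by apply: eq_integral => w' _; rewrite /chi_step_rhs chiE /= eqxx.
rewrite (@iid_normal_one _ _ _ P _ X iX j g1); last 2 first.
- by apply/measurable_EFinP; exact: mrho.
- by move=> y; rewrite lee_fin.
rewrite (@iid_normal_one _ _ _ P _ X iX j g2); first exact: stein_chi.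
- have my2 : measurable_fun setT (fun y : R => y ^+ 2) by exact: exprn_measurable.
  apply/measurable_EFinP; apply: measurable_funD; apply: measurable_funM => //.
  exact: measurable_funM.
- move=> y; rewrite lee_fin; apply: addr_ge0; apply: mulr_ge0 => //; rewrite ?sqr_ge0//.
  by apply: mulr_ge0 => //; exact: sqr_ge0.
Qed.

Lemma chi_moment_fin (s : nat) :
  (\int[P]_w (chi_inv (X ^~ w) ^+ s)%:E \is a fin_num)%E.
Proof.
have [mX _] := iX.
have mchi : measurable_fun setT (fun w => (chi_inv (X ^~ w) ^+ s)%:E).
  exact: measurableT_comp (measurable_chi_inv s) (measurable_fam mX).
rewrite ge0_fin_numE; last by apply: integral_ge0 => w _; rewrite lee_fin chi_invX_ge0.
apply: (@le_lt_trans _ _ (\int[P]_w ((Num.sqrt eps)^-1 ^+ s)%:E)%E).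
  apply: ge0_le_integral => //.
  - by move=> w _; rewrite lee_fin chi_invX_ge0.
  - move=> w _; rewrite lee_fin; apply: lerXn2r; last exact: chi_inv_le.
      by rewrite nnegrE ltW// chi_inv_gt0.
    by rewrite nnegrE invr_ge0 sqrtr_ge0.
by rewrite integral_cst//= [X in (_ * X)%E]probability_setT mule1 ltry.
Qed.

Definition chi_moment (s : nat) : R := fine (\int[P]_w (chi_inv (X ^~ w) ^+ s)%:E)%E.

Lemma chi_momentE s :
  (\int[P]_w (chi_inv (X ^~ w) ^+ s)%:E = (chi_moment s)%:E)%E.
Proof. by rewrite fineK// chi_moment_fin. Qed.

Lemma sum_chi_step_rhs s x :
  \sum_(j | J j) chi_step_rhs s.+2 j x <= s.+2%:R * chi_inv x ^+ s.+2 + chi_inv x ^+ s.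
Proof.
pose u := \sum_(i | J i) x i ^+ 2 * chi_inv x ^+ 2.
have u1 : u <= 1 := sum_chi_inv x.
have -> : \sum_(j | J j) chi_step_rhs s.+2 j x =
    s.+2%:R * u * chi_inv x ^+ s.+2 + u * chi_inv x ^+ s.
  rewrite /u mulr_sumr !mulr_suml -big_split /=; apply: eq_bigr => j _.
  by rewrite /chi_step_rhs !exprS; ring.
apply: lerD; last by rewrite ler_piMl ?chi_invX_ge0.
by rewrite ler_wpM2r ?chi_invX_ge0// ler_piMr.
Qed.

(** Sum [chi_step_coord] over the coordinates in [J]: the weights [x j ^+ 2 * chi_inv x ^+ 2] add up
    to at most 1, so each of the two terms on the right loses its square together with two powers of
    [chi_inv]. *)
Lemma chi_moment_step (s : nat) :
  #|J|%:R * chi_moment s.+2 <= s.+2%:R * chi_moment s.+2 + chi_moment s.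
Proof.
have [mX _] := iX.
have mchi n : measurable_fun setT (fun w => (chi_inv (X ^~ w) ^+ n)%:E).
  exact: measurableT_comp (measurable_chi_inv n) (measurable_fam mX).
have mstep j : measurable_fun setT (fun w => (chi_step_rhs s.+2 j (X ^~ w))%:E).
  exact: measurableT_comp (measurable_chi_step_rhs s.+2 j) (measurable_fam mX).
rewrite -lee_fin EFinD !EFinM -!chi_momentE.
apply: (@le_trans _ _ (\sum_(j | J j) \int[P]_w (chi_step_rhs s.+2 j (X ^~ w))%:E)%E).
  have -> : (#|J|%:R%:E * \int[P]_w (chi_inv (X ^~ w) ^+ s.+2)%:E =
      \sum_(j | J j) \int[P]_w (chi_inv (X ^~ w) ^+ s.+2)%:E)%E.
    by rewrite chi_momentE sumEFin sumr_const -EFinM mulr_natl.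
  by apply: lee_sum => j; exact: chi_step_coord.
pose h j w := if J j then (chi_step_rhs s.+2 j (X ^~ w))%:E else 0%E.
have -> : (\sum_(j | J j) \int[P]_w (chi_step_rhs s.+2 j (X ^~ w))%:E =
   \int[P]_w \sum_j h j w)%E.
  rewrite ge0_integral_sum//; last 2 first.
  - by move=> j; rewrite /h; case: (J j).
  - by move=> j w _; rewrite /h; case: ifP => // _; rewrite lee_fin chi_step_rhs_ge0.
  rewrite big_mkcond /=; apply: eq_bigr => j _.
  by rewrite /h; case: (J j) => //; rewrite integral0.
have -> : (s.+2%:R%:E * \int[P]_w (chi_inv (X ^~ w) ^+ s.+2)%:E +
    \int[P]_w (chi_inv (X ^~ w) ^+ s)%:E =
    \int[P]_w (s.+2%:R * chi_inv (X ^~ w) ^+ s.+2 + chi_inv (X ^~ w) ^+ s)%:E)%E.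
  under [RHS]eq_integral do rewrite EFinD EFinM.
  rewrite ge0_integralD//; last 3 first.
  - by move=> w _; rewrite mule_ge0// lee_fin ?chi_invX_ge0.
  - exact: measurable_funeM.
  - by move=> w _; rewrite lee_fin chi_invX_ge0.
  by rewrite ge0_integralZl// => w _; rewrite lee_fin chi_invX_ge0.
apply: ge0_le_integral => //.
- move=> w _; apply: sume_ge0 => j _; rewrite /h; case: ifP => // _.
  by rewrite lee_fin chi_step_rhs_ge0.
- by apply: emeasurable_sum => j; rewrite /h; case: (J j).
- have mc n : measurable_fun setT (fun w => chi_inv (X ^~ w) ^+ n).
    by apply/measurable_EFinP; exact: (mchi n).
  by apply/measurable_EFinP; apply: measurable_funD => //; exact: measurable_funM.
move=> w _; rewrite /h -big_mkcond /= sumEFin lee_fin.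
exact: sum_chi_step_rhs.
Qed.

Lemma chi_moment_le (s : nat) : (2 < #|J|)%N -> (s < #|J|)%N ->
  chi_moment s <= cmom #|J| s.
Proof.
move=> J2.
have m0 : chi_moment 0 = 1.
  rewrite /chi_moment; under eq_integral do rewrite expr0.
  by rewrite integral_cst//= mul1e [P _]probability_setT.
have step n : (n.+2 < #|J|)%N -> chi_moment n.+2 <= chi_moment n / (#|J| - n.+2)%:R.
  move=> nJ; rewrite ler_pdivlMr; last by rewrite ltr0n subn_gt0.
  rewrite natrB ?(ltnW nJ)// mulrBr lerBlDl ![chi_moment n.+2 * _]mulrC.
  exact: chi_moment_step.
elim/nat_ind2: s => [||s IHs] sJ; first by rewrite m0.
  have m2 := step 0%N J2; rewrite m0 in m2.
  have J2' : 0 < (#|J| - 2)%:R :> R by rewrite ltr0n subn_gt0.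
  pose c : R := Num.sqrt (#|J| - 2)%:R; have c0 : 0 < c by rewrite sqrtr_gt0.
  have c2 : c ^+ 2 = (#|J| - 2)%:R by rewrite sqr_sqrtr// ltW.
  have [mX _] := iX.
  have mchi n : measurable_fun setT (fun w => (chi_inv (X ^~ w) ^+ n)%:E).
    exact: measurableT_comp (measurable_chi_inv n) (measurable_fam mX).
  (* This integrates [y <= (c / 2) y^2 + 1 / (2 c)]. The choice [c^2 = N - 2], with [N] the size of
     [J], balances the two terms once the second moment is at most [1 / c^2]. *)
  have : chi_moment 1 <= (c / 2) * chi_moment 2 + (2 * c)^-1 * chi_moment 0.
    have k1 : 0 <= c / 2 by rewrite divr_ge0// ltW.
    have k2 : 0 <= (2 * c)^-1 by rewrite invr_ge0 mulr_ge0// ltW.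
    rewrite -lee_fin EFinD (EFinM (c / 2)) (EFinM (2 * c)^-1) -!chi_momentE.
    have chi0 n w : (0 <= (chi_inv (X ^~ w) ^+ n)%:E)%E by rewrite lee_fin chi_invX_ge0.
    rewrite -ge0_integralZl// -ge0_integralZl//.
    rewrite -ge0_integralD//; last 4 first.
    - by move=> w _; rewrite mule_ge0.
    - exact: measurable_funeM.
    - by move=> w _; rewrite mule_ge0.
    - exact: measurable_funeM.
    apply: ge0_le_integral => //.
    - by apply: emeasurable_funD; exact: measurable_funeM.
    move=> w _; rewrite -!EFinM -EFinD lee_fin expr0 expr1 mulr1.
    set y := chi_inv _.
    rewrite -subr_ge0 (_ : _ - _ = (c * y - 1) ^+ 2 / (2 * c)).
      by rewrite divr_ge0 ?sqr_ge0// mulr_ge0// ltW.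
    by field; rewrite gt_eqF.
  move=> h; apply: le_trans h _; rewrite m0 mulr1.
  apply: (@le_trans _ _ (c / 2 * (1 / c ^+ 2) + (2 * c)^-1)).
    by rewrite lerD2r ler_wpM2l ?c2// divr_ge0// ltW.
  rewrite /= -/c (_ : _ + _ = c^-1)//; by field; rewrite gt_eqF.
apply: le_trans (step s sJ) _.
by rewrite /= ler_wpM2r// IHs// (ltn_trans _ sJ).
Qed.

End Chi.
End Moments.

(** * Measurability of matrix operations *)

Section Measurability.
Context {R : realType} {d : measure_display} {T : measurableType d}.

Lemma measurable_det k (M : T -> 'M[R]_k) :
  (forall i j, measurable_fun setT (fun w => M w i j)) ->
  measurable_fun setT (fun w => \det (M w)).
Proof.
move=> mM; apply: measurable_sum => s; apply: measurable_funM => //.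
by apply: measurable_prod => i _; exact: mM.
Qed.

Lemma measurable_adj k (M : T -> 'M[R]_k) i j :
  (forall i j, measurable_fun setT (fun w => M w i j)) ->
  measurable_fun setT (fun w => (\adj (M w)) i j).
Proof.
move=> mM; under eq_fun do rewrite mxE /cofactor.
apply: measurable_funM => //; apply: measurable_det => a b.
by under eq_fun do rewrite !mxE; exact: mM.
Qed.

Lemma measurable_mulmx m n p (A : T -> 'M[R]_(m, n)) (B : T -> 'M[R]_(n, p)) i j :
  (forall i j, measurable_fun setT (fun w => A w i j)) ->
  (forall i j, measurable_fun setT (fun w => B w i j)) ->
  measurable_fun setT (fun w => (A w *m B w) i j).
Proof.
move=> mA mB; under eq_fun do rewrite mxE.
by apply: measurable_sum => e; apply: measurable_funM.
Qed.

Lemma measurable_eq0 (f : T -> R) : measurable_fun setT f ->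
  measurable [set w | f w = 0].
Proof.
move=> mf; rewrite (_ : mkset _ = f @^-1` [set 0])//.
by rewrite -[_ @^-1` _]setTI; apply: mf.
Qed.

End Measurability.

(** * Pseudo-inverse of a Gaussian matrix *)

Section GramInverse.
Context {R : realType}.

(* The transpose of the pseudo-inverse of a matrix of full row rank, written so
   that its entries are visibly measurable; it is 0 otherwise. *)
Definition gram_inv k l (M : 'M[R]_(k, l)) : 'M[R]_(k, l) :=
  (\det (M *m M^T))^-1 *: (\adj (M *m M^T) *m M).

Lemma gram_invE k l (M : 'M[R]_(k, l)) : M *m M^T \in unitmx ->
  gram_inv M = invmx (M *m M^T) *m M.
Proof. by move=> uM; rewrite /gram_inv /invmx uM -scalemxAl. Qed.

Lemma gram_invK k l (M : 'M[R]_(k, l)) : M *m M^T \in unitmx ->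
  M *m (gram_inv M)^T = 1%:M.
Proof.
move=> uM; rewrite gram_invE// trmx_mul trmx_inv trmx_mul trmxK mulmxA.
exact: mulmxV.
Qed.

(* Row j of gram_inv M has inner product 1 with row j of M, and it is orthogonal
   to the other rows; J rotates these into the first k-1 coordinates. *)
Lemma gram_inv_row_le k l (M : 'M[R]_(k, l)) (J : 'M[R]_l) (j : 'I_k) :
  J^T *m J = 1%:M ->
  (forall i (c : 'I_l), (k.-1 <= c)%N -> i != j -> (M *m J) i c = 0) ->
  (\sum_c gram_inv M j c ^+ 2) *
    (\sum_(c : 'I_l | (k.-1 <= c)%N) (M *m J) j c ^+ 2) <= 1.
Proof.
move=> oJ MJ0.
have [uM|uM] := boolP (M *m M^T \in unitmx); last first.
  rewrite big1 ?mul0r// => c _.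
  have -> : gram_inv M = 0.
    by rewrite /gram_inv (_ : \det _ = 0) ?invr0 ?scale0r//; apply/eqP;
      rewrite -[_ == _]negbK -unitfE -unitmxE.
  by rewrite mxE expr0n.
have orthC := mulmx1C oJ.
set t := \sum_c _.
pose Gi := invmx (M *m M^T).
have GiT : Gi^T = Gi by rewrite /Gi trmx_inv trmx_mul trmxK.
have tE : t = Gi j j.
  transitivity ((gram_inv M *m (gram_inv M)^T) j j).
    by rewrite [RHS]mxE; apply: eq_bigr => c _; rewrite [X in _ * X]mxE expr2.
  rewrite gram_invE// -/Gi trmx_mul GiT mulmxA -(mulmxA Gi) -/Gi.
  by rewrite /Gi mulVmx// mul1mx.
have t2 : t = \sum_c (gram_inv M *m J) j c ^+ 2.
  transitivity ((gram_inv M *m J *m (gram_inv M *m J)^T) j j).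
    rewrite trmx_mul mulmxA -(mulmxA (gram_inv M)) orthC mulmx1 [RHS]mxE.
    by apply: eq_bigr => c _; rewrite [X in _ * X]mxE expr2.
  by rewrite [LHS]mxE; apply: eq_bigr => c _; rewrite [X in _ * X]mxE expr2.
(* In these columns only row [j] of [M *m J] survives, and its coefficient in row [j] of
   [gram_inv M] is [Gi j j], which is [t]. *)
have hJ (c : 'I_l) : (k.-1 <= c)%N -> (gram_inv M *m J) j c = t * (M *m J) j c.
  move=> kc; rewrite gram_invE// -/Gi -mulmxA mxE (bigD1 j)//= -tE.
  by rewrite big1 ?addr0// => i ij; rewrite MJ0 ?mulr0.
set r := \sum_(c | _) _.
have t0 : 0 <= t by apply: sumr_ge0 => c _; exact: sqr_ge0.
have : t ^+ 2 * r <= t.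
  rewrite [leRHS]t2 (bigID (fun c : 'I_l => (k.-1 <= c)%N))/=.
  rewrite -[leLHS]addr0; apply: lerD; last by apply: sumr_ge0 => c _; exact: sqr_ge0.
  by rewrite /r mulr_sumr; apply: ler_sum => c kc; rewrite hJ// exprMn.
move: t0; rewrite le_eqVlt => /predU1P[<-|t0]; first by rewrite mul0r.
by rewrite expr2 -mulrA ger_pMr.
Qed.

Lemma measurable_gram_inv {d} {T : measurableType d} k l (M : T -> 'M[R]_(k, l)) j c :
  (forall i j, measurable_fun setT (fun w => M w i j)) ->
  measurable_fun setT (fun w => gram_inv (M w) j c).
Proof.
move=> mM.
have mMT i i' : measurable_fun setT (fun w => (M w)^T i i').
  by under eq_fun do rewrite mxE; exact: mM.
have mG i i' : measurable_fun setT (fun w => (M w *m (M w)^T) i i').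
  exact: measurable_mulmx.
under eq_fun do rewrite mxE.
apply: measurable_funM; first exact: (measurable_invr (measurable_det mG)).
by apply: measurable_mulmx => // i i'; exact: measurable_adj.
Qed.

End GramInverse.

(** * Almost sure invertibility of a square Gaussian matrix *)

Section Nonsingular.
Context {R : realType} {d : measure_display} {T : measurableType d}.
Variable P : probability T R.
Notation N01 := (@normal_prob R 0 1).
Local Notation fam := (@fam R).

Lemma normal_prob_set1 (a : R) : N01 [set a] = 0%E.
Proof.
have /null_content_dominatesP := @normal_prob_dominates R 0 1.
move=> h; apply: h; last exact: lebesgue_measure_set1.
exact: (measurable_set1 (a : measurableTypeR R)).
Qed.

Definition fam_mx k l (x : 'I_k * 'I_l -> R) : 'M[R]_(k, l) := \matrix_(i, j) x (i, j).

Lemma measurable_fam_mx k l (i : 'I_k) (j : 'I_l) :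
  measurable_fun setT (fun x : fam ('I_k * 'I_l)%type => fam_mx x i j).
Proof.
rewrite [X in measurable_fun _ X](_ : _ = fun x => x (i, j)).
  exact: (@measurable_eval R _ (i, j)).
by apply/funext => x; rewrite mxE.
Qed.

(** Expanded along row 0, the determinant is affine in the corner entry, with the complementary
    minor as slope. That minor is almost surely nonzero by induction; with the other entries frozen,
    a single value of the corner entry is then bad. *)
Lemma det_normal_neq0 k (X : 'I_k * 'I_k -> T -> R) : iid_normal P X ->
  P [set w | \det (fam_mx (X ^~ w)) = 0] = 0%E.
Proof.
elim: k X => [|k IHk] X iX.
  rewrite (_ : mkset _ = set0) ?measure0//.
  by apply/seteqP; split=> // w /=; rewrite det_mx00 => /eqP; rewrite oner_eq0.
have [mX _] := iX.
pose D (x : fam ('I_k.+1 * 'I_k.+1)%type) := \det (fam_mx x).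
pose C (x : fam ('I_k.+1 * 'I_k.+1)%type) := \det (row' 0 (col' 0 (fam_mx x))).
have mD : measurable_fun setT D.
  by apply: measurable_det => i j; exact: measurable_fam_mx.
have mC : measurable_fun setT C.
  apply: measurable_det => i j.
  rewrite [X in measurable_fun _ X](_ : _ = fun x => x (lift 0 i, lift 0 j)).
    exact: (@measurable_eval R _ (lift 0 i, lift 0 j)).
  by apply/funext => x; rewrite !mxE.
pose mf := measurable_fam mX.
pose A := [set x : fam ('I_k.+1 * 'I_k.+1)%type | D x = 0].
pose B := [set x : fam ('I_k.+1 * 'I_k.+1)%type | C x = 0].
have mA : measurable A by exact: measurable_eq0.
have mB : measurable B by exact: measurable_eq0.
have mXA (E : set (fam ('I_k.+1 * 'I_k.+1)%type)) :
    measurable E -> measurable [set w | E (X ^~ w)].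
  by move=> mE; rewrite -[mkset _]setTI; exact: mf.
have PB : P [set w | B (X ^~ w)] = 0%E.
  pose e (ij : 'I_k * 'I_k) := (lift (0 : 'I_k.+1) ij.1, lift (0 : 'I_k.+1) ij.2).
  have einj : injective e.
    move=> [i j] [i' j'] h; congr (_, _); apply: (@lift_inj _ (0 : 'I_k.+1)).
      exact: (congr1 fst h).
    exact: (congr1 snd h).
  rewrite -[RHS](IHk _ (iid_normal_sub einj iX)); congr (P _).
  apply/seteqP; split=> w; rewrite /B /= => h; apply: etrans h; congr (\det _);
    by apply/matrixP => i j; rewrite !mxE.
have mAB : measurable (A `\` B) by exact: measurableD.
have PAB : P [set w | (A `\` B) (X ^~ w)] = 0%E.
  apply/eqP; rewrite eq_le measure_ge0 andbT.
  have mAB1 : measurable_fun setT (fun x : fam ('I_k.+1 * 'I_k.+1)%type =>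
      (\1_(A `\` B) x)%:E : \bar R) by exact/measurable_EFinP/measurable_indic.
  have := @iid_normal_resample_le R _ _ P _ X iX (pred1 (0, 0)) _ (fun=> 0%E)
    mAB1 (fun=> _) (measurable_cst _) _.
  rewrite integral0 (_ : (fun w => (\1_(A `\` B) (X ^~ w))%:E) =
    (fun w => (\1_[set w | (A `\` B) (X ^~ w)] w)%:E))// integral_indic// ?setIT//;
    last exact: mXA.
  apply; first by move=> x; rewrite lee_fin.
  move=> w; pose M := fam_mx (X ^~ w).
  pose x w' : fam ('I_k.+1 * 'I_k.+1)%type :=
    fun i => if pred1 (0, 0) i then X i w' else X i w.
  have Cx w' : C (x w') = C (X ^~ w).
    by congr (\det _); apply/matrixP => i j; rewrite !mxE.
  pose r := \sum_(j | j != 0) M 0 j * cofactor M 0 j.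
  have Dx w' : D (x w') = X (0, 0) w' * C (X ^~ w) + r.
    have cofE j : cofactor (fam_mx (x w')) 0 j = cofactor M 0 j.
      by congr (_ * \det _); apply/matrixP => i j'; rewrite !mxE.
    rewrite /D (expand_det_row _ 0) (bigD1 0)//= cofE mxE; congr (_ + _).
      by rewrite /cofactor addn0 expr0 mul1r.
    by apply: eq_bigr => j /negbTE j0; rewrite cofE !mxE /x /= xpair_eqE j0 andbF.
  pose a := - r / C (X ^~ w).
  pose g (y : R) : \bar R := (\1_[set a] y)%:E.
  have m1 : measurable [set a] by exact: measurable_set1.
  have mg : measurable_fun setT g by apply/measurable_EFinP; exact: measurable_indic.
  have g0 y : (0 <= g y)%E by rewrite lee_fin.
  apply: (@le_trans _ _ (\int[P]_w' g (X (0%R, 0%R) w'))%E); last first.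
    rewrite (@iid_normal_one _ _ _ P _ X iX (0, 0) g mg g0).
    by rewrite integral_indic// setIT [leLHS]normal_prob_set1.
  apply: ge0_le_integral => //.
  - apply: measurableT_comp mAB1 _; apply: measurable_fam => i.
    by case: (pred1 _ i).
  - exact: measurableT_comp mg (mX _).
  move=> w' _; rewrite lee_fin !indicE.
  have [/set_mem[/= Ax Bx]|_] := boolP (x w' \in A `\` B); last by [].
  rewrite mem_set//= /a; apply: (canRL (mulfK _)).
    by apply/eqP => C0; apply: Bx; rewrite /B /= Cx.
  by apply/eqP; rewrite -addr_eq0 -Dx; apply/eqP.
apply/eqP; rewrite eq_le measure_ge0 andbT.
rewrite -[leRHS]adde0 -{1}PB -PAB.
apply: le_trans (measureU2 _ _ _); [|exact: mXA|exact: mXA].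
apply: le_measure; rewrite ?inE.
- by apply: (mXA A).
- by apply: measurableU; exact: mXA.
move=> w Aw; have [Bw|Bw] := pselect (B (X ^~ w)); first by left.
by right.
Qed.

End Nonsingular.

(** * Moments of the inner products with the pseudo-inverse *)

Section KeyEstimate.
Context {R : realType} {d : measure_display} {T : measurableType d}.
Variable P : probability T R.
Notation N01 := (@normal_prob R 0 1).
Local Notation fam := (@fam R).

(** Triangularizing the one-row matrix [v] rotates it onto the first axis, so the form becomes one
    standard normal coordinate times plus or minus the length of [v]. *)
Lemma linear_form_moment l (Y : 'I_l -> T -> R) (v : 'I_l -> R) (s : nat) :
  (0 < l)%N -> iid_normal P Y ->
  (\int[P]_w (`|\sum_c Y c w * v c| ^+ s)%:E <=
   (Num.sqrt (\sum_c v c ^+ 2) ^+ s * gmom s)%:E)%E.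
Proof.
case: l Y v => // l Y v _ iY.
have [J [oJ gJ] J0] := orth_gauss_triangularize (\row_c v c).
pose vJ := (\row_c v c) *m J.
pose Y' := rot_apply J Y.
have iY' : iid_normal P Y' by exact: gJ.
have oJ' := mulmx1C oJ.
have vJ0 c : c != 0 -> vJ 0 c = 0 by move=> c0; apply: J0; rewrite lt0n.
have sumE w : \sum_c Y c w * v c = Y' 0 w * vJ 0 0.
  transitivity (((\row_c Y c w) *m (\row_c v c)^T) 0 0).
    by rewrite mxE; apply: eq_bigr => c _; rewrite !mxE.
  transitivity (((\row_c Y c w *m J) *m vJ^T) 0 0).
    by rewrite /vJ trmx_mul mulmxA -(mulmxA _ J) oJ' mulmx1.
  rewrite mxE (bigD1 0)//= big1 ?addr0 => [|c c0]; last first.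
    by rewrite [X in _ * X]mxE vJ0// mulr0.
  rewrite [X in _ * X]mxE; congr (_ * _).
  by rewrite mxE; apply: eq_bigr => c _; rewrite mxE.
have normE : Num.sqrt (\sum_c v c ^+ 2) = `|vJ 0 0|.
  rewrite -sqrtr_sqr; congr Num.sqrt.
  transitivity ((\row_c v c *m (\row_c v c)^T) 0 0).
    by rewrite mxE; apply: eq_bigr => c _; rewrite !mxE expr2.
  transitivity ((vJ *m vJ^T) 0 0).
    by rewrite /vJ trmx_mul mulmxA -(mulmxA _ J) oJ' mulmx1.
  rewrite mxE (bigD1 0)//= big1 ?addr0 => [|c c0]; last by rewrite vJ0// mul0r.
  by rewrite [X in _ * X]mxE expr2.
rewrite normE EFinM.
under eq_integral do rewrite sumE normrM exprMn mulrC EFinM.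
have mg := @measurable_normX R s.
have [mY' _] := iY'.
have mgY : measurable_fun setT (fun w => (`|Y' 0 w| ^+ s)%:E).
  exact: measurableT_comp mg (mY' 0).
rewrite ge0_integralZl//.
apply: lee_wpmul2l; first by rewrite lee_fin exprn_ge0.
have e1 := @iid_normal_one _ _ _ P _ Y' iY' 0 _ mg.
apply: le_trans (normal_moment_le s).
rewrite le_eqVlt; apply/orP; left; apply/eqP; apply: e1.
by move=> y; rewrite lee_fin exprn_ge0.
Qed.

Section Rows.
Variables (k l : nat) (X : option 'I_k * 'I_l -> T -> R).
Hypothesis iX : iid_normal P X.
Local Notation I := (option 'I_k * 'I_l)%type.

(** The indices [Some a] hold the [k] leading rows and [None] holds a single later row: the later
    rows are handled one at a time. *)
Definition head_rows (x : I -> R) : 'M[R]_(k, l) := \matrix_(a, c) x (Some a, c).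

Definition last_row_form (j : 'I_k) (x : I -> R) : R :=
  \sum_c x (None, c) * gram_inv (head_rows x) j c.

Definition row_norm (j : 'I_k) (x : I -> R) : R :=
  Num.sqrt (\sum_c gram_inv (head_rows x) j c ^+ 2).

Lemma measurable_head_rows a c :
  measurable_fun setT (fun x : fam I => head_rows x a c).
Proof.
rewrite [X in measurable_fun _ X](_ : _ = fun x => x (Some a, c)).
  exact: (@measurable_eval R _ (Some a, c)).
by apply/funext => x; rewrite mxE.
Qed.

Lemma measurable_last_row_form j (s : nat) :
  measurable_fun setT (fun x : fam I => (`|last_row_form j x| ^+ s)%:E).
Proof.
apply/measurable_EFinP; apply: measurable_funX.
apply: measurableT_comp; first exact: normr_measurable.
apply: measurable_sum => c; apply: measurable_funM.
  exact: (@measurable_eval R _ (None, c)).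
by apply: measurable_gram_inv => a e; exact: measurable_head_rows.
Qed.

Lemma measurable_row_norm j : measurable_fun setT (fun x : fam I => row_norm j x).
Proof.
apply: measurable_sqrtr; apply: measurable_sum => c; apply: measurable_funX.
by apply: measurable_gram_inv => a e; exact: measurable_head_rows.
Qed.

Let mX : forall i, measurable_fun setT (X i) := iX.1.

Lemma last_row_form_moment j (s : nat) : (0 < l)%N ->
  (\int[P]_w (`|last_row_form j (X ^~ w)| ^+ s)%:E <=
   \int[P]_w (row_norm j (X ^~ w) ^+ s * gmom s)%:E)%E.
Proof.
move=> l0; pose S (i : I) := i.1 == None.
apply: (iid_normal_resample_le iX (S := S)
  (f := fun x => (`|last_row_form j x| ^+ s)%:E)).
- exact: measurable_last_row_form.
- by move=> x; rewrite lee_fin exprn_ge0.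
- apply/measurable_EFinP; apply: measurable_funM => //; apply: measurable_funX.
  exact: measurableT_comp (measurable_row_norm j) (measurable_fam mX).
move=> w; pose Y c w' := X (None, c) w'.
have iY : iid_normal P Y.
  by apply: (iid_normal_sub (e := fun c : 'I_l => (None : option 'I_k, c))) iX => c c' [].
have := linear_form_moment (fun c => gram_inv (head_rows (X ^~ w)) j c) s l0 iY.
move=> h; apply: (le_trans _ h); rewrite le_eqVlt; apply/orP; left; apply/eqP.
apply: eq_integral => w' _; congr ((`|_| ^+ s)%:E).
Qed.

Section Regularized.
Variables (j : 'I_k) (eps : R).
Hypothesis eps0 : 0 < eps.

(* reg keeps the moments finite before the bound is known; eps is sent to 0 by
   Fatou's lemma. *)
Definition reg (t : R) : R := t / Num.sqrt (1 + eps * t ^+ 2).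

Lemma reg_ge0 t : 0 <= t -> 0 <= reg t.
Proof. by move=> t0; rewrite divr_ge0. Qed.

Lemma measurable_reg : measurable_fun setT reg.
Proof.
apply: measurable_funM => //; apply: measurable_invr; apply: measurable_sqrtr.
by apply: measurable_funD => //; apply: measurable_funM => //; exact: exprn_measurable.
Qed.

(** For [t > 0], [reg t] is the inverse square root of [t^-2 + eps], so a bound of [t^2] by [1 / r]
    turns into domination by [chi_inv] with the same [eps]. *)
Lemma reg_le t r : 0 <= t -> 0 <= r -> t ^+ 2 * r <= 1 ->
  reg t <= (Num.sqrt (r + eps))^-1.
Proof.
move=> t0 r0 tr; have a0 : 0 < 1 + eps * t ^+ 2.
  by rewrite ltr_pwDl// mulr_ge0 ?sqr_ge0// ltW.
have b0 : 0 < r + eps by rewrite ltr_wpDl.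
rewrite /reg ler_pdivrMr ?sqrtr_gt0// mulrC ler_pdivlMr ?sqrtr_gt0//.
rewrite -[X in X * _](ger0_norm t0) -sqrtr_sqr -sqrtrM ?sqr_ge0// ler_sqrt ?(ltW a0)//.
by rewrite mulrDr [eps * _]mulrC lerD2r.
Qed.

(** Only row [j] is redrawn. The rotation [J] triangularizes the [k.-1] other rows, which are
    frozen, so it does not depend on the redrawn row, whose rotated entries are again iid. The
    entries in columns [k.-1] and beyond give the distance to the span, hence [l - k.-1] degrees of
    freedom. *)
Lemma row_norm_reg_moment (s : nat) : (k.-1 + 2 < l)%N -> (s < l - k.-1)%N ->
  (\int[P]_w (reg (row_norm j (X ^~ w)) ^+ s)%:E <= (cmom (l - k.-1) s : R)%:E)%E.
Proof.
move=> kl sl; pose S (i : I) := i.1 == Some j.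
pose c0 : \bar R := (cmom (l - k.-1) s : R)%:E.
have regm : measurable_fun setT (fun x : fam I => (reg (row_norm j x) ^+ s)%:E).
  apply/measurable_EFinP; apply: measurable_funX.
  exact: measurableT_comp measurable_reg (measurable_row_norm j).
have le1 : (\int[P]_w (reg (row_norm j (X ^~ w)) ^+ s)%:E <= \int[P]_w c0)%E.
  apply: (iid_normal_resample_le iX (S := S)
    (f := fun x => (reg (row_norm j x) ^+ s)%:E) (g := fun=> c0)) => //.
    by move=> x; rewrite lee_fin exprn_ge0// reg_ge0// sqrtr_ge0.
  move=> w; have [J [oJ gJ] J0] := orth_gauss_triangularize (row' j (head_rows (X ^~ w))).
  pose y c w' := X (Some j, c) w'.
  have iy : iid_normal P y.
    by apply: (iid_normal_sub (e := fun c : 'I_l => (Some j, c))) iX => c c' [].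
  have iy' := gJ _ _ _ _ iy.
  pose K := [pred c : 'I_l | (k.-1 <= c)%N].
  have cK : #|K| = (l - k.-1)%N.
    rewrite -sum1_card -(big_geq_mkord k.-1 l xpredT (fun=> 1%N)).
    by rewrite sum_nat_const_nat muln1.
  have K2 : (2 < #|K|)%N by rewrite cK ltn_subRL.
  have sK : (s < #|K|)%N by rewrite cK.
  have := chi_moment_le iy' eps0 K2 sK; rewrite cK -lee_fin -(chi_momentE iy' K eps0).
  move=> h; apply: (le_trans _ h).
  set x := fun w' (i : I) => if S i then X i w' else X i w.
  have regE w' : reg (row_norm j (x w')) <= chi_inv K eps ((rot_apply J y) ^~ w').
    apply: reg_le; [exact: sqrtr_ge0|by apply: sumr_ge0 => c _; exact: sqr_ge0|].
    rewrite sqr_sqrtr; last by apply: sumr_ge0 => c _; exact: sqr_ge0.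
    have hJ : forall i (c : 'I_l), (k.-1 <= c)%N -> i != j ->
        (head_rows (x w') *m J) i c = 0.
      move=> i c kc ij; have [i' ii' _] : {i' | i = lift j i' & unlift j i = Some i'}.
        by apply: unlift_some; rewrite eq_sym.
      rewrite ii' -(J0 i' c) ?(leq_trans (ltn_ord i') kc)// !mxE.
      apply: eq_bigr => e _; rewrite !mxE /x /S /=; case: eqP => // -[] /eqP.
      by rewrite eq_sym (negbTE (neq_lift _ _)).
    apply: le_trans (gram_inv_row_le oJ hJ).
    rewrite le_eqVlt; apply/orP; left; apply/eqP; congr (_ * _).
    apply: eq_bigr => c _; congr (_ ^+ 2); rewrite /rot_apply mxE.
    by apply: eq_bigr => e _; rewrite mxE /x /S /= eqxx.
  apply: ge0_le_integral => //.
  - by move=> w' _; rewrite lee_fin exprn_ge0// reg_ge0// sqrtr_ge0.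
  - apply: measurableT_comp regm _; apply: measurable_fam => i.
    by rewrite /x; case: (S i).
  - apply: measurableT_comp (measurable_chi_inv K eps s) _.
    exact: measurable_fam iy'.1.
  move=> w' _; rewrite lee_fin; apply: lerXn2r; last exact: regE.
    by rewrite nnegrE reg_ge0// sqrtr_ge0.
  by rewrite nnegrE ltW// chi_inv_gt0.
apply: (le_trans le1).
by rewrite integral_cst//= [X in (_ * X)%E]probability_setT mule1.
Qed.

End Regularized.

Lemma row_norm_moment (j : 'I_k) (s : nat) : (k.-1 + 2 < l)%N -> (s < l - k.-1)%N ->
  (\int[P]_w (row_norm j (X ^~ w) ^+ s)%:E <= (cmom (l - k.-1) s : R)%:E)%E.
Proof.
move=> kl sl.
pose f (n : nat) w : \bar R := (reg n.+1%:R^-1 (row_norm j (X ^~ w)) ^+ s)%:E.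
have mrow : measurable_fun setT (fun w => row_norm j (X ^~ w)).
  exact: measurableT_comp (measurable_row_norm j) (measurable_fam mX).
have mf n : measurable_fun setT (f n).
  apply/measurable_EFinP; apply: measurable_funX.
  exact: measurableT_comp (measurable_reg _) mrow.
have f0 n w : setT w -> (0 <= f n w)%E.
  by move=> _; rewrite lee_fin exprn_ge0// reg_ge0// sqrtr_ge0.
have flim w : f n w @[n --> \oo] --> (row_norm j (X ^~ w) ^+ s)%:E.
  pose t := row_norm j (X ^~ w).
  have h1 : (1 + n.+1%:R^-1 * t ^+ 2 : R) @[n --> \oo] --> (1 + 0 * t ^+ 2 : R).
    apply: (@cvgD _ R^o); first exact: cvg_cst.
    by apply: cvgM; [exact: cvg_harmonic|exact: cvg_cst].
  have h2 := cvg_comp _ _ h1 (@sqrt_continuous R _).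
  rewrite mul0r addr0 sqrtr1 in h2.
  have h3 : (Num.sqrt (1 + n.+1%:R^-1 * t ^+ 2))^-1 @[n --> \oo] --> (1^-1 : R).
    by apply: cvgV; [exact: oner_neq0|exact: h2].
  have h4 : t * (Num.sqrt (1 + n.+1%:R^-1 * t ^+ 2))^-1 @[n --> \oo] --> t * 1^-1.
    by apply: cvgM; [exact: cvg_cst|exact: h3].
  have h5 := cvg_comp _ _ h4 (@exprn_continuous R s _).
  rewrite invr1 mulr1 in h5.
  apply: cvg_EFin; first exact: nearW.
  exact: h5.
have := @fatou _ _ _ P setT measurableT f mf f0.
have -> : (\int[P]_w limn_einf (f ^~ w) = \int[P]_w (row_norm j (X ^~ w) ^+ s)%:E)%E.
  by apply: eq_integral => w _; rewrite (cvg_limn_einf_sup (flim w)).1.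
move=> h; apply: le_trans h _.
rewrite limn_einf_lim; apply: lime_le; first exact: is_cvg_einfs.
apply: nearW => n; have en : 0 < n.+1%:R^-1 :> R by rewrite invr_gt0.
apply: le_trans (row_norm_reg_moment j en kl sl).
by apply: ereal_inf_lbound; exists n => /=.
Qed.

Lemma last_row_moment (j : 'I_k) (s : nat) : (k.-1 + 2 < l)%N -> (s < l - k.-1)%N ->
  (\int[P]_w (`|last_row_form j (X ^~ w)| ^+ s)%:E <=
   (gmom s * cmom (l - k.-1) s : R)%:E)%E.
Proof.
move=> kl sl; have l0 : (0 < l)%N by case: (l) kl.
apply: le_trans (last_row_form_moment j s l0) _.
have mrow : measurable_fun setT (fun w => (row_norm j (X ^~ w) ^+ s)%:E).
  apply/measurable_EFinP; apply: measurable_funX.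
  exact: measurableT_comp (measurable_row_norm j) (measurable_fam mX).
under eq_integral do rewrite mulrC EFinM.
rewrite ge0_integralZl//; last 2 first.
- by move=> w _; rewrite lee_fin exprn_ge0// sqrtr_ge0.
- by rewrite lee_fin gmom_ge0.
by rewrite EFinM lee_wpmul2l ?lee_fin ?gmom_ge0// row_norm_moment.
Qed.

End Rows.
End KeyEstimate.

(** * Deterministic error bound *)

Section Frobenius.
Context {R : realType}.

Lemma sum_sqr_trace m n (M : 'M[R]_(m, n)) :
  \sum_(i < m) \sum_(j < n) M i j ^+ 2 = \tr (M^T *m M).
Proof.
rewrite exchange_big /=; apply: eq_bigr => j _; rewrite mxE.
by apply: eq_bigr => i _; rewrite mxE expr2.
Qed.

Lemma frobenius_trace m n (M : 'M[R]_(m, n)) :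
  frobenius_norm M = Num.sqrt (\tr (M^T *m M)).
Proof. by rewrite -sum_sqr_trace. Qed.

Lemma sum_sqr_ge0 m n (M : 'M[R]_(m, n)) : 0 <= \sum_(i < m) \sum_(j < n) M i j ^+ 2.
Proof. by do 2![apply: sumr_ge0 => ? _]; exact: sqr_ge0. Qed.

Lemma frobenius_ge0 m n (M : 'M[R]_(m, n)) : 0 <= frobenius_norm M.
Proof. exact: sqrtr_ge0. Qed.

Lemma sqr_frobenius m n (M : 'M[R]_(m, n)) :
  frobenius_norm M ^+ 2 = \sum_(i < m) \sum_(j < n) M i j ^+ 2.
Proof. by rewrite sqr_sqrtr// sum_sqr_ge0. Qed.

Lemma frobenius_orth m n (U : 'M[R]_m) (M : 'M[R]_(m, n)) (V : 'M[R]_n) :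
  U^T *m U = 1%:M -> V^T *m V = 1%:M ->
  frobenius_norm (U^T *m M *m V) = frobenius_norm M.
Proof.
move=> /mulmx1C oU /mulmx1C oV; rewrite !frobenius_trace; congr Num.sqrt.
rewrite !trmx_mul trmxK mxtrace_mulC !mulmxA -(mulmxA _ V) oV mulmx1.
rewrite mxtrace_mulC !mulmxA oU mul1mx.
by rewrite mxtrace_mulC.
Qed.

Lemma range_projK m n (Z : 'M[R]_(m, n)) : range_proj Z *m Z = Z.
Proof. exact: mp_mulKr (mp_inverseP Z). Qed.

Lemma range_proj_id m n (Z : 'M[R]_(m, n)) :
  range_proj Z *m range_proj Z = range_proj Z.
Proof. by rewrite {2}/range_proj mulmxA range_projK. Qed.

Lemma range_proj_sym m n (Z : 'M[R]_(m, n)) : (range_proj Z)^T = range_proj Z.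
Proof. exact: mp_symr (mp_inverseP Z). Qed.

Lemma frobenius_proj_le m n p (Z : 'M[R]_(m, n)) (M : 'M[R]_(m, p)) :
  frobenius_norm ((1%:M - range_proj Z) *m M) <= frobenius_norm M.
Proof.
rewrite /frobenius_norm ler_sqrt ?sum_sqr_ge0// !sum_sqr_trace.
set Q := range_proj Z.
have QT : Q^T = Q := range_proj_sym Z.
have QQ : Q *m Q = Q := range_proj_id Z.
rewrite trmx_mul linearB /= trmx1 QT mulmxA -(mulmxA M^T).
have -> : (1%:M - Q) *m (1%:M - Q) = 1%:M - Q.
  by rewrite mulmxBr mulmx1 mulmxBl mul1mx QQ subrr subr0.
rewrite mulmxBr mulmx1 mulmxBl linearB /= gerBl.
have -> : M^T *m Q *m M = (Q *m M)^T *m (Q *m M).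
  by rewrite trmx_mul QT mulmxA -(mulmxA M^T Q Q) QQ.
by rewrite -sum_sqr_trace sum_sqr_ge0.
Qed.

(** [1%:M - range_proj Z] annihilates [Z *m X] and, being an orthogonal projection, does not
    increase the norm. *)
Lemma frobenius_residual_le m n p (Z : 'M[R]_(m, n)) (A : 'M[R]_(m, p)) X :
  frobenius_norm ((1%:M - range_proj Z) *m A) <= frobenius_norm (A - Z *m X).
Proof.
have -> : (1%:M - range_proj Z) *m A = (1%:M - range_proj Z) *m (A - Z *m X).
  have ZX0 : (1%:M - range_proj Z) *m (Z *m X) = 0.
    by rewrite mulmxA mulmxBl mul1mx range_projK subrr mul0mx.
  by rewrite mulmxBr ZX0 subr0.
exact: frobenius_proj_le.
Qed.

(** The minimum over [X] is attained; measurability of the residual depends on this. *)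
Lemma frobenius_residual m n p (Z : 'M[R]_(m, n)) (A : 'M[R]_(m, p)) :
  (1%:M - range_proj Z) *m A = A - Z *m (mp_inverse Z *m A).
Proof. by rewrite mulmxBl mul1mx mulmxA. Qed.

End Frobenius.

(** * The residual in singular coordinates *)

Section SingularValues.
Context {R : realType}.
Variables (m n : nat) (A : 'M[R]_(m, n)) (U : 'M[R]_m) (Sigma : 'M[R]_(m, n)).
Variables (sigma : nat -> R) (V : 'M[R]_n).
Hypothesis svd : is_svd A U Sigma sigma V.

Let AE := svd_eq svd.
Let oU := svd_orthU svd.
Let oV := svd_orthV svd.
Let SE := svd_diag svd.

Lemma rect_diag_mulT (f g : nat -> R) (i i' : 'I_m) :
  (rect_diag_mx m n f *m (rect_diag_mx m n g)^T) i i' =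
  if (i == i') && (i < n)%N then f i.+1 * g i.+1 else 0.
Proof.
rewrite mxE; case: (ltnP i n) => [lin|lni].
  rewrite (bigD1 (Ordinal lin))//= big1 ?addr0 => [|j ji]; last first.
    rewrite !mxE; case: eqP => [ij|]; last by rewrite mul0r.
    by case/negP: ji; apply/eqP/val_inj.
  rewrite !mxE /= eqxx andbT; have [->|ne] := eqVneq i i'; first by rewrite eqxx.
  by rewrite ifN ?mulr0// eq_sym.
rewrite andbF big1// => j _; rewrite !mxE ifN ?mul0r//.
by rewrite neq_ltn orbC (leq_trans (ltn_ord j)).
Qed.

Lemma rect_diag_mul3 (f g h : nat -> R) :
  rect_diag_mx m n f *m (rect_diag_mx m n g)^T *m rect_diag_mx m n h =
  rect_diag_mx m n (fun i => f i * g i * h i).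
Proof.
apply/matrixP => i j; rewrite mxE (bigD1 i)//= big1 ?addr0 => [|i' ii']; last first.
  by rewrite rect_diag_mulT eq_sym (negbTE ii') mul0r.
rewrite rect_diag_mulT eqxx !mxE /=; case: eqP => [ij|]; last by rewrite mulr0.
by rewrite ij ltn_ord.
Qed.

Lemma svd_power (q : nat) :
  A *m (A^T *m A) ^+ q =
  U *m rect_diag_mx m n (fun i => sigma i ^+ (2 * q).+1) *m V^T.
Proof.
elim: q => [|q IHq].
  rewrite expr0 mulmx1 AE SE; congr (_ *m _ *m _).
rewrite exprSr -mulmxE mulmxA IHq AE !trmx_mul trmxK !mulmxA.
rewrite -(mulmxA _ V^T V) oV mulmx1 -(mulmxA _ U^T U) oU mulmx1.
rewrite SE -(mulmxA U) -(mulmxA U) -mulmxA mulmxA rect_diag_mul3.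
congr (_ *m _ *m _); apply/matrixP => i j; rewrite !mxE; case: ifP => // _.
by rewrite -!exprSr; congr (_ ^+ _); lia.
Qed.

Lemma rank_svd : \rank A = \rank Sigma.
Proof.
have uU : U \in unitmx by case: (mulmx1_unit oU).
have uV : V^T \in unitmx by case: (mulmx1_unit oV).
by rewrite AE mxrankMfree ?row_free_unit// eqmxMfull// row_full_unit.
Qed.

Lemma rank_svd_le_min : (\rank A <= minn m n)%N.
Proof. by rewrite leq_min rank_leq_row rank_leq_col. Qed.

(** If [sigma k] vanished, so would all later values, and [Sigma] would factor through dimension
    [k.-1], forcing a rank below [k]. *)
Lemma sigma_gt0 (k : nat) : (0 < k)%N -> (k <= \rank A)%N -> 0 < sigma k.
Proof.
move=> k0 kr; have kmn := leq_trans kr rank_svd_le_min.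
rewrite lt_def (svd_ge0 svd) ?k0// andbT; apply/eqP => sk0.
have sj0 j : (k <= j)%N -> (j <= minn m n)%N -> sigma j = 0.
  move=> kj jmn; apply/eqP; rewrite eq_le -{1}sk0 (svd_decr svd) ?k0//=.
  by rewrite (svd_ge0 svd)// (leq_trans k0 kj).
pose Pm : 'M[R]_(m, k.-1) := \matrix_(i, a) (i == a :> nat)%:R.
pose Qm : 'M[R]_(k.-1, n) := \matrix_(a, j) (if a == j :> nat then sigma a.+1 else 0).
have SPQ : Sigma = Pm *m Qm.
  rewrite SE; apply/matrixP => i j; rewrite !mxE.
  have [ik|ki] := ltnP i k.-1.
    rewrite (bigD1 (Ordinal ik))//= big1 ?addr0 => [|a ai]; last first.
      rewrite !mxE; case: eqP => [ia|_]; last by rewrite mul0r.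
      by case/negP: ai; apply/eqP/val_inj.
    by rewrite !mxE eqxx mul1r.
  rewrite big1 => [|a _]; last first.
    rewrite !mxE; case: eqP => [ia|_]; last by rewrite mul0r.
    by have := ltn_ord a; rewrite -ia ltnNge ki.
  case: eqP => // ij; apply: sj0; first by lia.
  by rewrite leq_min (ltn_ord i) ij ltn_ord.
have := leq_trans kr (eq_leq rank_svd).
rewrite SPQ => /leq_trans/(_ (mxrankM_maxl _ _))/leq_trans/(_ (rank_leq_col _)).
by lia.
Qed.

Lemma sum_trail_ord k p (F : 'I_p -> R) :
  \sum_(i : 'I_(p - k)) F (trail_ord i) = \sum_(i : 'I_p | (k <= i)%N) F i.
Proof.
rewrite [RHS](reindex_omap (@trail_ord k p) (fun i => insub (i - k)%N)); last first.
  move=> i ki; have h : (i - k < p - k)%N by have := ltn_ord i; lia.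
  by rewrite insubT /=; apply: (congr1 (@Some _)); apply: val_inj => /=; lia.
apply: eq_bigl => i /=; rewrite leq_addr /= addKn.
by rewrite (valK i) eqxx.
Qed.

Lemma sqr_frobenius_trail k :
  frobenius_norm (trail_mx k Sigma) ^+ 2 =
  \sum_(i : 'I_m | (k <= i)%N) \sum_(j : 'I_n | (k <= j)%N) Sigma i j ^+ 2.
Proof.
rewrite sqr_frobenius -sum_trail_ord; apply: eq_bigr => i _.
by rewrite -(sum_trail_ord _ (fun j => Sigma (trail_ord i) j ^+ 2));
  apply: eq_bigr => j _; rewrite mxE.
Qed.

Lemma sqr_frobenius_trail_sigma k :
  frobenius_norm (trail_mx k Sigma) ^+ 2 =
  \sum_(e : 'I_n | (k <= e)%N && (e < m)%N) sigma e.+1 ^+ 2.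
Proof.
rewrite sqr_frobenius_trail exchange_big /= [RHS]big_mkcondr /=.
apply: eq_bigr => e ke; rewrite SE; case: ltnP => [em|me].
  rewrite (bigD1 (Ordinal em))//= big1 ?addr0 ?mxE ?eqxx// => i /andP[_ ie].
  rewrite mxE ifN ?expr0n//; apply: contraNneq ie => ie.
rewrite big1// => i _; rewrite mxE ifN ?expr0n//.
by rewrite neq_ltn (leq_trans (ltn_ord i) me).
Qed.

Section Deterministic.
Variables (k l q : nat) (G : 'M[R]_(n, l)) (H : 'M[R]_(k, l)).
Hypotheses (k0 : (0 < k)%N) (kr : (k < \rank A)%N).

Let Om := V^T *m G.
Let W (e : 'I_n) (a : 'I_k) := \sum_c Om e c * H a c.

Hypothesis HOm : forall (e : 'I_n) (a : 'I_k), (e < k)%N -> W e a = (e == a :> nat)%:R.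

(** Indices start at 0 here, so [e] carries [sigma e.+1]; the condition [e < m] drops the columns in
    which [Sigma] has no diagonal entry. *)
Definition cross_sum : R :=
  \sum_(e : 'I_n | (k <= e)%N && (e < m)%N) sigma e.+1 ^+ 2 * \sum_a W e a ^+ 2.

Definition power_ratio : R := (sigma k.+1 / sigma k) ^+ (2 * q).

Let kmn : (k.+1 <= minn m n)%N := leq_trans kr rank_svd_le_min.

(* The test matrix X = H^T D V^T makes the first k rows of U^T (A - Z X) V vanish. *)
Let D : 'M[R]_(k, n) := \matrix_(a, j) (if a == j :> nat then sigma a.+1 ^- (2 * q) else 0).
Let Z := A *m (A^T *m A) ^+ q *m G.
Let E := Sigma - rect_diag_mx m n (fun i => sigma i ^+ (2 * q).+1) *m (Om *m H^T *m D).

Lemma rotated_residual :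
  U^T *m (A - Z *m (H^T *m D *m V^T)) *m V = E.
Proof.
have UZ : U^T *m Z = rect_diag_mx m n (fun i => sigma i ^+ (2 * q).+1) *m Om.
  by rewrite /Z svd_power /Om !mulmxA oU mul1mx.
have UA : U^T *m A *m V = Sigma.
  by rewrite {1}AE !mulmxA oU mul1mx -mulmxA oV mulmx1.
rewrite mulmxBr mulmxBl UA (mulmxA U^T Z) UZ !mulmxA -(mulmxA _ V^T V) oV mulmx1.
by rewrite /E !mulmxA.
Qed.

(** Each sum has at most one term. Writing sums keeps one formula valid for [i >= n] and for
    [j >= k], where they are empty. *)
Lemma residual_entry (i : 'I_m) (j : 'I_n) :
  (rect_diag_mx m n (fun i => sigma i ^+ (2 * q).+1) *m (Om *m H^T *m D)) i j =
  \sum_(e : 'I_n | i == e :> nat) \sum_(a : 'I_k | a == j :> nat)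
    sigma e.+1 ^+ (2 * q).+1 * W e a * sigma a.+1 ^- (2 * q).
Proof.
rewrite mxE [RHS]big_mkcond; apply: eq_bigr => e _; rewrite mxE.
case: eqP => [ie|_]; last by rewrite mul0r.
rewrite mxE mulr_sumr [RHS]big_mkcond; apply: eq_bigr => a _.
rewrite [D a j]mxE; case: eqP => _; last by rewrite !mulr0.
rewrite mulrA ie; congr (_ * _ * _); rewrite mxE.
by apply: eq_bigr => c _; rewrite [H^T c a]mxE.
Qed.

Lemma sigma_pos (j : nat) : (j < k)%N -> sigma k <= sigma j.+1 /\ 0 < sigma j.+1.
Proof.
move=> jk; have sk : 0 < sigma k by exact: sigma_gt0 (ltnW kr).
have le : sigma k <= sigma j.+1 by apply: (svd_decr svd) => //; exact: ltnW kmn.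
by split=> //; exact: lt_le_trans le.
Qed.

Lemma power_ratio_ge0 : 0 <= power_ratio.
Proof.
have sk := sigma_gt0 k0 (ltnW kr).
by rewrite exprn_ge0// divr_ge0 ?(ltW sk)//; exact: (svd_ge0 svd).
Qed.

(** By blocks: [D] vanishes in columns [j >= k], which leaves the trailing block of [Sigma]; for
    [i, j < k] the two terms cancel by [HOm]; for [j < k <= i] the factor
    [(sigma i.+1 / sigma j.+1) ^+ (2 * q)] is at most [power_ratio], since [sigma] decreases. *)
Lemma residual_entry_le (i : 'I_m) (j : 'I_n) :
  E i j ^+ 2 <= (if (k <= i)%N && (k <= j)%N then Sigma i j ^+ 2 else 0) +
    \sum_(e : 'I_n | (k <= e)%N && (i == e :> nat)) \sum_(a : 'I_k | a == j :> nat)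
      power_ratio ^+ 2 * (sigma e.+1 ^+ 2 * W e a ^+ 2).
Proof.
have rhs0 : 0 <= \sum_(e : 'I_n | (k <= e)%N && (i == e :> nat)) \sum_(a : 'I_k | a == j :> nat)
      power_ratio ^+ 2 * (sigma e.+1 ^+ 2 * W e a ^+ 2).
  by do 2![apply: sumr_ge0 => ? _]; apply: mulr_ge0 (sqr_ge0 _) (mulr_ge0 _ _); exact: sqr_ge0.
have EE : E i j = Sigma i j - (rect_diag_mx m n (fun i => sigma i ^+ (2 * q).+1) *m
    (Om *m H^T *m D)) i j by rewrite [E]lock -lock !mxE.
rewrite EE residual_entry.
have SijE : Sigma i j = if i == j :> nat then sigma i.+1 else 0 by rewrite SE mxE.
have [kj|jk] := leqP k j.
  rewrite andbT (eq_bigr (fun=> 0)) => [|e _]; last first.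
    rewrite big1// => a /eqP aj; have := ltn_ord a; rewrite aj ltnNge kj//.
  rewrite big1 // subr0; case: ifP => ki; first by rewrite lerDl.
  rewrite SijE ifN ?expr0n ?add0r//; apply: contraFneq ki => ->; exact: kj.
rewrite andbF add0r.
pose a0 : 'I_k := Ordinal jk.
have suma F : \sum_(a : 'I_k | a == j :> nat) F a = F a0 :> R.
  by rewrite (big_pred1 a0).
have [lin|lni] := ltnP i n; last first.
  rewrite big_pred0 => [|e]; last by apply/negP => /eqP ie; have := ltn_ord e; lia.
  rewrite subr0 SijE ifN ?expr0n//; apply: contraTneq (ltn_ord j) => <-.
  by rewrite -leqNgt.
pose e0 : 'I_n := Ordinal lin.
have -> F : \sum_(e : 'I_n | i == e :> nat) F e = F e0 :> R.
  apply: big_pred1 => e; apply/idP/eqP => [/eqP ie|->]; last exact: eqxx.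
  exact/val_inj.
rewrite suma.
have [ki|ik] := leqP k i.
  have -> F : \sum_(e : 'I_n | (k <= e)%N && (i == e :> nat)) F e = F e0 :> R.
    apply: big_pred1 => e; apply/idP/eqP => [/andP[_ /eqP ie]|->]; first exact/val_inj.
    by rewrite /= ki eqxx.
  rewrite suma SijE ifN; last by rewrite neq_ltn orbC (leq_trans jk ki).
  rewrite sub0r sqrrN.
  have [skj sj0] := sigma_pos jk.
  have sk0 : 0 < sigma k by exact: sigma_gt0 (ltnW kr).
  have si0 : 0 <= sigma i.+1.
    by apply: (svd_ge0 svd); rewrite leq_min ltn_ord lin.
  have sik : sigma i.+1 <= sigma k.+1.
    by apply: (svd_decr svd); rewrite ?leq_min ?ltn_ord ?lin//= ltnS.
  rewrite -[X in _ <= _ * X]exprMn -[leRHS]exprMn -[leLHS]real_normK ?num_real//.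
  rewrite -[leRHS]real_normK ?num_real//; apply: lerXn2r; rewrite ?nnegrE//.
  rewrite /= exprS !normrM mulrA [`|power_ratio| * _]mulrC.
  have -> : `|sigma i.+1| * `|sigma i.+1 ^+ (2 * q)| * `|W e0 a0| * `|sigma j.+1 ^- (2 * q)| =
    `|sigma i.+1| * (`|sigma i.+1 ^+ (2 * q)| * `|sigma j.+1 ^- (2 * q)|) * `|W e0 a0| by ring.
  apply: ler_wpM2r => //; apply: ler_wpM2l => //.
  rewrite -normrM (ger0_norm power_ratio_ge0) ger0_norm; last first.
    by rewrite divr_ge0 ?exprn_ge0// ltW.
  rewrite /power_ratio expr_div_n; apply: ler_pM.
  - exact: exprn_ge0.
  - by rewrite invr_ge0 exprn_ge0// ltW.
  - by apply: lerXn2r; rewrite ?nnegrE// (le_trans si0).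
  - rewrite lef_pV2 ?posrE ?exprn_gt0//; apply: lerXn2r => //; rewrite nnegrE ltW//.
rewrite (_ : _ - _ = 0) ?expr0n//; apply/eqP; rewrite subr_eq0; apply/eqP.
rewrite HOm// SijE /=; case: eqP => [ij|_]; last by rewrite mulr0 mul0r.
rewrite mulr1 ij exprS mulfK// expf_neq0// gt_eqF//.
by have [] := sigma_pos jk.
Qed.

Lemma deterministic_bound :
  frobenius_norm ((1%:M - range_proj Z) *m A) <=
  frobenius_norm (trail_mx k Sigma) + power_ratio * Num.sqrt cross_sum.
Proof.
apply: le_trans (frobenius_residual_le Z A (H^T *m D *m V^T)) _.
rewrite -(frobenius_orth _ oU oV) rotated_residual.
set t := frobenius_norm (trail_mx k Sigma); set r := power_ratio.
have c0 : 0 <= cross_sum.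
  apply: sumr_ge0 => e _; apply: mulr_ge0; first exact: sqr_ge0.
  by apply: sumr_ge0 => a _; exact: sqr_ge0.
have r0 : 0 <= r := power_ratio_ge0.
have t0 : 0 <= t := frobenius_ge0 _.
(* The trailing block and the cross block share no entry, so their squared norms add; passing to a
   sum of norms only drops the mixed term. *)
apply: (@le_trans _ _ (Num.sqrt (t ^+ 2 + r ^+ 2 * cross_sum))); last first.
  rewrite -[leRHS]ger0_norm; last by rewrite addr_ge0 ?mulr_ge0// sqrtr_ge0.
  rewrite -sqrtr_sqr ler_sqrt ?sqr_ge0// sqrrD exprMn (sqr_sqrtr c0).
  have : 0 <= t * (r * Num.sqrt cross_sum) by rewrite !mulr_ge0// sqrtr_ge0.
  by move: (t ^+ 2) (r ^+ 2 * _) (t * _) => a b c; lra.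
rewrite /frobenius_norm ler_sqrt; last by rewrite addr_ge0 ?sqr_ge0// mulr_ge0 ?sqr_ge0.
apply: (@le_trans _ _ (\sum_(i < m) \sum_(j < n) ((if (k <= i)%N && (k <= j)%N then Sigma i j ^+ 2 else 0) +
    \sum_(e : 'I_n | (k <= e)%N && (i == e :> nat)) \sum_(a : 'I_k | a == j :> nat)
      r ^+ 2 * (sigma e.+1 ^+ 2 * W e a ^+ 2)))).
  by apply: ler_sum => i _; apply: ler_sum => j _; exact: residual_entry_le.
under eq_bigr do rewrite big_split /=.
rewrite big_split /=; apply: lerD.
  rewrite /t sqr_frobenius_trail [leRHS]big_mkcond /=; apply: ler_sum => i _.
  case: (leqP k i) => ki /=; last by rewrite big1.
  by rewrite -big_mkcond.
rewrite /cross_sum mulr_sumr.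
under [leRHS]eq_bigr do rewrite mulr_sumr mulr_sumr.
rewrite le_eqVlt; apply/orP; left; apply/eqP.
have sumj i : \sum_(j < n) \sum_(e : 'I_n | (k <= e)%N && (i == e :> nat))
     \sum_(a : 'I_k | a == j :> nat) r ^+ 2 * (sigma e.+1 ^+ 2 * W e a ^+ 2) =
   \sum_(e : 'I_n | (k <= e)%N && (i == e :> nat))
     \sum_(a : 'I_k) r ^+ 2 * (sigma e.+1 ^+ 2 * W e a ^+ 2).
  rewrite exchange_big /=; apply: eq_bigr => e _.
  under eq_bigr do rewrite big_mkcond /=.
  rewrite exchange_big /=; apply: eq_bigr => a _.
  have an : (a < n)%N by have := ltn_ord a; have := kmn; lia.
  rewrite -big_mkcond /=; apply: (@big_pred1 _ _ _ _ (Ordinal an)) => j.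
  by apply/idP/eqP => [/eqP aj|->]; [exact/val_inj|exact: eqxx].
under eq_bigr do rewrite sumj.
under eq_bigr do rewrite big_mkcondr /=.
rewrite exchange_big /= [RHS]big_mkcondr /=; apply: eq_bigr => e ke.
case: ltnP => [em|me].
  by rewrite -big_mkcond /= (big_pred1 (Ordinal em)).
rewrite big1// => i _; rewrite ifN// neq_ltn.
by rewrite (leq_trans (ltn_ord i) me).
Qed.

End Deterministic.
End SingularValues.

(** * Optimization of the tail exponent *)

Section Numerics.
Context {R : realType}.
Local Notation gmom := (@gmom R).
Local Notation cmom := (@cmom R).
Implicit Types (x y u t v : R) (r s N p : nat).

Lemma expR1_le3 : expR 1 <= 3 :> R.
Proof.
(* Numerically, [(7/8)^8 > 1/3]. *)
have h : (1 - 8^-1) ^+ 8 <= expR (- 1) :> R.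
  have -> : - 1 = 8%:R * (- 8^-1) :> R by lra.
  by rewrite expRM_natl; apply: lerXn2r; rewrite ?nnegrE ?expR_ge0 ?expR_ge1Dx//; lra.
rewrite expRN in h; rewrite -[leLHS]invrK -[leRHS]invrK lef_pV2 ?posrE ?invr_gt0 ?expR_gt0//.
by apply: le_trans h; lra.
Qed.

Lemma expR_chord v : 0 <= v <= 1 -> expR v <= 1 + 2 * v.
Proof.
move=> /andP[v0 v1]; pose w : {i01 R} := Itv01 v0 v1.
have := convex_expR w 1 0; rewrite !convRE /= expR0.
rewrite !mulr0 !mulr1 !addr0 => /le_trans; apply; rewrite /unstable.onem.
by have := ler_wpM2l v0 expR1_le3; lra.
Qed.

Lemma bernoulli_ineq x n : 0 <= x -> 1 + n%:R * x <= (1 + x) ^+ n.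
Proof.
move=> x0; elim: n => [|n IHn]; first by rewrite mul0r addr0 expr0.
rewrite exprSr -natr1; apply: (@le_trans _ _ ((1 + n%:R * x) * (1 + x))); last first.
  by apply: ler_wpM2r IHn; lra.
have : 0 <= n%:R * (x * x) by rewrite mulr_ge0// mulr_ge0.
nra.
Qed.

(** The left side is the double factorial of [2r - 1]. The induction uses [2 r^r <= (r + 1)^r],
    which is Bernoulli's inequality at [1 / r]. *)
Lemma gmom_even r : gmom r.*2 <= r%:R ^+ r.
Proof.
elim: r => [|r IHr]; first by rewrite expr0.
rewrite doubleS /=; apply: (@le_trans _ _ (r.*2.+1%:R * r%:R ^+ r)).
  by apply: ler_wpM2l.
rewrite exprS; have [->|r0] := posnP r; first by rewrite expr0.
apply: (@le_trans _ _ (r.+1%:R * (2 * r%:R ^+ r))).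
  rewrite mulrA; apply: ler_wpM2r; first exact: exprn_ge0.
  by rewrite -natrM ler_nat; lia.
apply: ler_wpM2l => //.
have rr : 0 < r%:R :> R by rewrite ltr0n.
have := @bernoulli_ineq r%:R^-1 r; rewrite invr_ge0 ler0n => /(_ isT).
rewrite divff ?gt_eqF// => h.
have -> : r.+1%:R = (1 + r%:R^-1) * r%:R :> R.
  by rewrite mulrDl mulVf ?gt_eqF// mul1r -natr1.
by rewrite exprMn; apply: ler_wpM2r h; exact: exprn_ge0.
Qed.

Lemma cmom_even N r : (r.*2 < N)%N -> cmom N r.*2 <= (N - r.*2)%:R ^- r.
Proof.
elim: r N => [|r IHr] N rN; first by rewrite expr0 invr1.
rewrite doubleS /= exprSr invfM -doubleS; apply: ler_wpM2r; first by rewrite invr_ge0.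
have h : (r.*2 < N)%N by rewrite doubleS in rN; lia.
apply: le_trans (IHr N h) _; rewrite lef_pV2 ?posrE ?exprn_gt0 ?ltr0n ?subn_gt0//.
by apply: lerXn2r; rewrite ?nnegrE// ler_nat; lia.
Qed.

(** Raising both indices by 2 keeps their difference, so for even [s] the product just gains the
    factor [1 / N]. For odd [s] the base value changes as well, and the comparison is
    [N (N - 2) <= (N - 1)^2]. *)
Lemma cmom_shift N s : (3 <= N)%N -> cmom N.+2 s.+2 <= cmom N s / N%:R.
Proof.
move=> N3; elim/nat_ind2: s => [||s IHs]; rewrite /cmom -/cmom.
- by rewrite subSS subSS subn0.
- rewrite -!invfM lef_pV2 ?posrE ?mulr_gt0 ?sqrtr_gt0 ?ltr0n; try lia.
  have -> : (N.+2 - 3 = N.-1)%N by lia.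
  have -> : (N.+2 - 2 = N)%N by lia.
  rewrite -ler_sqr ?nnegrE ?mulr_ge0 ?sqrtr_ge0// !exprMn !sqr_sqrtr//.
  rewrite -!natrX -!natrM ler_nat; nia.
have -> : (N.+2 - s.+4 = N - s.+2)%N by lia.
rewrite [leRHS]mulrAC; apply: ler_wpM2r IHs; by rewrite invr_ge0.
Qed.

(** Raising [p] by 2 multiplies [gmom] by [p + 1] and, by [cmom_shift], divides [cmom] by at least
    as much, so [p = 2] and [p = 3] decide. The factor [2 / 3] is what [N / (3 u^2)] is bounded by
    when [u^2 >= N / 2]. *)
Lemma top_moment p : (2 <= p)%N ->
  gmom p * cmom p.+1 p * Num.sqrt (2 / 3) ^+ p <= 1.
Proof.
have s23 : Num.sqrt (2 / 3) ^+ 2 = 2 / 3 :> R by rewrite sqr_sqrtr; lra.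
elim/nat_ind2: p => [//|//|p IHp] _.
have [->|p0] := eqVneq p 0; first by rewrite /= s23 (_ : 3 - 2 = 1)%N//; lra.
have [->|p1] := eqVneq p 1.
  rewrite /= (_ : 4 - 3 = 1)%N// (_ : 4 - 2 = 2)%N// exprSr s23.
  set X := (leLHS); have X0 : 0 <= X.
    by rewrite /X !mulr_ge0 ?invr_ge0 ?sqrtr_ge0//; lra.
  suff : X ^+ 2 <= 1 by move=> h; nra.
  by rewrite /X !exprMn !exprVn s23 sqr_sqrtr//; lra.
have := IHp ltac:(lia); apply: le_trans.
have -> : Num.sqrt (2 / 3) ^+ p.+2 = Num.sqrt (2 / 3) ^+ p * (2 / 3) :> R.
  by rewrite -[X in _ = _ * X]s23 -exprD addn2.
rewrite mulrA; apply: (@le_trans _ _ (gmom p.+2 * cmom p.+3 p.+2 * Num.sqrt (2 / 3) ^+ p)).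
  rewrite -[leRHS]mulr1; apply: ler_wpM2l; last lra.
  by rewrite !mulr_ge0 ?gmom_ge0 ?cmom_ge0// exprn_ge0 ?sqrtr_ge0.
apply: ler_wpM2r; first by rewrite exprn_ge0 ?sqrtr_ge0.
have h : (3 <= p.+1)%N by lia.
apply: (@le_trans _ _ (gmom p.+2 * (cmom p.+1 p / p.+1%:R))).
  by apply: ler_wpM2l (cmom_shift _ h); exact: gmom_ge0.
have cancel (a g c : R) : a != 0 -> a * g * (c / a) = g * c by move=> a0; field.
by rewrite [gmom p.+2]/= cancel// pnatr_eq0.
Qed.

(* With x = u^2: s = N-1 if N/2 <= x, s = 2 if x < 2, and otherwise s = 2r with
   r = floor(x/2), where the claim reduces to e^v <= 6v - 3 for v = x/(2r) in
   [1, 2]. *)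
Lemma gauss_tail_numerics N u t : (5 <= N)%N -> 1 <= u -> 1 <= t ->
  exists s, (2 <= s < N)%N /\
    gmom s * cmom N s * (Num.sqrt N%:R / (Num.sqrt 3 * u * t)) ^+ s <=
    expR (- (u ^+ 2 / 2)) + t ^- N.-1.
Proof.
move=> N5; have p2 : (2 <= N.-1 < N)%N by lia.
have N2 : (2 < N)%N by lia.
move=> u1 t1; set x := u ^+ 2; set b := _ / _.
have x1 : 1 <= x by rewrite /x expr2; nra.
have t2 : 1 <= t ^+ 2 by rewrite expr2; nra.
have NR : 5 <= N%:R :> R by rewrite ler_nat.
have b0 : 0 <= b by rewrite divr_ge0 ?sqrtr_ge0// !mulr_ge0 ?sqrtr_ge0//; lra.
have bE : b ^+ 2 = N%:R / (3 * x * t ^+ 2).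
  by rewrite expr_div_n !exprMn !sqr_sqrtr.
clearbody b.
have ble : b ^+ 2 <= N%:R / (3 * x).
  rewrite bE ler_pM2l ?lef_pV2 ?posrE; [|nra|nra|lra].
  by rewrite -[leLHS]mulr1; apply: ler_wpM2l t2; lra.
have e0 : 0 <= expR (- (x / 2)) by exact: expR_ge0.
have tp0 : 0 <= t ^- N.-1 by rewrite invr_ge0 exprn_ge0//; lra.
have [xN|Nx] := leP (N%:R / 2) x.
  exists N.-1; split=> //.
  apply: (@le_trans _ _ (t ^- N.-1)); last lra.
  have bt : b <= Num.sqrt (2 / 3) * t^-1.
    rewrite -ler_sqr ?nnegrE//; last by rewrite mulr_ge0 ?sqrtr_ge0// invr_ge0; lra.
    rewrite [leRHS]exprMn sqr_sqrtr; last lra.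
    rewrite bE invfM mulrA -exprVn; apply: ler_wpM2r; first exact: sqr_ge0.
    by rewrite ler_pdivrMr; lra.
  have := top_moment (andP p2).1; rewrite prednK ?(ltn_trans _ N2)//.
  move=> h; apply: (@le_trans _ _ (gmom N.-1 * cmom N N.-1 * (Num.sqrt (2 / 3) * t^-1) ^+ N.-1)).
    apply: ler_wpM2l; first by rewrite mulr_ge0 ?gmom_ge0 ?cmom_ge0.
    apply: lerXn2r => //; rewrite nnegrE// mulr_ge0 ?sqrtr_ge0// invr_ge0; lra.
  rewrite exprMn mulrA exprVn -[leRHS]mul1r; apply: ler_wpM2r => //.
(* After [gmom_even] and [cmom_even] everything is an [r]-th power, so it is enough to compare the
   bases; [v] is [x / (2 r)]. *)
have key r v : (0 < r)%N -> (r.*2 < N)%N ->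
    r%:R / (N - r.*2)%:R * (N%:R / (3 * x)) <= expR (- v) -> v * r%:R = x / 2 ->
    gmom r.*2 * cmom N r.*2 * b ^+ r.*2 <= expR (- (x / 2)).
  move=> r0 rN h vE; rewrite -vE -mulNr (mulrC (- v)) expRM_natl.
  apply: (@le_trans _ _ ((r%:R / (N - r.*2)%:R * (N%:R / (3 * x))) ^+ r)); last first.
    by apply: lerXn2r h; rewrite nnegrE ?expR_ge0// !mulr_ge0// invr_ge0; lra.
  rewrite [leRHS]exprMn [X in _ <= X * _]exprMn exprVn -[X in b ^+ X]mul2n exprM; apply: ler_pM.
  - by rewrite mulr_ge0 ?gmom_ge0 ?cmom_ge0.
  - by rewrite exprn_ge0 ?sqr_ge0.
  - by apply: ler_pM; rewrite ?gmom_ge0 ?cmom_ge0 ?gmom_even ?cmom_even.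
  - by apply: lerXn2r ble; rewrite nnegrE ?sqr_ge0// divr_ge0//; lra.
have [x2|x2] := ltP x 2.
  exists 2; split=> //.
  apply: (@le_trans _ _ (expR (- (x / 2)))); last lra.
  apply: (key 1%N (x / 2)) => //; last lra.
  rewrite expRN natrB ?ler_nat ?(ltnW N2)//.
  have y1 : 0 <= x / 2 - 1 / 2 <= 1 by lra.
  have half : expR (1 / 2) <= 7 / 4 :> R.
    have : expR (1 / 2) ^+ 2 <= 3 :> R by rewrite -expRM_natl; have := expR1_le3; rewrite (_ : 2%:R * (1 / 2) = 1 :> R)//; lra.
    by have := @expR_ge0 R (1 / 2); nra.
  (* The constant [9 / 5] is [3 (N - 2) / N] at [N = 5], the smallest value allowed. *)
  have ex : expR (x / 2) <= 9 / 5 * x.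
    have -> : x / 2 = 1 / 2 + (x / 2 - 1 / 2) by lra.
    rewrite expRD; have := expR_chord y1 => h.
    apply: (@le_trans _ _ (7 / 4 * (1 + 2 * (x / 2 - 1 / 2)))); last lra.
    by apply: ler_pM; rewrite ?expR_ge0.
  apply: (@le_trans _ _ (9 / 5 * x)^-1).
    rewrite (_ : 1.*2 = 2)%N//.
    have -> : 1%:R / (N%:R - 2%:R) * (N%:R / (3 * x)) = (3 * x * (N%:R - 2) / N%:R)^-1.
      by field; do ?[apply/andP; split]; lra.
    rewrite lef_pV2 ?posrE; [|rewrite divr_gt0//; nra|lra].
    by rewrite ler_pdivlMr; nra.
  by rewrite lef_pV2 ?posrE ?expR_gt0//; lra.
pose r := Num.truncn (x / 2); have x20 : 0 <= x / 2 by lra.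
have /andP[rx xr] := truncn_itv x20; rewrite -/r -[r.+1%:R]natr1 in rx xr.
have r0 : (0 < r)%N by rewrite truncn_gt0; lra.
have rR : 1 <= r%:R :> R by rewrite ler1n.
have r2N : r%:R * 2 < N%:R :> R by lra.
have rN : (r.*2 < N)%N by rewrite -(ltr_nat R) -muln2 natrM.
exists r.*2; split; first by rewrite rN andbT; move: r0; rewrite -(leq_double 1).
apply: (@le_trans _ _ (expR (- (x / 2)))); last lra.
apply: (key r (x / 2 / r%:R)) => //; last by rewrite mulfVK// gt_eqF//; lra.
set v := x / 2 / r%:R.
have v01 : 0 <= v - 1 <= 1.
  have -> : v - 1 = (x / 2 - r%:R) / r%:R by rewrite /v; field; lra.
  by rewrite divr_ge0 ?ler_pdivrMr; lra.
(* Split off [expR 1 <= 3] and use the chord bound for [v - 1]: the product is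
   [3 (1 + 2 (v - 1))]. *)
have ev : expR v <= 6 * v - 3.
  have -> : v = 1 + (v - 1) by lra.
  rewrite expRD; have h := expR_chord v01.
  apply: (@le_trans _ _ (3 * (1 + 2 * (v - 1)))); last lra.
  by apply: ler_pM; rewrite ?expR_ge0 ?expR1_le3.
rewrite expRN; apply: (@le_trans _ _ (6 * v - 3)^-1); last first.
  by rewrite lef_pV2 ?posrE ?expR_gt0//; lra.
rewrite natrB ?(ltnW rN)// -muln2 natrM.
have -> : 6 * v - 3 = 3 * (x - r%:R) / r%:R by rewrite /v; field; lra.
have -> : r%:R / (N%:R - r%:R * 2%:R) * (N%:R / (3 * x)) =
   (3 * x * (N%:R - r%:R * 2) / (r%:R * N%:R))^-1.
  by field; do ?[apply/andP; split]; lra.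
rewrite lef_pV2 ?posrE; [|rewrite divr_gt0// ?mulr_gt0//; lra|rewrite divr_gt0//; lra].
rewrite ler_pdivrMr; last lra.
have -> : 3 * x * (N%:R - r%:R * 2) / (r%:R * N%:R) * r%:R = 3 * x * (N%:R - r%:R * 2) / N%:R.
  by field; do ?[apply/andP; split]; lra.
(* Cleared of denominators, this is [2 x <= N]. *)
by rewrite ler_pdivlMr; nra.
Qed.
End Numerics.

(** * Power mean inequality *)

Section PowerMean.
Context {R : realType}.

(* The tangent of y |-> y^((s+2)/2) at a^2, evaluated at x^2. *)
Lemma power_tangent (a x : R) s : 0 <= a -> 0 <= x ->
  s.+2%:R * a ^+ s * x ^+ 2 <= 2 * x ^+ s.+2 + s%:R * a ^+ s.+2.
Proof.
move=> a0 x0; elim: s => [|s IHs]; first by rewrite expr0 mulr1 mul0r addr0.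
have h1 : 0 <= (x - a) * (x ^+ s.+1 - a ^+ s.+1).
  have [xa|ax] := leP x a.
    by rewrite mulr_le0// subr_le0// lerXn2r.
  by rewrite mulr_ge0// subr_ge0 ?lerXn2r ?(ltW ax).
have h2 : 0 <= x * ((x - a) * (x ^+ s.+1 - a ^+ s.+1)) by rewrite mulr_ge0.
have := ler_wpM2l a0 IHs.
have h3 : 0 <= (x - a) * (x ^+ s.+2 - a ^+ s.+2).
  have [xa|ax] := leP x a.
    by rewrite mulr_le0// subr_le0// lerXn2r.
  by rewrite mulr_ge0// subr_ge0 ?lerXn2r ?(ltW ax).
have -> : s.+1%:R = 1 + s%:R :> R by rewrite nat1r.
have -> : s.+3%:R = 3 + s%:R :> R by rewrite -natrD.
have -> : s.+2%:R = 2 + s%:R :> R by rewrite -natrD.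
move: h1 h2 h3; rewrite !exprS.
move: (x ^+ s) (a ^+ s) => X Y; move: (s%:R) => z h1 h2 h3.
lra.
Qed.

(** Jensen's inequality with unnormalized weights. It places the event that the weighted sum of
    squares is large inside the event that the weighted sum of [s]-th powers is large, to which
    Markov's inequality is applied. *)
Lemma power_mean (I : Type) (r : seq I) (Q : pred I) (w x : I -> R) (a : R) s :
  (forall i, 0 <= w i) -> (forall i, 0 <= x i) -> 0 <= a -> (2 <= s)%N ->
  (\sum_(i <- r | Q i) w i) * a ^+ 2 <= \sum_(i <- r | Q i) w i * x i ^+ 2 ->
  (\sum_(i <- r | Q i) w i) * a ^+ s <= \sum_(i <- r | Q i) w i * x i ^+ s.
Proof.
move=> w0 x0 a0; case: s => [//|[//|s]] _; set W := \sum_(i <- r | Q i) w i => h.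
have : \sum_(i <- r | Q i) w i * (s.+2%:R * a ^+ s * x i ^+ 2) <=
       \sum_(i <- r | Q i) w i * (2 * x i ^+ s.+2 + s%:R * a ^+ s.+2).
  by apply: ler_sum => i _; apply: ler_wpM2l => //; exact: power_tangent.
under [X in _ <= X -> _]eq_bigr do rewrite mulrDr.
rewrite big_split/= -mulr_suml -/W.
under [X in X <= _]eq_bigr do rewrite mulrCA.
under [X in _ <= X + _]eq_bigr do rewrite mulrCA.
rewrite -!mulr_sumr => h'.
have h2 := ler_wpM2l (mulr_ge0 (ler0n _ s.+2) (exprn_ge0 s a0)) h.
have e : s.+2%:R = 2 + s%:R :> R by rewrite -natrD.
have e2 : a ^+ s.+2 = a ^+ s * a ^+ 2 by rewrite -exprD addn2.
rewrite e2 e in h' h2 *; lra.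
Qed.

End PowerMean.

(** * Measurability of the residual norm *)

Section ResidualMeasurability.
Context {R : realType}.

Lemma frobenius_rat_approx m l n (A : 'M[R]_(m, n)) (Z : 'M[R]_(m, l)) X c :
  frobenius_norm (A - Z *m X) < c ->
  exists Y : 'M[rat]_(l, n), frobenius_norm (A - Z *m map_mx ratr Y) < c.
Proof.
move=> hc.
have c0 : 0 < c := le_lt_trans (frobenius_ge0 _) hc.
pose C := \sum_i \sum_j `|Z i j|.
have C0 : 0 <= C by do 2![apply: sumr_ge0 => ? _].
pose B := A - Z *m X.
(* For [e <= 1], moving an entry [b] by at most [e C] raises its square by at most
   [e (2 |b| C + C^2)]; [K] collects these increments. *)
pose K := \sum_(i < m) \sum_(j < n) (2 * `|B i j| * C + C ^+ 2).
have K0 : 0 <= K.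
  by do 2![apply: sumr_ge0 => ? _]; rewrite addr_ge0 ?sqr_ge0// !mulr_ge0.
pose g := c ^+ 2 - frobenius_norm B ^+ 2.
have g0 : 0 < g by rewrite subr_gt0 ltr_pXn2r ?nnegrE ?frobenius_ge0// ltW.
pose e := Num.min 1 (g / (K + 1)).
have e0 : 0 < e by rewrite lt_min ltr01 divr_gt0//; lra.
have e1 : e <= 1 by rewrite ge_min lexx.
have eK : e * K < g.
  apply: (@le_lt_trans _ _ (g / (K + 1) * K)).
    by apply: ler_wpM2r => //; rewrite ge_min lexx orbT.
  by rewrite mulrAC ltr_pdivrMr; nra.
have rat_near x : {y : rat | `|x - ratr y| < e}.
  apply: cid; have [y] := @rat_in_itvoo R (x - e) (x + e) ltac:(lra).
  by rewrite in_itv/= => yx; exists y; rewrite ltr_norml; lra.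
pose Y : 'M[rat]_(l, n) := \matrix_(i, j) sval (rat_near (X i j)).
exists Y; set B' := A - _.
have BB i j : `|B' i j - B i j| <= e * C.
  have -> : B' i j - B i j = (Z *m (X - map_mx ratr Y)) i j.
    by rewrite mulmxBr /B' /B !mxE opprB addrCA addrAC subrr add0r addrC.
  rewrite mxE; apply: le_trans (ler_norm_sum _ _ _) _.
  apply: (@le_trans _ _ (\sum_b `|Z i b| * e)).
    apply: ler_sum => b _; rewrite normrM; apply: ler_wpM2l => //.
    by rewrite !mxE ltW//; exact: (svalP (rat_near (X b j))).
  rewrite -mulr_suml mulrC; apply: ler_wpM2l; first exact: ltW.
  rewrite /C [leRHS](bigD1 i)//= lerDl.
  by do 2![apply: sumr_ge0 => ? _].
rewrite -(@ltr_pXn2r _ 2) ?nnegrE ?frobenius_ge0 ?(ltW c0)//.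
apply: (@le_lt_trans _ _ (frobenius_norm B ^+ 2 + e * K)); last by rewrite /g in eK; lra.
rewrite !sqr_frobenius /K mulr_sumr -big_split; apply: ler_sum => i _.
rewrite mulr_sumr -big_split; apply: ler_sum => j _ /=.
have := BB i j; move: (B' i j) (B i j) => b' b.
move=> bb.
have b'le : `|b'| <= `|b| + e * C.
  by rewrite -[b'](subrK b) (le_trans (ler_normD _ _))// addrC lerD2l.
rewrite -real_normK ?num_real// -[b ^+ 2]real_normK ?num_real//.
apply: (@le_trans _ _ ((`|b| + e * C) ^+ 2)).
  by apply: lerXn2r => //; rewrite nnegrE addr_ge0// mulr_ge0// ltW.
have h : e * (e * C ^+ 2) <= e * C ^+ 2.
  rewrite -[leRHS]mul1r; apply: ler_wpM2r => //.
  by rewrite mulr_ge0 ?sqr_ge0// ltW.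
rewrite sqrrD exprMn; move: h; rewrite [e ^+ 2]expr2.
move: (`|b|) => z h; lra.
Qed.

Context {d : measure_display} {T : measurableType d}.

(* The residual is below c iff |A - Z X|_F < c for some rational X. *)
Lemma measurable_residual m l n (A : 'M[R]_(m, n)) (Z : T -> 'M[R]_(m, l)) :
  (forall i j, measurable_fun setT (fun w => Z w i j)) ->
  measurable_fun setT (fun w => frobenius_norm ((1%:M - range_proj (Z w)) *m A)).
Proof.
move=> mZ.
have mf (Y : 'M[R]_(l, n)) : measurable_fun setT (fun w => frobenius_norm (A - Z w *m Y)).
  apply: measurable_sqrtr.
  apply: measurable_sum => i; apply: measurable_sum => j.
  apply: measurable_funX.
  apply: (eq_measurable_fun (fun w => A i j - \sum_b Z w i b * Y b j)).
    by move=> w _; rewrite !mxE.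
  apply: measurable_funB => //; apply: measurable_sum => b.
  by apply: measurable_funM.
apply: (measurability _ (RGenInftyO.measurableE R)) => // _ [_ [c ->] <-].
rewrite setTI.
have -> : (fun w => frobenius_norm ((1%:M - range_proj (Z w)) *m A)) @^-1` `]-oo, c[ =
   \bigcup_(Y : 'M[rat]_(l, n)) [set w | frobenius_norm (A - Z w *m map_mx ratr Y) < c].
  apply/seteqP; split=> w /=.
    rewrite in_itv/= frobenius_residual => /frobenius_rat_approx[Y hY].
    by exists Y.
  by move=> [Y _ /= hY]; rewrite in_itv/= (le_lt_trans _ hY)// frobenius_residual_le.
apply: countable_bigcupT_measurable => [|Y]; first exact: countableP.
rewrite -[X in measurable X]setTI.
have := mf (map_mx ratr Y) measurableT `]-oo, c[%classic (measurable_itv _).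
by congr measurable; apply/seteqP; split=> w [_]; rewrite /= in_itv/=; split.
Qed.

End ResidualMeasurability.

(** * Law of the rotated Gaussian matrix *)

Section GaussianRows.
Context {R : realType} {d : measure_display} {T : measurableType d}.
Variable P : probability T R.

Lemma std_gaussian_vector_iid n (X : T -> n.-tuple R) :
  std_gaussian_vector P X -> iid_normal P (fun (i : 'I_n) w => tnth (X w) i).
Proof.
move=> [mX lX iX]; split=> [i|B mB].
  exact: (measurableT_comp (measurable_tnth i) mX).
have := iX [set: 'I_n]%SET B mB.
rewrite (_ : [set` _] = [set: 'I_n]); last by apply/seteqP; split=> // i _ /=; rewrite inE.
rewrite -box_bigcap => h; apply: (etrans h).
by apply: eq_big => [i|i _]; [rewrite inE|exact: lX].
Qed.

Variables (n l : nat) (G : T -> 'M[R]_(n, l)).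
Hypothesis hG : std_gaussian_mx P G.

Let colE i j w : tnth (col_tuple (G w) j) i = G w i j.
Proof. by rewrite tnth_mktuple. Qed.

Lemma std_gaussian_mx_col j : iid_normal P (fun (i : 'I_n) w => G w i j).
Proof.
have := std_gaussian_vector_iid (gaussm_cols hG j).
by congr iid_normal; apply/funext => i; apply/funext => w; rewrite colE.
Qed.

Lemma measurable_std_gaussian_mx i j : measurable_fun setT (fun w => G w i j).
Proof. exact: (std_gaussian_mx_col j).1 i. Qed.

(** [V^T] acts on each column separately, so a box condition on the rotated matrix is a condition
    [C j] on each original column. Independence of the columns splits the probability, and rotation
    invariance evaluates each factor. *)
Lemma std_gaussian_mx_rotate (V : 'M[R]_n) : V^T *m V = 1%:M ->
  iid_normal P (fun (c : 'I_n * 'I_l) w => (V^T *m G w) c.1 c.2).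
Proof.
move=> oV.
have VE i j w : (V^T *m G w) i j = \sum_e tnth (col_tuple (G w) j) e * V e i.
  by rewrite mxE; apply: eq_bigr => e _; rewrite mxE colE mulrC.
split=> [[i j] /=|B mB].
  under eq_fun do rewrite VE; apply: measurable_sum => e; apply: measurable_funM => //.
  by under eq_fun do rewrite colE; exact: measurable_std_gaussian_mx.
pose C j : set (n.-tuple R) := [set y | forall i, B (i, j) (\sum_e tnth y e * V e i)].
have mC j : measurable (C j).
  pose f i (y : n.-tuple R) : R := \sum_e tnth y e * V e i.
  have -> : C j = \bigcap_(i in [set: 'I_n]) f i @^-1` B (i, j).
    exact: (box_bigcap f (fun i => B (i, j))).
  apply: fin_bigcap_measurable => // i _; rewrite -[_ @^-1` _]setTI.
  apply: measurable_sum => // e; apply: measurable_funM => //.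
  exact: measurable_tnth.
have := gaussm_indep hG [set: 'I_l]%SET mC.
rewrite (_ : [set` _] = [set: 'I_l]); last by apply/seteqP; split=> // i _ /=; rewrite inE.
rewrite (_ : \bigcap_(j in _) _ = [set w | forall c, B c ((V^T *m G w) c.1 c.2)]); last first.
  apply/seteqP; split=> [w Cw [i j]|w Bw j _ i] /=.
    by have := Cw j I i; rewrite VE.
  by have := Bw (i, j); rewrite VE.
move=> h; apply: (etrans h); rewrite [RHS](eq_bigr (fun c => normal_prob 0 1 (B (c.1, c.2)))) => [|[]//].
rewrite -(pair_bigA _ (fun i j => normal_prob 0 1 (B (i, j)))) [RHS]exchange_big /=.
apply: eq_big => [j|j _]; first by rewrite inE.
have [_ <-//] := orth_preserving oV (std_gaussian_mx_col j).
have rE i w : rot_apply V (fun (i : 'I_n) w => G w i j) i w =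
    \sum_e tnth (col_tuple (G w) j) e * V e i.
  by apply: eq_bigr => e _; rewrite colE.
by congr (P _); apply/seteqP; split=> w Cw i; have := Cw i; rewrite rE.
Qed.

End GaussianRows.

(** * The leading rows and their pseudo-inverse *)

Section LeadingRows.
Context {R : realType} {d : measure_display} {T : measurableType d}.
Variable P : probability T R.
Variables (n l k : nat) (Y : T -> 'M[R]_(n, l)).
Hypothesis iY : iid_normal P (fun (c : 'I_n * 'I_l) w => Y w c.1 c.2).
Hypothesis kn : (k <= n)%N.

Definition lead_rows (M : 'M[R]_(n, l)) : 'M[R]_(k, l) :=
  \matrix_(a, c) M (widen_ord kn a) c.

Definition cross_coef (e : 'I_n) (a : 'I_k) (M : 'M[R]_(n, l)) : R :=
  \sum_c M e c * gram_inv (lead_rows M) a c.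

Lemma measurable_cross_coef e a : measurable_fun setT (fun w => cross_coef e a (Y w)).
Proof.
have [mY _] := iY.
apply: measurable_sum => c; apply: measurable_funM; first exact: (mY (e, c)).
apply: measurable_gram_inv => i j.
by under eq_fun do rewrite mxE; exact: (mY (widen_ord kn i, j)).
Qed.

Lemma cross_coef_moment (e : 'I_n) a s : (k <= e)%N ->
  (k.-1 + 2 < l)%N -> (s < l - k.-1)%N ->
  (\int[P]_w (`|cross_coef e a (Y w)| ^+ s)%:E <=
   (gmom s * cmom (l - k.-1) s : R)%:E)%E.
Proof.
move=> ke kl sl.
pose f (c : option 'I_k * 'I_l) : 'I_n * 'I_l :=
  (if c.1 is Some b then widen_ord kn b else e, c.2).
have f_inj : injective f.
  move=> [[b|] c] [[b'|] c'] //=; rewrite /f /= => -[].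
  - by move=> bb ->; congr (Some _, _); exact: val_inj.
  - by move=> /(congr1 val)/= be _; have := ltn_ord b; rewrite be ltnNge ke.
  - by move=> /(congr1 val)/= eb _; have := ltn_ord b'; rewrite -eb ltnNge ke.
  - by move=> ->.
have iX := iid_normal_sub f_inj iY.
by have := last_row_moment iX a kl sl.
Qed.

Lemma cross_coef_lead (e : 'I_n) a (M : 'M[R]_(n, l)) : (e < k)%N ->
  lead_rows M *m (lead_rows M)^T \in unitmx ->
  cross_coef e a M = (e == a :> nat)%:R.
Proof.
move=> ek /gram_invK /matrixP/(_ (Ordinal ek) a); rewrite !mxE.
rewrite -val_eqE /= => <-; apply: eq_bigr => c _.
by rewrite !mxE; congr (M _ _ * _); exact: val_inj.
Qed.

(** The first [k] columns of the leading rows form a square Gaussian matrix, almost surely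
    invertible, so these rows are independent and their Gram matrix is invertible. *)
Lemma lead_rows_unit : (k <= l)%N ->
  \forall w \ae P, lead_rows (Y w) *m (lead_rows (Y w))^T \in unitmx.
Proof.
move=> kl.
pose f (c : 'I_k * 'I_k) : 'I_n * 'I_l := (widen_ord kn c.1, widen_ord kl c.2).
have f_inj : injective f.
  by move=> [a b] [a' b'] [aa bb]; congr (_, _); exact: val_inj.
have iX := iid_normal_sub f_inj iY; have [mX _] := iX.
exists [set w | \det (fam_mx (fun c => Y w (f c).1 (f c).2)) = 0]; split.
- apply: measurable_eq0; apply: measurable_det => i j.
  by under eq_fun do rewrite mxE; exact: (mX (i, j)).
- exact: det_normal_neq0 iX.
move=> w /=; apply: contra_notP => /eqP det0.
apply: row_free_gram_unit.
set L := fam_mx _ in det0.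
have uL : L \in unitmx by rewrite unitmxE unitfE.
pose S : 'M[R]_(l, k) := \matrix_(c, b) (c == b :> nat)%:R.
apply/row_freeP; exists (S *m invmx L); rewrite mulmxA.
have -> : lead_rows (Y w) *m S = L; last exact: mulmxV.
apply/matrixP => i j; rewrite !mxE (bigD1 (widen_ord kl j))//= big1 => [|c cj].
  by rewrite !mxE eqxx mulr1 addr0.
rewrite !mxE; case: eqP => [cj'|]; last by rewrite mulr0.
by case/eqP: cj; exact: val_inj.
Qed.

End LeadingRows.

(** * Expectation and tail inequalities *)

Section Probability.
Context {R : realType} {d : measure_display} {T : measurableType d}.
Variable P : probability T R.

Lemma measurable_preimage_itv (f : T -> R) (i : interval R) :
  measurable_fun setT f -> measurable [set w | f w \in i].
Proof.
move=> mf; rewrite -[X in measurable X]setTI.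
exact: (mf measurableT [set` i] (measurable_itv _)).
Qed.

(** The bound is asked only where the weight is nonzero: the indices of leading rows get weight 0,
    and [cross_coef_moment] says nothing about them. *)
Lemma integral_weighted_sum_le (I : finType) (wt : I -> R) (f : I -> T -> R) b :
  (forall i, 0 <= wt i) -> (forall i, measurable_fun setT (f i)) ->
  (forall i w, 0 <= f i w) ->
  (forall i, wt i != 0 -> (\int[P]_w (f i w)%:E <= b%:E)%E) ->
  (\int[P]_w (\sum_i wt i * f i w)%:E <= ((\sum_i wt i) * b)%:E)%E.
Proof.
move=> wt0 mf f0 fb.
have mwf i : measurable_fun setT (fun w => (wt i * f i w)%:E).
  by apply/measurable_EFinP; apply: measurable_funM.
have -> : (\int[P]_w (\sum_i wt i * f i w)%:E = \int[P]_w \sum_i (wt i * f i w)%:E)%E.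
  by apply: eq_integral => w _; rewrite sumEFin.
have wf0 i w : [set: T] w -> (0 <= (wt i * f i w)%:E)%E.
  by move=> _; rewrite lee_fin mulr_ge0.
have e := ge0_integral_sum P measurableT mwf wf0 (index_enum I).
apply: (@le_trans _ _ (\sum_i \int[P]_w (wt i * f i w)%:E)%E).
  by rewrite le_eqVlt; apply/orP; left; apply/eqP; exact: e.
rewrite mulr_suml -sumEFin; apply: lee_sum => i _.
have [w0|wi] := eqVneq (wt i) 0.
  rewrite w0 mul0r; under eq_integral do rewrite mul0r.
  by rewrite integral0.
have -> : (\int[P]_w (wt i * f i w)%:E = (wt i)%:E * \int[P]_w (f i w)%:E)%E.
  rewrite -ge0_integralZl//; first by apply/measurable_EFinP.
  - by move=> w _; rewrite lee_fin.
  - by rewrite lee_fin.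
by rewrite EFinM; apply: lee_wpmul2l; rewrite ?lee_fin ?fb.
Qed.

Lemma integral_affine (f : T -> R) (a b : R) : measurable_fun setT f ->
  (forall w, 0 <= f w) -> 0 <= a -> 0 <= b ->
  (\int[P]_w (a + b * f w)%:E = a%:E + b%:E * \int[P]_w (f w)%:E)%E.
Proof.
move=> mf f0 a0 b0.
have mbf : measurable_fun setT (fun w => (b * f w)%:E).
  by apply/measurable_EFinP; apply: measurable_funM.
have e1 : (\int[P]_w (a%:E + (b * f w)%:E) = \int[P]_w a%:E + \int[P]_w (b * f w)%:E)%E.
  by apply: ge0_integralD => //= w _; rewrite lee_fin// mulr_ge0.
apply: etrans e1 _; congr (_ + _)%E.
  by rewrite integral_cst// [X in (_ * X)%E]probability_setT mule1.
rewrite -ge0_integralZl//; first by apply/measurable_EFinP.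
by move=> w _; rewrite lee_fin.
Qed.

(** Integrate the tangent bound [sqrt y <= c / 2 + y / (2 c)] at [c = sqrt b + e]; the summand [e],
    sent to 0 at the end, keeps [c] positive when [b = 0]. *)
Lemma integral_sqrt_le (f : T -> R) b : measurable_fun setT f ->
  (forall w, 0 <= f w) -> 0 <= b -> (\int[P]_w (f w)%:E <= b%:E)%E ->
  (\int[P]_w (Num.sqrt (f w))%:E <= (Num.sqrt b)%:E)%E.
Proof.
move=> mf f0 b0 fb; apply/lee_addgt0Pr => e e0.
have sb0 := sqrtr_ge0 b; have bE := sqr_sqrtr b0.
set c := Num.sqrt b + e; have c0 : 0 < c by rewrite /c; lra.
have amgm w : Num.sqrt (f w) <= c / 2 + (2 * c)^-1 * f w.
  rewrite -[f w in leRHS](sqr_sqrtr (f0 w)); set y := Num.sqrt _.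
  have -> : c / 2 + (2 * c)^-1 * y ^+ 2 = y + (y - c) ^+ 2 / (2 * c) by field; lra.
  by rewrite lerDl divr_ge0 ?sqr_ge0//; lra.
have ic0 : 0 <= (2 * c)^-1 by rewrite invr_ge0; lra.
have c20 : 0 <= c / 2 by lra.
apply: (@le_trans _ _ (\int[P]_w (c / 2 + (2 * c)^-1 * f w)%:E)%E).
  apply: ge0_le_integral => //=.
  - by apply/measurable_EFinP; apply: measurable_sqrtr.
  - apply/measurable_EFinP; apply: measurable_funD => //.
    by apply: measurable_funM.
  - by move=> w _; rewrite lee_fin.
rewrite (integral_affine mf f0 c20 ic0).
apply: (@le_trans _ _ ((c / 2)%:E + (2 * c)^-1%:E * b%:E)%E).
  by apply: leeD2l; apply: lee_wpmul2l; rewrite ?lee_fin.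
rewrite -EFinM -!EFinD lee_fin -/c.
have -> : c / 2 + (2 * c)^-1 * b = c + (b - c ^+ 2) / (2 * c) by field; lra.
rewrite -[leRHS]addr0 lerD2l mulr_le0_ge0 ?invr_ge0//; last lra.
by rewrite -bE /c expr2; nra.
Qed.

Lemma markov_ge (f : T -> R) c D : measurable_fun setT f -> (forall w, 0 <= f w) ->
  0 < c -> (\int[P]_w (f w)%:E <= (c * D)%:E)%E ->
  (P [set w | (c <= f w)%R] <= D%:E)%E.
Proof.
move=> mf f0 c0 h; set S := [set w | _].
have mS : measurable S.
  have := measurable_preimage_itv `[c, +oo[ mf.
  by congr measurable; apply/seteqP; split=> w; rewrite /S /= in_itv/= andbT.
have : (c%:E * P S <= c%:E * D%:E)%E.
  apply: (@le_trans _ _ (\int[P]_w (f w)%:E)%E) => //.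
  rewrite -integral_cst//; apply: (@le_trans _ _ (\int[P]_(w in S) (f w)%:E)%E).
    apply: ge0_le_integral => //=.
    - by move=> w _; rewrite lee_fin ltW.
    - by apply/measurable_EFinP; apply: measurable_funTS.
  apply: ge0_subset_integral => //=; first by apply/measurable_EFinP.
  by move=> w _; rewrite lee_fin.
by rewrite lee_pmul2l// lte_fin.
Qed.

Lemma probability_ge_ae (A B : set T) D : measurable A -> measurable B ->
  (P B <= D%:E)%E -> (\forall w \ae P, ~ B w -> A w) -> ((1 - D)%:E <= P A)%E.
Proof.
move=> mA mB PB [N [mN N0 sub]].
have : (P (~` A) <= D%:E)%E.
  apply: (@le_trans _ _ (P (N `|` B))).
    apply: le_measure; rewrite ?inE; [exact: measurableC|exact: measurableU|].
    move=> w nA; have [Bw|nB] := pselect (B w); [by right|left].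
    by apply: sub => /= /(_ nB).
  apply: le_trans (measureU2 _ _ _) _ => //.
  by rewrite [X in (X + _)%E]N0 add0e.
move=> h; have -> : P A = (1 - P (~` A))%E.
  by rewrite -[in LHS](setCK A); apply: probability_setC; exact: measurableC.
by rewrite EFinB; apply: leeB.
Qed.
End Probability.

(** * Expectation and tail of the residual *)

Section Assembly.
Context {R : realType} {d : measure_display} {T : measurableType d}.
Variable P : probability T R.
Variables (m n k q l : nat) (A : 'M[R]_(m, n)) (U : 'M[R]_m) (Sigma : 'M[R]_(m, n)).
Variables (sigma : nat -> R) (V : 'M[R]_n) (G : T -> 'M[R]_(n, l)).
Hypothesis svd : is_svd A U Sigma sigma V.
Hypothesis hG : std_gaussian_mx P G.
Hypotheses (k0 : (0 < k)%N) (kr : (k < \rank A)%N) (kl : (k + 2 <= l)%N).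

Let Z w := A *m (A^T *m A) ^+ q *m G w.
Let err w := frobenius_norm ((1%:M - range_proj (Z w)) *m A).
Let F := frobenius_norm (trail_mx k Sigma).
Let rho := power_ratio sigma k q.
Let N := (l - k.-1)%N.

Let kn : (k <= n)%N.
Proof. by rewrite (leq_trans (ltnW kr))// rank_leq_col. Qed.

Let Y w := V^T *m G w.

Let iY : iid_normal P (fun (c : 'I_n * 'I_l) w => Y w c.1 c.2).
Proof. exact: std_gaussian_mx_rotate (svd_orthV svd). Qed.

(** Indexing by pairs makes [cross_sum] a single weighted sum of squares, the form [power_mean]
    takes; the weight ignores [c.2], so each row is counted [k] times. *)
Let wt (c : 'I_n * 'I_k) : R :=
  if (k <= c.1)%N && (c.1 < m)%N then sigma c.1.+1 ^+ 2 else 0.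

Let coef (c : 'I_n * 'I_k) w : R := `|cross_coef kn c.1 c.2 (Y w)|.

Let wt_ge0 c : 0 <= wt c.
Proof. by rewrite /wt; case: (_ && _) => //; exact: sqr_ge0. Qed.

Let sum_wt : \sum_c wt c = k%:R * F ^+ 2.
Proof.
rewrite (sqr_frobenius_trail_sigma svd) mulr_sumr [RHS]big_mkcond /=.
rewrite (eq_bigr (fun c => wt (c.1, c.2))) => [|[]//].
rewrite -(pair_bigA _ (fun i j => wt (i, j))) /=; apply: eq_bigr => e _.
rewrite /wt /= sumr_const card_ord.
by case: (_ && _); rewrite ?mul0rn// mulr_natl.
Qed.

Let measurable_coef c s : measurable_fun setT (fun w => coef c w ^+ s).
Proof.
apply: measurable_funX; apply: measurableT_comp; first exact: normr_measurable.
exact: measurable_cross_coef iY _ _ _.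
Qed.

Let measurable_weighted s : measurable_fun setT (fun w => \sum_c wt c * coef c w ^+ s).
Proof. by apply: measurable_sum => c; apply: measurable_funM. Qed.

Let weighted_ge0 s w : 0 <= \sum_c wt c * coef c w ^+ s.
Proof. by apply: sumr_ge0 => c _; rewrite mulr_ge0// exprn_ge0 ?normr_ge0. Qed.

Lemma weighted_moment s : (s < N)%N ->
  (\int[P]_w (\sum_c wt c * coef c w ^+ s)%:E <=
   (k%:R * F ^+ 2 * (gmom s * cmom N s))%:E)%E.
Proof.
move=> sN; rewrite -sum_wt.
apply: (integral_weighted_sum_le (f := fun c w => coef c w ^+ s)) => //.
  by move=> c w; rewrite exprn_ge0 ?normr_ge0.
move=> c; rewrite /wt; case: (boolP (_ && _)) => [/andP[kc _] _|]; last by rewrite eqxx.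
by apply: (cross_coef_moment iY) => //; lia.
Qed.

Let rho_ge0 : 0 <= rho.
Proof. exact: (power_ratio_ge0 svd q k0 kr). Qed.

Let F_ge0 : 0 <= F := frobenius_ge0 _.

Lemma residual_bound_ae : \forall w \ae P,
  err w <= F + rho * Num.sqrt (\sum_c wt c * coef c w ^+ 2).
Proof.
have kl' : (k <= l)%N by lia.
apply: filterS (lead_rows_unit iY kn kl') => w uw.
have HOm (e : 'I_n) (a : 'I_k) : (e < k)%N -> \sum_c Y w e c * gram_inv (lead_rows kn (Y w)) a c =
    (e == a :> nat)%:R by move=> ek; exact: cross_coef_lead.
have := deterministic_bound svd q k0 kr HOm.
congr (_ <= _ + _ * Num.sqrt _).
rewrite /cross_sum big_mkcond [RHS](eq_bigr (fun c => wt (c.1, c.2) * coef (c.1, c.2) w ^+ 2)) => [|[]//].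
rewrite -(pair_bigA _ (fun i j => wt (i, j) * coef (i, j) w ^+ 2)) /=; apply: eq_bigr => e _.
rewrite /wt /=; case: (_ && _); last by rewrite big1// => a _; rewrite mul0r.
by rewrite mulr_sumr; apply: eq_bigr => a _; rewrite /coef real_normK ?num_real.
Qed.

Lemma measurable_err : measurable_fun setT err.
Proof.
apply: measurable_residual => i j.
under eq_fun do rewrite mxE.
apply: measurable_sum => e; apply: measurable_funM => //.
exact: measurable_std_gaussian_mx hG _ _.
Qed.

Lemma expectation_residual_le :
  ('E_P[err] <= ((1 + (sigma k.+1 / sigma k) ^+ (2 * q)
     * Num.sqrt (k%:R / (l - k - 1)%:R)) * F)%:E)%E.
Proof.
pose S w := Num.sqrt (\sum_c wt c * coef c w ^+ 2).
have mS : measurable_fun setT S by exact: measurable_sqrtr.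
have S0 w : 0 <= S w by exact: sqrtr_ge0.
have N2 : (2 < N)%N by rewrite /N; lia.
(* The second moment of a normal variable times that of the inverse chi variable; [N - 2] is
   [l - k - 1], the denominator in the bound. *)
have momE : gmom 2 * cmom N 2 = (N - 2)%:R^-1 :> R by rewrite /= !mul1r.
have := weighted_moment N2; rewrite momE.
have b0 : 0 <= k%:R * F ^+ 2 / (N - 2)%:R.
  by rewrite divr_ge0// mulr_ge0// sqr_ge0.
move=> /(integral_sqrt_le (measurable_weighted 2) (weighted_ge0 2) b0).
have -> : Num.sqrt (k%:R * F ^+ 2 / (N - 2)%:R) = Num.sqrt (k%:R / (l - k - 1)%:R) * F.
  have -> : (N - 2 = l - k - 1)%N by rewrite /N; lia.
  by rewrite mulrAC sqrtrM ?divr_ge0// sqrtr_sqr ger0_norm.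
move=> hS; have -> : ((1 + (sigma k.+1 / sigma k) ^+ (2 * q)
     * Num.sqrt (k%:R / (l - k - 1)%:R)) * F)%:E =
   (F%:E + rho%:E * (Num.sqrt (k%:R / (l - k - 1)%:R) * F)%:E)%E.
  by rewrite mulrDl mul1r EFinD -mulrA EFinM.
apply: (@le_trans _ _ (\int[P]_w (F + rho * S w)%:E)%E).
  rewrite unlock; apply: ae_ge0_le_integral => //.
  - by move=> w _; rewrite lee_fin; exact: frobenius_ge0.
  - by apply/measurable_EFinP; exact: measurable_err.
  - by move=> w _; rewrite lee_fin addr_ge0// mulr_ge0.
  - apply/measurable_EFinP; apply: measurable_funD => //.
    by apply: measurable_funM.
  - by apply: filterS residual_bound_ae => w h _; rewrite lee_fin.
rewrite (integral_affine P mS S0 F_ge0 rho_ge0).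
by apply: leeD2l; apply: lee_wpmul2l; rewrite ?lee_fin.
Qed.

Lemma probability_residual_le (u t : R) : (k + 4 <= l)%N -> 1 <= u -> 1 <= t ->
  ((1 - expR (- (u ^+ 2 / 2)) - t ^- (l - k))%:E <=
   P [set w | (err w <= (1 + Num.sqrt 3 * u * t * (sigma k.+1 / sigma k) ^+ (2 * q)
     * Num.sqrt (k%:R / (l - k + 1)%:R)) * F)%R])%E.
Proof.
move=> kl4 u1 t1.
have N5 : (5 <= N)%N by rewrite /N; lia.
have NE : (N = l - k + 1)%N by rewrite /N; lia.
have Np : (N.-1 = l - k)%N by rewrite /N; lia.
have [s [/andP[s2 sN] hs]] := gauss_tail_numerics N5 u1 t1.
rewrite Np in hs; set D := expR _ + _ in hs.
(* Chosen so that [rho * Num.sqrt (W * a ^+ 2)] is exactly the allowed excess over [F]; its inverse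
   is the base raised to the power [s] in [gauss_tail_numerics]. *)
pose a : R := Num.sqrt 3 * u * t / Num.sqrt N%:R.
have sN0 : 0 < Num.sqrt N%:R :> R by rewrite sqrtr_gt0 ltr0n; lia.
have a0 : 0 < a by rewrite divr_gt0// !mulr_gt0 ?sqrtr_gt0//; lra.
pose W : R := k%:R * F ^+ 2.
have W0 : 0 <= W by rewrite mulr_ge0 ?sqr_ge0.
pose S w := \sum_c wt c * coef c w ^+ 2.
have mE c : measurable [set w | (err w <= c)%R].
  have := measurable_preimage_itv `]-oo, c] measurable_err.
  by congr measurable; apply/seteqP; split=> w; rewrite /= in_itv.
have mB : measurable [set w | W * a ^+ 2 < S w].
  have := measurable_preimage_itv `]W * a ^+ 2, +oo[ (measurable_weighted 2).
  by congr measurable; apply/seteqP; split=> w; rewrite /= in_itv/= andbT.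
have -> : 1 - expR (- (u ^+ 2 / 2)) - t ^- (l - k) = 1 - D by rewrite /D opprD addrA.
apply: (probability_ge_ae (mE _) mB); last first.
  apply: filterS residual_bound_ae => w h /= /negP; rewrite -leNgt => Sle.
  apply: le_trans h _; rewrite mulrDl mul1r lerD2l.
  apply: (@le_trans _ _ (rho * Num.sqrt (W * a ^+ 2))).
    by apply: ler_wpM2l => //; rewrite ler_sqrt// mulr_ge0 ?sqr_ge0.
  rewrite /W sqrtrM ?mulr_ge0 ?sqr_ge0// sqrtrM// !sqrtr_sqr !ger0_norm ?(ltW a0)//.
  by rewrite -NE sqrtrM// sqrtrV// /a /rho /power_ratio le_eqVlt; apply/orP; left; apply/eqP; ring.
(* Markov's inequality divides by [W * a ^+ s]. When [W = 0] all weights vanish, so [S] is 0 and the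
   exceptional event is empty. *)
have [W00|Wn0] := eqVneq W 0.
  rewrite (_ : mkset _ = set0) ?measure0 ?lee_fin.
    by rewrite addr_ge0 ?expR_ge0// invr_ge0 exprn_ge0//; lra.
  apply/seteqP; split=> // w /=; rewrite W00 mul0r /S big1 ?ltxx// => c _.
  have /eqP := sum_wt; rewrite -/W W00 psumr_eq0// => /allP/(_ c).
  by rewrite mem_index_enum => /(_ isT) /eqP ->; rewrite mul0r.
have Wp : 0 < W by rewrite lt_neqAle eq_sym Wn0.
have c0 : 0 < W * a ^+ s by rewrite mulr_gt0// exprn_gt0.
apply: (@le_trans _ _ (P [set w | (W * a ^+ s <= \sum_c wt c * coef c w ^+ s)%R])).
  apply: le_measure; rewrite ?inE; first exact: mB.
    have := measurable_preimage_itv `[W * a ^+ s, +oo[ (measurable_weighted s).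
    by congr measurable; apply/seteqP; split=> w; rewrite /= in_itv/= andbT.
  move=> w /= h; rewrite /W -sum_wt; apply: power_mean => //.
  - by move=> c; exact: normr_ge0.
  - exact: ltW.
  - by rewrite sum_wt; exact: ltW.
apply: markov_ge (measurable_weighted s) (weighted_ge0 s) c0 _.
apply: le_trans (weighted_moment sN) _; rewrite lee_fin -/W -(mulrA W).
apply: ler_wpM2l => //.
apply: (@le_trans _ _ (a ^+ s * (gmom s * cmom N s * (Num.sqrt N%:R / (Num.sqrt 3 * u * t)) ^+ s))).
  rewrite -[Num.sqrt N%:R / _]invf_div -/a exprVn mulrCA mulfV ?mulr1//.
  by rewrite gt_eqF// exprn_gt0.
by apply: ler_wpM2l => //; rewrite exprn_ge0// ltW.
Qed.

End Assembly.

Theorem corollary4p2 (R : realType) (d : measure_display) (T : measurableType d)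
    (P : probability T R) (m n k q l : nat)
    (A : 'M[R]_(m, n)) (U : 'M[R]_m) (Sigma : 'M[R]_(m, n))
    (sigma : nat -> R) (V : 'M[R]_n) (G : T -> 'M[R]_(n, l))
    (hk : (1 <= k)%N) (hl : (l <= \rank A)%N)
    (hsvd : is_svd A U Sigma sigma V)
    (hG : std_gaussian_mx P G) :
  let Z := fun w => A *m (A^T *m A) ^+ q *m G w in
  let err := fun w => frobenius_norm ((1%:M - range_proj (Z w)) *m A) in
  ((k + 2 <= l)%N ->
    ('E_P[err] <=
      ((1 + (sigma k.+1 / sigma k) ^+ (2 * q)
            * Num.sqrt (k%:R / (l - k - 1)%:R))
       * frobenius_norm (trail_mx k Sigma))%:E)%E) /\
  ((k + 4 <= l)%N -> forall u t : R, 1 <= u -> 1 <= t ->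
    ((1 - expR (- (u ^+ 2 / 2)) - t ^- (l - k))%:E <=
     P [set w | (err w <=
       (1 + Num.sqrt 3 * u * t * (sigma k.+1 / sigma k) ^+ (2 * q)
            * Num.sqrt (k%:R / (l - k + 1)%:R))
       * frobenius_norm (trail_mx k Sigma))%R])%E).
Proof.
move=> Z err; split=> [kl|kl u t u1 t1].
  (* This makes [sigma k] positive, so the quotient is a genuine one, and keeps [k.+1] within the
     range of the singular values. *)
  have kr : (k < \rank A)%N by lia.
  exact: (expectation_residual_le q hsvd hG).
have kr : (k < \rank A)%N by lia.
have kl2 : (k + 2 <= l)%N by lia.
exact: (probability_residual_le q hsvd hG).
Qed.
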